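(* Let $\rho>0$, let $(x_1,y_1),(x_2,y_2)\in\mathbb{R}^2$ be two targets, and let $\Theta_k=[\theta_k^{min},\theta_k^{max}]\subseteq[0,2\pi]$ with $\theta_k^{min}<\theta_k^{max}$, and $\Theta_k^o=(\theta_k^{min},\theta_k^{max})$, for $k=1,2$. Consider all paths from $(x_1,y_1)$ to $(x_2,y_2)$ that are $C^1$ and piecewise $C^2$, whose radius of curvature is at least $\rho$ at every point, whose departure angle $\theta_d$ at target 1 lies in $\Theta_1$ and whose arrival angle $\theta_a$ at target 2 lies in $\Theta_2$. Then any shortest path among these must be one of the following, or a degenerate form of one of these: 1. $S$ or $L_\psi$ or $R_\psi$ or $L_\psi R_\psi$ or $R_\psi L_\psi$ with $\psi>\pi$. 2. $\theta_d=\theta_1^{max}$ and $\theta_a=\theta_2^{max}$ and the path is $LSR$. 3. $\theta_d=\theta_1^{max}$ and $\theta_a=\theta_2^{min}$ and the path is either $LSL$ or $LR_\psi L$ with $\psi>\pi$. 4. $\theta_d=\theta_1^{min}$ and $\theta_a=\theta_2^{min}$ and the path is $RSL$. 5. $\theta_d=\theta_1^{min}$ and $\theta_a=\theta_2^{max}$ and the path is either $RSR$ or $RL_\psi R$ with $\psi>\pi$. 6. $\theta_d=\theta_1^{max}$ and $\theta_a\in\Theta_2^o$ and the path is either $LS$ or $LR_\psi$ with $\psi>\pi$. 7. $\theta_d=\theta_1^{min}$ and $\theta_a\in\Theta_2^o$ and the path is either $RS$ or $RL_\psi$ with $\psi>\pi$. 8. $\theta_d\in\Theta_1^o$ and $\theta_a=\theta_2^{max}$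 and the path is either $SR$ or $L_\psi R$ with $\psi>\pi$. 9. $\theta_d\in\Theta_1^o$ and $\theta_a=\theta_2^{min}$ and the path is either $SL$ or $R_\psi L$ with $\psi>\pi$.
   Context: Angles (headings) are measured from the positive $x$-axis, counterclockwise positive; a heading is a direction of travel, so it is identified modulo $2\pi$ and lies in $\Theta_k$ if it has a representative in $\Theta_k\subseteq[0,2\pi]$. The departure angle is the heading of the path at its start, the arrival angle the heading at its end. Path types: $L$ denotes a circular arc of radius $\rho$ traversed counterclockwise, $R$ a circular arc of radius $\rho$ traversed clockwise, and $S$ a straight line segment. A word such as $LSR$ denotes the ($C^1$) concatenation of the segments in the given order. A subscript, as in $L_\psi$ or $R_\psi$, indicates the angle of turn $\psi$ of that arc; if $\psi$ appears twice in a word (as in $L_\psi R_\psi$) both arcs have the same angle of turn. A degenerate form of a path type is one obtained by letting one or more of its segments have zero length, i.e. deleting them; e.g. the degenerate forms of $RSL$ are $S$, $L$, $R$, $RS$, $SL$ and $RL$. Subscripted arcs that are retained keep their stated condition on $\psi$. *)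

(* Defs.v *)
(* Stdlib real numbers with Coquelicot derivatives. *)
From Stdlib Require Import Reals List.
From Coquelicot Require Import Coquelicot.
Import ListNotations.
Open Scope R_scope.

Definition C1 (f : R -> R) : Prop :=
  forall t, ex_derive f t /\ continuous (Derive f) t.

Definition C2 (f : R -> R) : Prop :=
  forall t, ex_derive f t /\ ex_derive (Derive f) t /\
            continuous (Derive_n f 2) t.

(* A path is parametrized by arc length on [0, len].  The values outside
   [0, len] are irrelevant: they only make two-sided derivatives available at
   the end points, and every C^1 function on [0, len] extends to a C^1 function
   on the line. *)
Record path := mkPath { len : R; px : R -> R; py : R -> R }.

Definition unit_speed (g : path) : Prop :=
  forall t, 0 <= t <= len g ->
    Derive (px g) t ^ 2 + Derive (py g) t ^ 2 = 1.

(* Signed curvature of a curve at a time where it has unit speed. *)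
Definition curvature (X Y : R -> R) (t : R) : R :=
  Derive X t * Derive_n Y 2 t - Derive Y t * Derive_n X 2 t.

(* [0, len] is cut into finitely many closed intervals, on each of which the
   path is C^2 up to the end points (it agrees there with a C^2 curve X, Y) and
   has radius of curvature 1 / |curvature| >= rho (infinite radius if the
   curvature is 0).  At a cut point this constrains both one-sided
   curvatures. *)
Definition piecewise_C2_radius_ge (rho : R) (g : path) : Prop :=
  exists (n : nat) (s : nat -> R),
    s 0%nat = 0 /\ s n = len g /\
    forall i, (i < n)%nat ->
      s i < s (S i) /\
      exists X Y : R -> R,
        C2 X /\ C2 Y /\
        forall t, s i <= t <= s (S i) ->
          px g t = X t /\ py g t = Y t /\
          (curvature X Y t = 0 \/ rho <= / Rabs (curvature X Y t)).

(* th represents, modulo 2 pi, the direction of travel of g at time t. *)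
Definition heading (g : path) (t th : R) : Prop :=
  Derive (px g) t = cos th /\ Derive (py g) t = sin th.

Definition departs (g : path) (th : R) : Prop := heading g 0 th.
Definition arrives (g : path) (th : R) : Prop := heading g (len g) th.

(* The constant path has no heading, hence 0 < len g even if the two targets
   coincide. *)
Definition feasible (rho x1 y1 x2 y2 t1min t1max t2min t2max : R)
    (g : path) : Prop :=
  0 < len g /\ C1 (px g) /\ C1 (py g) /\ unit_speed g /\
  piecewise_C2_radius_ge rho g /\
  px g 0 = x1 /\ py g 0 = y1 /\
  px g (len g) = x2 /\ py g (len g) = y2 /\
  (exists td, t1min <= td <= t1max /\ departs g td) /\
  (exists ta, t2min <= ta <= t2max /\ arrives g ta).

Definition shortest (rho x1 y1 x2 y2 t1min t1max t2min t2max : R)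
    (g : path) : Prop :=
  feasible rho x1 y1 x2 y2 t1min t1max t2min t2max g /\
  forall h, feasible rho x1 y1 x2 y2 t1min t1max t2min t2max h ->
    len g <= len h.

Definition is_segment (g : path) (a b : R) : Prop :=
  exists th, forall t, a <= t <= b ->
    px g t = px g a + (t - a) * cos th /\ py g t = py g a + (t - a) * sin th.

Definition is_ccw_arc (rho : R) (g : path) (a b : R) : Prop :=
  exists cx cy phi, forall t, a <= t <= b ->
    px g t = cx + rho * cos (phi + (t - a) / rho) /\
    py g t = cy + rho * sin (phi + (t - a) / rho).

Definition is_cw_arc (rho : R) (g : path) (a b : R) : Prop :=
  exists cx cy phi, forall t, a <= t <= b ->
    px g t = cx + rho * cos (phi - (t - a) / rho) /\
    py g t = cy + rho * sin (phi - (t - a) / rho).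

(* Llet_psi and Rlet_psi are the subscripted arcs: their angle of turn, i.e.
   their length divided by rho, is the angle psi shared by the whole word. *)
Inductive letter := Llet | Rlet | Slet | Llet_psi | Rlet_psi.

Definition traces (rho psi : R) (g : path) (c : letter) (a b : R) : Prop :=
  match c with
  | Llet => is_ccw_arc rho g a b
  | Rlet => is_cw_arc rho g a b
  | Slet => is_segment g a b
  | Llet_psi => is_ccw_arc rho g a b /\ (b - a) / rho = psi
  | Rlet_psi => is_cw_arc rho g a b /\ (b - a) / rho = psi
  end.

Fixpoint follows (rho psi : R) (g : path) (w : list letter) (a b : R) : Prop :=
  match w with
  | [] => a = b
  | c :: w' => exists m, a < m <= b /\
      traces rho psi g c a m /\ follows rho psi g w' m b
  end.

Fixpoint subwords (w : list letter) : list (list letter) :=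
  match w with
  | [] => [[]]
  | c :: w' => map (cons c) (subwords w') ++ subwords w'
  end.

(* The path is of type w, or of a degenerate form of w obtained by deleting
   letters, for some psi > pi.  The empty word is never followed by a path of
   positive length. *)
Definition of_type (rho : R) (g : path) (w : list letter) : Prop :=
  exists psi, PI < psi /\
  exists w', In w' (subwords w) /\ follows rho psi g w' 0 (len g).

(* Main.v *)
Require Import Defs.
From Stdlib Require Import Reals List Lra Lia.
From Coquelicot Require Import Coquelicot.
Import ListNotations.
Open Scope R_scope.

(* After scaling to [rho = 1], a path is a heading function [th] with [|th'| <= 1].
   On a window of length at most 1/4, compare it with the arc-segment-arc path of
   the same length and the same end headings, the middle heading [phi] being
   chosen, by the intermediate value theorem, such that both paths have the same
   displacement across [phi].  The comparison path is pointwise closer to [phi], so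
   it advances further along [phi], by some [d] which does not exceed the length of
   its segment; cutting [d] off the segment gives a shorter path unless the two
   coincide.  Hence a shortest path is a finite word of arcs and segments.

   Such a word is then compared with explicit variations.  An arc end is "soft" if
   the heading there can be moved in the direction that shortens the arc: either it
   is an end point of the path at which the heading is not blocked by its interval,
   or the next arc has the opposite orientation.  A shortest word satisfies:
   - an arc both of whose ends are soft turns by more than pi;
   - a segment is not followed by an arc whose other end is soft or is another
     segment;
   - if one arc follows another and its far end is soft, it is at least as long;
   - two consecutive arcs of equal turn, the first with a soft far end, end the path.
   With their mirror images and time reversals, these rules leave exactly the listed
   words. *)

(** * One-sided limits and trigonometry *)

(** Minimality is only ever tested against finite words, through [optimal]; [wr_conn] realizes such
    words as paths once and for all, so every variation becomes trigonometry of lengths and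
    displacements. A move must restore both components of the displacement exactly. The quantities
    that do so are solved for in closed form or by a continuity argument, and only the length is
    estimated: by comparing arc and chord, from a one-sided derivative at 0, or, where two equal
    arcs make that derivative vanish, at second order. The weight [w] in [fsoft] and [bsoft] unifies
    the two kinds of softness. Shifting a junction by [t] takes a turn [t] off the arc under study.
    An opposite neighbour loses a turn [t] as well, with the same displacement, so that in all
    [w * t] of length and [w] copies of one small displacement disappear. The bound 1/4 on a window
    keeps its headings and [phi] within 1/4 of the initial heading, hence within 1/2 of each other.
    There [|sin| <= cos], so [cos - sin] is decreasing and nonnegative. *)

Lemma locally_lt (f : R -> R) c : continuous f 0 -> f 0 < c -> locally 0 (fun s => f s < c).
Proof. intros Hf Hc. apply (Hf (fun y => y < c)). exact (open_lt c _ Hc). Qed.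

Lemma locally_gt (f : R -> R) c : continuous f 0 -> c < f 0 -> locally 0 (fun s => c < f s).
Proof. intros Hf Hc. apply (Hf (fun y => c < y)). exact (open_gt c _ Hc). Qed.

Lemma at_right_of_locally (P : R -> Prop) : locally 0 P -> at_right 0 P.
Proof. apply filter_le_within. Qed.

Lemma at_right_lt (f : R -> R) c : continuous f 0 -> f 0 < c -> at_right 0 (fun s => f s < c).
Proof. intros; apply at_right_of_locally, locally_lt; auto. Qed.
Lemma at_right_gt (f : R -> R) c : continuous f 0 -> c < f 0 -> at_right 0 (fun s => c < f s).
Proof. intros; apply at_right_of_locally, locally_gt; auto. Qed.

Lemma at_right_pos : at_right 0 (fun s => 0 < s).
Proof. exists (mkposreal 1 Rlt_0_1). intros; auto. Qed.
Lemma at_right_le d : 0 < d -> at_right 0 (fun s => s <= d).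
Proof.
  intros Hd. apply filter_imp with (fun s => s < d); [intros; lra|].
  apply (at_right_lt (fun s => s)); [apply continuous_id|auto].
Qed.

Lemma at_right_ex (P : R -> Prop) : at_right 0 P -> exists s, P s.
Proof. apply (@Hierarchy.filter_ex _ _ (at_right_proper_filter 0)). Qed.

(** How an infinitesimal variation is exploited: a strictly negative rate at 0 yields a real gain
    for all small positive parameters, and the side conditions that hold near 0 are intersected with
    it in the filter [at_right 0]. *)
Lemma at_right_decr (f : R -> R) l c :
  is_derive f 0 l -> l < 0 -> f 0 = c -> at_right 0 (fun s => f s < c).
Proof.
  intros Hf Hl <-. apply is_derive_Reals in Hf.
  destruct (Hf (- l / 2)) as [d Hd]; [lra|].
  exists d. intros s Hs Hs0.
  assert (Hsd : Rabs s < d).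
  { change (Rabs (s - 0) < d) in Hs. now rewrite Rminus_0_r in Hs. }
  specialize (Hd s ltac:(lra) Hsd). rewrite Rplus_0_l in Hd.
  apply Rabs_def2 in Hd as [Hd _].
  assert ((f s - f 0) / s < l / 2) by lra.
  assert (f s - f 0 < l / 2 * s).
  { replace (f s - f 0) with ((f s - f 0) / s * s) by (field; lra).
    apply Rmult_lt_compat_r; auto. }
  assert (l / 2 * s < 0) by (apply Ropp_lt_cancel; rewrite Ropp_0, Ropp_mult_distr_l; apply Rmult_lt_0_compat; lra).
  lra.
Qed.

Lemma at_right_incr (f : R -> R) l c :
  is_derive f 0 l -> 0 < l -> f 0 = c -> at_right 0 (fun s => c < f s).
Proof.
  intros Hf Hl <-.
  apply filter_imp with (fun s => - f s < - f 0); [intros; lra|].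
  apply (at_right_decr (fun s => - f s) (- l)); [|lra|auto].
  now apply (is_derive_opp f).
Qed.

Lemma is_derive_acos x : -1 < x < 1 -> is_derive acos x (-1 / sqrt (1 - x²)).
Proof.
  intros Hx. apply is_derive_Reals. rewrite <- (derive_pt_acos x Hx).
  apply (proj2_sig (derivable_pt_acos x Hx)).
Qed.

Lemma derive_continuous (f : R -> R) x l : is_derive f x l -> continuous f x.
Proof. intros H. apply (ex_derive_continuous (V := R_NormedModule) f). now exists l. Qed.

Lemma sin_neg_interval a : PI < a < 2 * PI -> sin a < 0.
Proof. intros; apply sin_lt_0; lra. Qed.

(* [A s] is the solution in (PI, 2 PI) of [cos (A s) = k s]. *)
Lemma inverse_cos (k : R -> R) k' a :
  is_derive k 0 k' -> k 0 = cos a -> PI < a < 2 * PI ->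
  exists A, A 0 = a /\ is_derive A 0 (- k' / sin a) /\ locally 0 (fun s => cos (A s) = k s).
Proof.
  intros Hk Hk0 Ha. pose proof (sin_neg_interval a Ha) as Hs.
  assert (Hc : -1 < cos a < 1).
  { pose proof (sin2_cos2 a) as H. unfold Rsqr in H. nra. }
  (* [acos] takes its values in [0, PI]; its reflection in PI is the branch through [a], which
     exceeds PI. *)
  exists (fun s => 2 * PI - acos (k s)). split; [|split].
  - rewrite Hk0. replace (cos a) with (cos (2 * PI - a)).
    + rewrite acos_cos; lra.
    + rewrite cos_minus, cos_2PI, sin_2PI. ring.
  - replace (- k' / sin a) with (0 - k' * (-1 / sqrt (1 - (k 0)²))).
    + apply (is_derive_minus (fun _ => 2 * PI) (fun s => acos (k s))).
      * apply (is_derive_const (V := R_NormedModule)).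
      * apply (is_derive_comp acos k).
        -- apply is_derive_acos. now rewrite Hk0.
        -- exact Hk.
    + rewrite Hk0. replace (1 - (cos a)²) with ((- sin a)²).
      * rewrite sqrt_Rsqr by lra. field. lra.
      * rewrite <- Rsqr_neg. pose proof (sin2_cos2 a). lra.
  - apply filter_imp with (fun s => -1 < k s /\ k s < 1).
    + intros s Hks. replace (cos (2 * PI - acos (k s))) with (cos (acos (k s))).
      * apply cos_acos; lra.
      * rewrite cos_minus, cos_2PI, sin_2PI. ring.
    + apply derive_continuous in Hk.
      apply filter_and; [apply locally_gt|apply locally_lt]; auto; lra.
Qed.

(** An arc of turn [t] advances by strictly less than its length in a fixed direction; this
    strictness is the gain when turns are traded for a segment. *)
Lemma sin_diff_lt x t : 0 < t -> sin x - sin (x - t) < t.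
Proof.
  intros Ht.
  replace (sin x - sin (x - t)) with (2 * sin (t / 2) * cos (x - t / 2)).
  2:{ replace (sin x) with (sin ((x - t/2) + t/2)) by (f_equal; lra).
      replace (sin (x - t)) with (sin ((x - t/2) - t/2)) by (f_equal; lra).
      rewrite (sin_plus (x - t/2)), (sin_minus (x - t/2)). ring. }
  pose proof (COS_bound (x - t/2)).
  destruct (Rle_lt_dec (t/2) PI) as [H'|H'].
  - pose proof (sin_lt_x (t/2) ltac:(lra)). pose proof (sin_ge_0 (t/2) ltac:(lra) H').
    nra.
  - pose proof (SIN_bound (t/2)). pose proof PI2_3_2. nra.
Qed.

(** * Words of arcs and segments *)

(* [wr u v L X Y]: for the turning radius 1, some word leads from heading [u] to
   heading [v] (both modulo 2 PI) with length [L] and displacement [(X, Y)]. *)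
Inductive wr : R -> R -> R -> R -> R -> Prop :=
| wr_refl u v : cos u = cos v -> sin u = sin v -> wr u v 0 0 0
| wr_left u t : 0 <= t -> wr u (u + t) t (sin (u + t) - sin u) (cos u - cos (u + t))
| wr_right u t : 0 <= t -> wr u (u - t) t (sin u - sin (u - t)) (cos (u - t) - cos u)
| wr_line u t : 0 <= t -> wr u u t (t * cos u) (t * sin u)
| wr_trans u v w L1 X1 Y1 L2 X2 Y2 :
    wr u v L1 X1 Y1 -> wr v w L2 X2 Y2 -> wr u w (L1 + L2) (X1 + X2) (Y1 + Y2).

Lemma wr_eq u v L X Y u' v' L' X' Y' :
  wr u v L X Y -> u = u' -> v = v' -> L = L' -> X = X' -> Y = Y' -> wr u' v' L' X' Y'.
Proof. intros; subst; assumption. Qed.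

Lemma wr_mirror u v L X Y : wr u v L X Y -> wr (- u) (- v) L X (- Y).
Proof.
  induction 1 as [u v Hc Hs|u t Ht|u t Ht|u t Ht|u v w L1 X1 Y1 L2 X2 Y2 _ IH1 _ IH2].
  - apply wr_eq with (-u) (-v) 0 0 0; try lra.
    apply wr_refl; rewrite ?cos_neg, ?sin_neg; lra.
  - eapply wr_eq; [apply (wr_right (-u) t Ht)| | | | |]; try lra.
    + replace (- u - t) with (- (u + t)) by ring. rewrite !sin_neg. ring.
    + replace (- u - t) with (- (u + t)) by ring. rewrite !cos_neg. ring.
  - eapply wr_eq; [apply (wr_left (-u) t Ht)| | | | |]; try lra.
    + replace (- u + t) with (- (u - t)) by ring. rewrite !sin_neg. ring.
    + replace (- u + t) with (- (u - t)) by ring. rewrite !cos_neg. ring.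
  - eapply wr_eq; [apply (wr_line (-u) t Ht)| | | | |]; rewrite ?cos_neg, ?sin_neg; try lra.
  - eapply wr_eq; [apply (wr_trans _ _ _ _ _ _ _ _ _ IH1 IH2)| | | | |]; lra.
Qed.

(* Time reversal followed by the point reflection of the plane keeps the headings. *)
Lemma wr_reverse u v L X Y : wr u v L X Y -> wr v u L X Y.
Proof.
  induction 1 as [u v Hc Hs|u t Ht|u t Ht|u t Ht|u v w L1 X1 Y1 L2 X2 Y2 _ IH1 _ IH2].
  - apply wr_refl; auto.
  - eapply wr_eq; [apply (wr_right (u + t) t Ht)| | | | |]; try lra;
    replace (u + t - t) with u by ring; lra.
  - eapply wr_eq; [apply (wr_left (u - t) t Ht)| | | | |]; try lra;
    replace (u - t + t) with u by ring; lra.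
  - apply wr_line; auto.
  - eapply wr_eq; [apply (wr_trans _ _ _ _ _ _ _ _ _ IH2 IH1)| | | | |]; lra.
Qed.

Lemma wr_len_ge u v L X Y : wr u v L X Y -> 0 <= L.
Proof. induction 1; lra. Qed.

Inductive dir := Lf | Rt | St.
Definition sg d := match d with Lf => 1 | Rt => -1 | St => 0 end.
Definition dX d u t := match d with
  Lf => sin (u + t) - sin u | Rt => sin u - sin (u - t) | St => t * cos u end.
Definition dY d u t := match d with
  Lf => cos u - cos (u + t) | Rt => cos (u - t) - cos u | St => t * sin u end.

Definition word := list (dir * R).
Fixpoint turn (w : list (dir * R)) : R := match w with [] => 0 | (d, t) :: w' => sg d * t + turn w' end.
Fixpoint wlen (w : list (dir * R)) : R := match w with [] => 0 | (d, t) :: w' => t + wlen w' end.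
Fixpoint wX (u : R) (w : word) :=
  match w with [] => 0 | (d, t) :: w' => dX d u t + wX (u + sg d * t) w' end.
Fixpoint wY (u : R) (w : word) :=
  match w with [] => 0 | (d, t) :: w' => dY d u t + wY (u + sg d * t) w' end.
Definition nonneg_word (w : word) := List.Forall (fun p => 0 <= snd p) w.
Definition positive_word (w : word) := List.Forall (fun p => 0 < snd p) w.

Lemma turn_app p q : turn (p ++ q) = turn p + turn q.
Proof. induction p as [|[d t] p IH]; simpl; [lra|rewrite IH; lra]. Qed.
Lemma wlen_app p q : wlen (p ++ q) = wlen p + wlen q.
Proof. induction p as [|[d t] p IH]; simpl; [lra|rewrite IH; lra]. Qed.
Lemma wX_app u p q : wX u (p ++ q) = wX u p + wX (u + turn p) q.
Proof.
  revert u; induction p as [|[d t] p IH]; simpl; intros u.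
  - rewrite Rplus_0_r; lra.
  - rewrite IH, (Rplus_assoc u). lra.
Qed.
Lemma wY_app u p q : wY u (p ++ q) = wY u p + wY (u + turn p) q.
Proof.
  revert u; induction p as [|[d t] p IH]; simpl; intros u.
  - rewrite Rplus_0_r; lra.
  - rewrite IH, (Rplus_assoc u). lra.
Qed.

Lemma positive_nonneg w : positive_word w -> nonneg_word w.
Proof. apply Forall_impl. intros; lra. Qed.

Lemma wlen_ge w : nonneg_word w -> 0 <= wlen w.
Proof. induction 1 as [|[d t] w H _ IH]; simpl in *; lra. Qed.

Lemma wr_letter d u t : 0 <= t -> wr u (u + sg d * t) t (dX d u t) (dY d u t).
Proof.
  intros Ht. destruct d; simpl.
  - eapply wr_eq; [apply (wr_left u t Ht)|..]; auto; lra.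
  - eapply wr_eq; [apply (wr_right u t Ht)|..]; auto; lra.
  - eapply wr_eq; [apply (wr_line u t Ht)|..]; auto; lra.
Qed.

Lemma wr_word w u : nonneg_word w -> wr u (u + turn w) (wlen w) (wX u w) (wY u w).
Proof.
  intros H; revert u; induction H as [|[d t] w Ht _ IH]; intros u; simpl in *.
  - rewrite Rplus_0_r. apply wr_refl; auto.
  - eapply wr_eq; [eapply wr_trans; [apply wr_letter; exact Ht|apply IH]|..]; auto; lra.
Qed.

(** The competitors are words with arbitrary admissible end headings. The condition [0 < L] reflects
    that the constant path has no heading and is not feasible. *)
Definition optimal (I J : R -> Prop) T X Y :=
  forall o e L, I o -> J e -> 0 < L -> wr o e L X Y -> T <= L.

Definition solution (I J : R -> Prop) u (w : word) :=
  I u /\ J (u + turn w) /\ positive_word w /\ optimal I J (wlen w) (wX u w) (wY u w).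

(** The rest of the path before, or after, a modified portion, reduced to the existence of a word
    with given length and displacement, so that a soft end may replace it by another one. *)
Definition front (I : R -> Prop) u L X Y := exists o, I o /\ wr o u L X Y.
Definition back (J : R -> Prop) v L X Y := exists e, J e /\ wr v e L X Y.

Lemma optimal_split I J T X Y u v L1 X1 Y1 L2 X2 Y2 L X' Y' :
  optimal I J T X Y -> front I u L1 X1 Y1 -> wr u v L X' Y' -> back J v L2 X2 Y2 ->
  0 < L -> X1 + X' + X2 = X -> Y1 + Y' + Y2 = Y -> T <= L1 + L + L2.
Proof.
  intros Ho (o & Io & H1) Hm (e & Je & H2) HL HX HY.
  apply (Ho o e); auto.
  - apply wr_len_ge in H1; apply wr_len_ge in H2; lra.
  - eapply wr_eq; [exact (wr_trans _ _ _ _ _ _ _ _ _ (wr_trans _ _ _ _ _ _ _ _ _ H1 Hm) H2)|..]; lra.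
Qed.

(** * Symmetries of optimal words: reflection and reversal *)

Definition flip d := match d with Lf => Rt | Rt => Lf | St => St end.
Definition mirror (w : word) : word := map (fun p => (flip (fst p), snd p)) w.
Definition negated (I : R -> Prop) := fun x => I (- x).

Lemma turn_mirror w : turn (mirror w) = - turn w.
Proof. induction w as [|[[] t] w IH]; simpl; [lra|rewrite IH; lra..]. Qed.
Lemma wlen_mirror w : wlen (mirror w) = wlen w.
Proof. induction w as [|[[] t] w IH]; simpl; [lra|rewrite IH; lra..]. Qed.
Lemma dX_flip d u t : dX (flip d) (- u) t = dX d u t.
Proof.
  destruct d; simpl; rewrite ?cos_neg; auto.
  - replace (- u - t) with (- (u + t)) by ring. rewrite !sin_neg. ring.
  - replace (- u + t) with (- (u - t)) by ring. rewrite !sin_neg. ring.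
Qed.
Lemma dY_flip d u t : dY (flip d) (- u) t = - dY d u t.
Proof.
  destruct d; simpl; rewrite ?sin_neg; try ring.
  - replace (- u - t) with (- (u + t)) by ring. rewrite !cos_neg. ring.
  - replace (- u + t) with (- (u - t)) by ring. rewrite !cos_neg. ring.
Qed.
Lemma sg_flip d : sg (flip d) = - sg d.
Proof. destruct d; simpl; lra. Qed.
Lemma wX_mirror w u : wX (- u) (mirror w) = wX u w.
Proof.
  revert u; induction w as [|[d t] w IH]; intros u; simpl; auto.
  rewrite dX_flip, sg_flip.
  replace (- u + - sg d * t) with (- (u + sg d * t)) by ring. now rewrite IH.
Qed.
Lemma wY_mirror w u : wY (- u) (mirror w) = - wY u w.
Proof.
  revert u; induction w as [|[d t] w IH]; intros u; simpl; [lra|].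
  rewrite dY_flip, sg_flip.
  replace (- u + - sg d * t) with (- (u + sg d * t)) by ring. rewrite IH. ring.
Qed.
Lemma positive_mirror w : positive_word w -> positive_word (mirror w).
Proof. induction 1; simpl; constructor; auto. Qed.

Lemma solution_mirror I J u w :
  solution I J u w -> solution (negated I) (negated J) (- u) (mirror w).
Proof.
  intros (Hu & Hv & Hp & Ho). unfold negated. split; [|split; [|split]].
  - now rewrite Ropp_involutive.
  - rewrite turn_mirror. now replace (- (- u + - turn w)) with (u + turn w) by ring.
  - now apply positive_mirror.
  - intros o e L Io Je HL H. rewrite wlen_mirror in *.
    rewrite wX_mirror, wY_mirror in H. apply (Ho (- o) (- e)); auto.
    apply wr_mirror in H. now rewrite Ropp_involutive in H.
Qed.

Lemma turn_rev w : turn (rev w) = turn w.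
Proof. induction w as [|[d t] w IH]; simpl; auto. rewrite turn_app, IH; simpl; lra. Qed.
Lemma wlen_rev w : wlen (rev w) = wlen w.
Proof. induction w as [|[d t] w IH]; simpl; auto. rewrite wlen_app, IH; simpl; lra. Qed.
Lemma dX_rev d u t : dX d (- (u + sg d * t)) t = dX d u t.
Proof.
  destruct d; simpl.
  - replace (- (u + 1 * t) + t) with (- u) by ring.
    replace (u + 1 * t) with (u + t) by ring. rewrite !sin_neg. ring.
  - replace (- (u + -1 * t) - t) with (- u) by ring.
    replace (u + -1 * t) with (u - t) by ring. rewrite !sin_neg. ring.
  - replace (- (u + 0 * t)) with (- u) by ring. now rewrite cos_neg.
Qed.
Lemma dY_rev d u t : dY d (- (u + sg d * t)) t = - dY d u t.
Proof.
  destruct d; simpl.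
  - replace (- (u + 1 * t) + t) with (- u) by ring.
    replace (u + 1 * t) with (u + t) by ring. rewrite !cos_neg. ring.
  - replace (- (u + -1 * t) - t) with (- u) by ring.
    replace (u + -1 * t) with (u - t) by ring. rewrite !cos_neg. ring.
  - replace (- (u + 0 * t)) with (- u) by ring. rewrite sin_neg. ring.
Qed.
Lemma wX_rev w u : wX (- (u + turn w)) (rev w) = wX u w.
Proof.
  revert u; induction w as [|[d t] w IH]; intros u; simpl; auto.
  rewrite wX_app, turn_rev. simpl.
  replace (- (u + (sg d * t + turn w)) + turn w) with (- (u + sg d * t)) by ring.
  rewrite dX_rev, <- (Rplus_assoc u), IH. ring.
Qed.
Lemma wY_rev w u : wY (- (u + turn w)) (rev w) = - wY u w.
Proof.
  revert u; induction w as [|[d t] w IH]; intros u; simpl; [ring|].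
  rewrite wY_app, turn_rev. simpl.
  replace (- (u + (sg d * t + turn w)) + turn w) with (- (u + sg d * t)) by ring.
  rewrite dY_rev, <- (Rplus_assoc u), IH. ring.
Qed.

(** Time reversal followed by the reflection that changes the sign of the first coordinate: each
    operation exchanges left and right, so the letters keep their orientation while their order is
    reversed and the headings change sign. *)
Lemma solution_rev I J u w :
  solution I J u w -> solution (negated J) (negated I) (- (u + turn w)) (rev w).
Proof.
  intros (Hu & Hv & Hp & Ho). unfold negated. split; [|split; [|split]].
  - now rewrite Ropp_involutive.
  - rewrite turn_rev. now replace (- (- (u + turn w) + turn w)) with u by ring.
  - now apply Forall_rev.
  - intros o e L Io Je HL H. rewrite wlen_rev in *.
    rewrite wX_rev, wY_rev in H. apply (Ho (- e) (- o)); auto.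
    apply wr_mirror, wr_reverse in H. now rewrite Ropp_involutive in H.
Qed.

(** * Soft ends of arcs *)

Definition canInc (I : R -> Prop) u := exists d, 0 < d /\ forall t, 0 <= t <= d -> I (u + t).
Definition canDec (I : R -> Prop) u := exists d, 0 < d /\ forall t, 0 <= t <= d -> I (u - t).

Lemma canInc_negated I u : canInc (negated I) (- u) <-> canDec I u.
Proof.
  unfold negated; split; intros (d & Hd & H); exists d; split; auto; intros t Ht.
  - replace (u - t) with (- (- u + t)) by ring. auto.
  - replace (- (- u + t)) with (u - t) by ring. auto.
Qed.
Lemma canDec_negated I u : canDec (negated I) (- u) <-> canInc I u.
Proof.
  unfold negated; split; intros (d & Hd & H); exists d; split; auto; intros t Ht.
  - replace (u + t) with (- (- u - t)) by ring. auto.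
  - replace (- (- u - t)) with (u + t) by ring. auto.
Qed.

(* The part of the path that ends at heading [u] can be modified so that it ends at
   heading [u + t].  Here [w = 1] if the departure heading may increase, and [w = 2]
   if that part ends with a right arc, which then becomes shorter. *)
Definition fsoft I w u L X Y := exists d, 0 < d /\ forall t, 0 <= t <= d ->
  front I (u + t) (L - (w - 1) * t) (X - (w - 1) * (sin (u + t) - sin u))
    (Y - (w - 1) * (cos u - cos (u + t))).
Definition bsoft J w v L X Y := exists d, 0 < d /\ forall t, 0 <= t <= d ->
  back J (v - t) (L - (w - 1) * t) (X - (w - 1) * (sin v - sin (v - t)))
    (Y - (w - 1) * (cos (v - t) - cos v)).

(** Softness as seen from a left arc, which shortens when its initial heading increases or its final
    heading decreases. *)
Definition softS I u (pre : word) :=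
  (pre = [] /\ canInc I u) \/ exists p g, pre = p ++ [(Rt, g)].
Definition softE J v (post : word) :=
  (post = [] /\ canDec J v) \/ exists p g, post = (Rt, g) :: p.

Lemma softS_fsoft I J u pre rest : solution I J u (pre ++ rest) -> softS I u pre ->
  exists w, (w = 1 \/ w = 2) /\ fsoft I w (u + turn pre) (wlen pre) (wX u pre) (wY u pre).
Proof.
  intros (Hu & _ & Hp & _) [[-> (d & Hd & H)]|(p & g & ->)].
  - exists 1. split; auto. exists d; split; auto. intros t Ht. simpl.
    exists (u + t); split; auto.
    eapply wr_eq; [apply (wr_refl (u + t) (u + t)); auto|..]; simpl; try ring.
  - exists 2. split; auto.
    apply Forall_app in Hp as [Hp _]. apply Forall_app in Hp as [Hp Hg].
    inversion Hg as [|? ? Hg' _]; subst; simpl in Hg'.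
    exists g; split; auto. intros t Ht.
    rewrite turn_app, wlen_app, wX_app, wY_app; simpl.
    exists u; split; auto.
    eapply wr_eq; [eapply wr_trans; [apply (wr_word p u), positive_nonneg, Hp|
      apply (wr_right _ (g - t)); lra]|..]; try lra.
    + replace (u + turn p - (g - t)) with (u + turn p - g + t) by ring.
      replace (u + (turn p + (-1 * g + 0)) + t) with (u + turn p - g + t) by ring.
      replace (u + (turn p + (-1 * g + 0))) with (u + turn p - g) by ring. ring.
    + replace (u + turn p - (g - t)) with (u + turn p - g + t) by ring.
      replace (u + (turn p + (-1 * g + 0)) + t) with (u + turn p - g + t) by ring.
      replace (u + (turn p + (-1 * g + 0))) with (u + turn p - g) by ring. ring.
Qed.

Lemma softE_bsoft I J u pre post :
  solution I J u (pre ++ post) -> softE J (u + turn pre) post ->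
  exists w, (w = 1 \/ w = 2) /\ bsoft J w (u + turn pre) (wlen post)
    (wX (u + turn pre) post) (wY (u + turn pre) post).
Proof.
  intros (_ & Hv & Hp & _) Hs. rewrite turn_app in Hv.
  set (v := u + turn pre) in *.
  destruct Hs as [[-> (d & Hd & H)]|(p & g & ->)].
  - exists 1. split; auto. exists d; split; auto. intros t Ht. simpl.
    exists (v - t); split; auto.
    eapply wr_eq; [apply (wr_refl (v - t) (v - t)); auto|..]; simpl; try ring.
  - exists 2. split; auto.
    apply Forall_app in Hp as [_ Hp].
    inversion Hp as [|? ? Hg' Hp']; subst; simpl in Hg'.
    exists g; split; auto. intros t Ht. simpl.
    exists (v + turn ((Rt, g) :: p)); split.
    { unfold v. now rewrite Rplus_assoc. }
    assert (H1 : wr (v - t) (v - g) (g - t) (sin (v - t) - sin (v - t - (g - t)))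
      (cos (v - t - (g - t)) - cos (v - t))).
    { eapply wr_eq; [apply (wr_right (v - t) (g - t)); lra|..]; lra. }
    eapply wr_eq; [exact (wr_trans _ _ _ _ _ _ _ _ _ H1
      (wr_word p (v - g) (positive_nonneg _ Hp')))|..]; try (simpl; lra).
    + simpl. replace (v + -1 * g) with (v - g) by ring.
      replace (v - t - (g - t)) with (v - g) by ring. ring.
    + simpl. replace (v + -1 * g) with (v - g) by ring.
      replace (v - t - (g - t)) with (v - g) by ring. ring.
Qed.

(** * Shortening moves *)

Lemma cos_lower h d c : 0 < d <= h -> h <= PI -> 0 < c <= cos (h - d) - cos h ->
  exists t, 0 < t <= d /\ cos (h - t) - cos h = c.
Proof.
  intros Hd Hh Hc.
  destruct (IVT_gen (fun t => cos (h - t) - cos h) 0 d c) as (t & Ht & E).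
  - intro x. apply derivable_continuous_pt, ex_derive_Reals_0. auto_derive. auto.
  - rewrite Rminus_0_r, Rminus_diag, Rmin_left, Rmax_right; lra.
  - rewrite Rmin_left, Rmax_right in Ht by lra.
    exists t; split; auto. split; [|lra].
    destruct (proj1 Ht) as [|<-]; auto.
    rewrite Rminus_0_r in E. lra.
Qed.

(* If [al <= PI], cut turns [t1] and [t2] off the ends of the arc and insert a segment
   of length [m < w1 * t1 + w2 * t2] in its middle direction. *)
Lemma short_arc_core I J T X Y u al L1 X1 Y1 L2 X2 Y2 w1 w2 :
  0 < w1 -> 0 < w2 ->
  optimal I J T X Y -> fsoft I w1 u L1 X1 Y1 -> bsoft J w2 (u + al) L2 X2 Y2 ->
  0 < al -> T = L1 + al + L2 ->
  X = X1 + (sin (u + al) - sin u) + X2 -> Y = Y1 + (cos u - cos (u + al)) + Y2 ->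
  PI < al.
Proof.
  intros Hw1 Hw2 Hopt (d1 & Hd1 & HF) (d2 & Hd2 & HB) Hal HT HX HY.
  apply Rnot_le_lt; intros Hle.
  set (h := al / 2). pose proof PI_RGT_0.
  set (d := Rmin (Rmin d1 d2) (h / 2)).
  assert (Hd : 0 < d <= h / 2 /\ d <= d1 /\ d <= d2).
  { pose proof (Rmin_l (Rmin d1 d2) (h / 2)). pose proof (Rmin_r (Rmin d1 d2) (h / 2)).
    pose proof (Rmin_l d1 d2). pose proof (Rmin_r d1 d2).
    assert (0 < d) by (unfold d; repeat apply Rmin_glb_lt; unfold h; lra).
    unfold d in *; lra. }
  assert (Hg : 0 < cos (h - d) - cos h).
  { assert (cos h < cos (h - d)) by (apply cos_decreasing_1; unfold h in *; lra). lra. }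
  set (g := cos (h - d) - cos h) in *.
  (* [c] is the transverse displacement that both cuts must share in order to cancel; the minimum
     makes it attainable at either end with a cut of at most [d]. *)
  set (c := Rmin (w1 * g) (w2 * g)).
  assert (Hc : 0 < c /\ c <= w1 * g /\ c <= w2 * g).
  { assert (0 < w1 * g) by (apply Rmult_lt_0_compat; auto).
    assert (0 < w2 * g) by (apply Rmult_lt_0_compat; auto).
    unfold c. apply Rmin_case_strong; intros; lra. }
  assert (Hdiv : forall w, 0 < w -> c <= w * g -> 0 < c / w <= g).
  { intros w Hw Hcw. split; [apply Rdiv_lt_0_compat; lra|].
    apply Rmult_le_reg_l with w; auto. replace (w * (c / w)) with c by (field; lra). auto. }
  destruct (cos_lower h d (c / w1)) as (t1 & Ht1 & E1);
    [lra|unfold h; lra|apply Hdiv; lra|].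
  destruct (cos_lower h d (c / w2)) as (t2 & Ht2 & E2);
    [lra|unfold h; lra|apply Hdiv; lra|].
  assert (E : w1 * (cos (h - t1) - cos h) = w2 * (cos (h - t2) - cos h)).
  { rewrite E1, E2. field. lra. }
  set (m1 := sin h - sin (h - t1)). set (m2 := sin h - sin (h - t2)).
  assert (Hm : forall t, 0 < t <= d -> 0 <= sin h - sin (h - t) < t).
  { intros t Ht. split; [|apply sin_diff_lt; lra].
    assert (sin (h - t) < sin h) by (apply sin_increasing_1; unfold h in *; lra). lra. }
  pose proof (Hm t1 Ht1) as Hm1. pose proof (Hm t2 Ht2) as Hm2. fold m1 in Hm1. fold m2 in Hm2.
  (* Along the middle heading the displacements of the removed pieces add up, and the segment
     replaces exactly this sum. *)
  set (m := w1 * m1 + w2 * m2).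
  assert (Hm0 : 0 <= m /\ m < w1 * t1 + w2 * t2) by (unfold m; nra).
  assert (Hmid : wr (u + t1) (u + al - t2) ((h - t1) + m + (h - t2))
    (sin (u + h) - sin (u + t1) + m * cos (u + h) + (sin (u + al - t2) - sin (u + h)))
    (cos (u + t1) - cos (u + h) + m * sin (u + h) + (cos (u + h) - cos (u + al - t2)))).
  { assert (A1 := wr_left (u + t1) (h - t1) ltac:(lra)).
    assert (A2 := wr_line (u + h) m ltac:(lra)).
    assert (A3 := wr_left (u + h) (h - t2) ltac:(lra)).
    replace (u + t1 + (h - t1)) with (u + h) in A1 by ring.
    replace (u + h + (h - t2)) with (u + al - t2) in A3 by (unfold h; field).
    eapply wr_eq; [exact (wr_trans _ _ _ _ _ _ _ _ _ (wr_trans _ _ _ _ _ _ _ _ _ A1 A2) A3)|..]; lra. }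
  assert (T <= L1 - (w1 - 1) * t1 + ((h - t1) + m + (h - t2)) + (L2 - (w2 - 1) * t2)).
  { pose proof (HF t1 ltac:(lra)) as F1. pose proof (HB t2 ltac:(lra)) as B1.
    refine (optimal_split _ _ _ _ _ _ _ _ _ _ _ _ _ _ _ _ Hopt F1 Hmid B1 _ _ _).
    - lra.
    - rewrite HX. unfold m, m1, m2.
      replace (u + t1) with (u + h - (h - t1)) by ring.
      replace (u + al - t2) with (u + h + (h - t2)) by (unfold h; field).
      replace (u + al) with (u + h + h) by (unfold h; field).
      set (k := u + h). replace u with (k - h) by (unfold k; ring).
      rewrite !(sin_plus k), !(sin_minus k).
      apply Rminus_diag_uniq.
      transitivity (sin k * (w2 * (cos (h - t2) - cos h) - w1 * (cos (h - t1) - cos h))); [ring|].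
      rewrite E. ring.
    - rewrite HY. unfold m, m1, m2.
      replace (u + t1) with (u + h - (h - t1)) by ring.
      replace (u + al - t2) with (u + h + (h - t2)) by (unfold h; field).
      replace (u + al) with (u + h + h) by (unfold h; field).
      set (k := u + h). replace u with (k - h) by (unfold k; ring).
      rewrite !(cos_plus k), !(cos_minus k).
      apply Rminus_diag_uniq.
      transitivity (cos k * (w1 * (cos (h - t1) - cos h) - w2 * (cos (h - t2) - cos h))); [ring|].
      rewrite E. ring. }
  unfold h in *. lra.
Qed.

Lemma polar_atan a b : 0 < a ->
  a * sqrt (1 + (b / a)²) * cos (atan (b / a)) = a /\
  a * sqrt (1 + (b / a)²) * sin (atan (b / a)) = b.
Proof.
  intros Ha. rewrite cos_atan, sin_atan.
  assert (0 < sqrt (1 + (b / a)²)) by (apply sqrt_lt_R0; pose proof (Rle_0_sqr (b / a)); lra).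
  split; field; lra.
Qed.

(* Turn by [s] before the segment instead of after it, and shorten the arc by [t]. *)
Lemma line_arc_core_minor I J T X Y u l al L1 X1 Y1 L2 X2 Y2 w :
  0 < w -> 0 < l -> 0 < al <= PI ->
  optimal I J T X Y -> front I u L1 X1 Y1 -> bsoft J w (u + al) L2 X2 Y2 ->
  T = L1 + l + al + L2 ->
  X = X1 + l * cos u + (sin (u + al) - sin u) + X2 ->
  Y = Y1 + l * sin u + (cos u - cos (u + al)) + Y2 -> False.
Proof.
  intros Hw Hl Hal Hopt HF (d & Hd & HB) HT HX HY.
  (* [(Vx, Vy)] is the displacement lost at the soft end, in the frame where [u = 0]. The left arcs
     before and after the segment together displace like one arc, so the segment has to absorb the
     loss: its vector becomes [(l + Vx, Vy)], of polar angle [s] and length [l']. *)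
  set (Vx := fun t => w * (sin al - sin (al - t))).
  set (Vy := fun t => w * (cos (al - t) - cos al)).
  set (s := fun t => atan (Vy t / (l + Vx t))).
  set (l' := fun t => (l + Vx t) * sqrt (1 + (Vy t / (l + Vx t))²)).
  assert (V0 : Vx 0 = 0 /\ Vy 0 = 0) by (unfold Vx, Vy; rewrite Rminus_0_r; lra).
  destruct V0 as [Vx0 Vy0].
  assert (H1 : at_right 0 (fun t => 0 < l + Vx t)).
  { apply at_right_gt; [|rewrite Vx0; lra].
    apply (ex_derive_continuous (V := R_NormedModule)). unfold Vx. auto_derive. auto. }
  assert (H2 : at_right 0 (fun t => 0 < al - t - s t)).
  { apply at_right_gt.
    - apply (ex_derive_continuous (V := R_NormedModule)). unfold s, Vx, Vy. auto_derive.
      rewrite Ropp_0, Rplus_0_r. lra.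
    - unfold s. rewrite Vx0, Vy0. unfold Rdiv. rewrite Rmult_0_l, atan_0. lra. }
  assert (H3 : at_right 0 (fun t => l' t - w * t < l)).
  { assert (L0 : l' 0 - w * 0 = l).
    { unfold l'. rewrite Vx0, Vy0. unfold Rdiv. rewrite Rmult_0_l, Rsqr_0, !Rplus_0_r, sqrt_1. ring. }
    (* To first order only [Vx] lengthens the segment, at the rate [w * cos al], while arcs of
       length [w * t] disappear. *)
    apply (at_right_decr (fun t => l' t - w * t) (w * (cos al - 1))); auto.
    - unfold l', Vx, Vy, Rsqr. auto_derive.
      + rewrite Ropp_0, Rplus_0_r, !Rplus_opp_r. rewrite !Rmult_0_r, Rplus_0_r, !Rmult_0_l, Rplus_0_r.
        repeat split; try lra.
      + rewrite Ropp_0, Rplus_0_r, !Rplus_opp_r. rewrite !Rmult_0_r, Rplus_0_r, !Rmult_0_l, Rplus_0_r, sqrt_1.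
        field. lra.
    - assert (cos al < 1) by (rewrite <- cos_0; apply cos_decreasing_1; lra). nra. }
  destruct (at_right_ex _ (filter_and _ _ (filter_and _ _ H1 H2)
    (filter_and _ _ (filter_and _ _ H3 (at_right_le _ (proj1 Hal)))
      (filter_and _ _ at_right_pos (at_right_le _ Hd)))))
    as (t & (P1 & P2) & (P3 & P4) & P5 & P6).
  assert (Hy : 0 <= Vy t).
  { unfold Vy. apply Rmult_le_pos; [lra|].
    assert (cos al <= cos (al - t)) by (apply cos_decr_1; lra). lra. }
  assert (Hs : 0 <= s t).
  { unfold s. rewrite <- atan_0. destruct Hy as [Hy|<-].
    - left. apply atan_increasing. apply Rdiv_lt_0_compat; lra.
    - unfold Rdiv; rewrite Rmult_0_l; lra. }
  destruct (polar_atan (l + Vx t) (Vy t) P1) as [E1 E2]. fold (l' t) in E1, E2. fold (s t) in E1, E2.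
  assert (Hl' : 0 <= l' t) by (unfold l'; apply Rmult_le_pos; [lra|apply sqrt_pos]).
  assert (A1 := wr_left u (s t) Hs).
  assert (A2 := wr_line (u + s t) (l' t) Hl').
  assert (A3 := wr_left (u + s t) (al - t - s t) ltac:(lra)).
  replace (u + s t + (al - t - s t)) with (u + al - t) in A3 by ring.
  assert (A := wr_trans _ _ _ _ _ _ _ _ _ (wr_trans _ _ _ _ _ _ _ _ _ A1 A2) A3).
  specialize (HB t ltac:(lra)).
  assert (T <= L1 + (s t + l' t + (al - t - s t)) + (L2 - (w - 1) * t)); [|lra].
  replace (u + al - t) with (u + (al - t)) in * by ring.
  unfold Vx, Vy in E1, E2.
  refine (optimal_split _ _ _ _ _ _ _ _ _ _ _ _ _ _ _ _ Hopt HF A HB _ _ _).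
  - lra.
  - rewrite HX, !(cos_plus u), !(sin_plus u). apply Rminus_diag_uniq.
    transitivity (cos u * (l' t * cos (s t) - (l + w * (sin al - sin (al - t))))
      - sin u * (l' t * sin (s t) - w * (cos (al - t) - cos al))); [ring|].
    rewrite E1, E2. ring.
  - rewrite HY, !(cos_plus u), !(sin_plus u). apply Rminus_diag_uniq.
    transitivity (sin u * (l' t * cos (s t) - (l + w * (sin al - sin (al - t))))
      + cos u * (l' t * sin (s t) - w * (cos (al - t) - cos al))); [ring|].
    rewrite E1, E2. ring.
Qed.

(* Turn right by [s] before the segment; [A s] and [l' s] restore the displacement.
   The length changes at the rate [l * (1 - cos al) / sin al < 0]. *)
Lemma line_arc_core_major I J T X Y u l al L1 X1 Y1 L2 X2 Y2 w :
  0 < w -> 0 < l -> PI < al < 2 * PI ->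
  optimal I J T X Y -> front I u L1 X1 Y1 -> bsoft J w (u + al) L2 X2 Y2 ->
  T = L1 + l + al + L2 ->
  X = X1 + l * cos u + (sin (u + al) - sin u) + X2 ->
  Y = Y1 + l * sin u + (cos u - cos (u + al)) + Y2 -> False.
Proof.
  intros Hw Hl Hal Hopt HF (d & Hd & HB) HT HX HY.
  pose proof (sin_neg_interval al Hal) as Hsin. pose proof PI_RGT_0 as Hpi.
  (* This is the component of the displacement equation normal to the new segment, whose heading is
     [u - s]. It is free of [l'] and thus determines [A]; the component along the segment then
     defines [l']. *)
  destruct (inverse_cos (fun s => cos (al + s) + (2 * (1 - cos s) - l * sin s) / w)
    (- sin al - l / w) al) as (A & A0 & DA & HA); auto.
  { auto_derive; auto. rewrite Rplus_0_r, sin_0, cos_0. field; lra. }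
  { rewrite Rplus_0_r, sin_0, cos_0. field; lra. }
  set (t := fun s => al + s - A s).
  set (Vx := fun s => w * (sin al - sin (A s - s))).
  set (Vy := fun s => w * (cos (A s - s) - cos al)).
  set (l' := fun s => (l + Vx s) * cos s - (2 + Vy s) * sin s).
  assert (EA : ex_derive A 0) by (eexists; exact DA).
  assert (DA' : Derive (fun s => A s) 0 = - (- sin al - l / w) / sin al)
    by exact (is_derive_unique _ _ _ DA).
  assert (Dt : is_derive t 0 (- l / (w * sin al))).
  { unfold t. auto_derive; auto. rewrite DA'. field. lra. }
  assert (t0 : t 0 = 0) by (unfold t; rewrite A0; ring).
  assert (l'0 : l' 0 = l).
  { unfold l', Vx, Vy. rewrite A0, sin_0, cos_0, Rminus_0_r. ring. }
  assert (El : ex_derive l' 0) by (unfold l', Vx, Vy; auto_derive; auto).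
  assert (H1 : at_right 0 (fun s => 0 < t s)).
  { apply (at_right_incr _ _ _ Dt); auto.
    replace (- l / (w * sin al)) with (l / (w * - sin al)) by (field; lra).
    apply Rdiv_lt_0_compat; [lra|apply Rmult_lt_0_compat; lra]. }
  assert (H2 : at_right 0 (fun s => t s < d)).
  { apply at_right_lt; [now apply derive_continuous in Dt|lra]. }
  assert (H3 : at_right 0 (fun s => 0 < A s)).
  { apply at_right_gt; [now apply derive_continuous in DA|lra]. }
  assert (H4 : at_right 0 (fun s => 0 < l' s)).
  { apply at_right_gt; [now apply (ex_derive_continuous (V := R_NormedModule))|lra]. }
  assert (H5 : at_right 0 (fun s => 2 * s + l' s - w * t s < l)).
  { assert (F0 : 2 * 0 + l' 0 - w * t 0 = l) by (rewrite l'0, t0; ring).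
    apply (at_right_decr (fun s => 2 * s + l' s - w * t s) (l * (1 - cos al) / sin al)); auto.
    - unfold l', Vx, Vy, t. auto_derive; auto.
      rewrite DA', A0, sin_0, cos_0, Ropp_0, Rplus_0_r.
      field. lra.
    - assert (cos al < 1).
      { pose proof (sin2_cos2 al) as S2. unfold Rsqr in S2. nra. }
      assert (0 < l * (1 - cos al) / - sin al).
      { apply Rdiv_lt_0_compat; [apply Rmult_lt_0_compat|]; lra. }
      replace (l * (1 - cos al) / sin al) with (- (l * (1 - cos al) / - sin al)) by (field; lra).
      lra. }
  destruct (at_right_ex _ (filter_and _ _ (filter_and _ _ H1 H2) (filter_and _ _
    (filter_and _ _ H3 H4) (filter_and _ _ H5 (filter_and _ _ at_right_pos
    (at_right_of_locally _ HA))))))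
    as (s & (P1 & P2) & (P3 & P4) & P5 & P6 & E).
  assert (Ew : w * cos (A s) = w * cos (al + s) + (2 * (1 - cos s) - l * sin s)).
  { rewrite E. field. lra. }
  assert (EI : (l + Vx s) * sin s + (2 + Vy s) * cos s = 2).
  { unfold Vx, Vy.
    replace (A s) with ((A s - s) + s) in Ew by ring. rewrite !cos_plus in Ew. lra. }
  pose proof (sin2_cos2 s) as S2. unfold Rsqr in S2.
  assert (E1 : l' s * cos s + 2 * sin s = l + Vx s).
  { rewrite <- EI at 1. unfold l'.
    transitivity ((l + Vx s) * (sin s * sin s + cos s * cos s)); [ring|rewrite S2; ring]. }
  assert (E2 : 2 * cos s - l' s * sin s = 2 + Vy s).
  { rewrite <- EI at 1. unfold l'.
    transitivity ((2 + Vy s) * (sin s * sin s + cos s * cos s)); [ring|rewrite S2; ring]. }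
  assert (A1 := wr_right u s ltac:(lra)).
  assert (A2 := wr_line (u - s) (l' s) ltac:(lra)).
  assert (A3 := wr_left (u - s) (A s) ltac:(lra)).
  assert (B1 := wr_trans _ _ _ _ _ _ _ _ _ (wr_trans _ _ _ _ _ _ _ _ _ A1 A2) A3).
  specialize (HB (t s) ltac:(lra)).
  assert (Et : u + al - t s = u + (A s - s)) by (unfold t; ring).
  assert (Et' : u - s + A s = u + (A s - s)) by ring.
  rewrite Et in HB. rewrite Et' in B1.
  assert (T <= L1 + (s + l' s + A s) + (L2 - (w - 1) * t s)); [|unfold t in *; lra].
  unfold Vx, Vy in E1, E2.
  refine (optimal_split _ _ _ _ _ _ _ _ _ _ _ _ _ _ _ _ Hopt HF B1 HB _ _ _).
  - lra.
  - rewrite HX, ?(sin_plus u), ?(cos_minus u), ?(sin_minus u). apply Rminus_diag_uniq.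
    transitivity (cos u * (l' s * cos s + 2 * sin s - (l + w * (sin al - sin (A s - s))))
      - sin u * (2 * cos s - l' s * sin s - (2 + w * (cos (A s - s) - cos al)))); [ring|].
    rewrite E1, E2; ring.
  - rewrite HY, ?(cos_plus u), ?(cos_minus u), ?(sin_minus u). apply Rminus_diag_uniq.
    transitivity (sin u * (l' s * cos s + 2 * sin s - (l + w * (sin al - sin (A s - s))))
      + cos u * (2 * cos s - l' s * sin s - (2 + w * (cos (A s - s) - cos al)))); [ring|].
    rewrite E1, E2; ring.
Qed.

(* For [al <= PI] move the segments to the middle of the arc; for [al > PI] lengthen
   the arc by turning right by [s] at the far ends of the segments. *)
Lemma line_arc_line_core I J T X Y u l al L1 X1 Y1 L2 X2 Y2 :
  0 < l -> 0 < al < 2 * PI ->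
  optimal I J T X Y -> front I u L1 X1 Y1 -> back J (u + al) L2 X2 Y2 ->
  T = L1 + l + al + l + L2 ->
  X = X1 + l * cos u + (sin (u + al) - sin u) + l * cos (u + al) + X2 ->
  Y = Y1 + l * sin u + (cos u - cos (u + al)) + l * sin (u + al) + Y2 -> False.
Proof.
  intros Hl Hal Hopt HF HB HT HX HY. pose proof PI_RGT_0 as Hpi.
  set (h := al / 2). set (k := u + h).
  assert (Eu : u = k - h) by (unfold k; ring).
  assert (Ev : u + al = k + h) by (unfold k, h; field).
  destruct (Rle_lt_dec al PI) as [Hle|Hgt].
  (* Both segments make the angle [h] with the middle heading, so the sum of their vectors has
     length [2 * l * cos h] and points along it. *)
  - set (m := 2 * l * cos h).
    assert (Hc : 0 <= cos h < 1).
    { split; [apply cos_ge_0; unfold h; lra|].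
      rewrite <- cos_0. apply cos_decreasing_1; unfold h; lra. }
    assert (Hm : 0 <= m < 2 * l) by (unfold m; nra).
    assert (A1 := wr_left u h ltac:(unfold h; lra)).
    assert (A2 := wr_line (u + h) m ltac:(lra)).
    assert (A3 := wr_left (u + h) h ltac:(unfold h; lra)).
    assert (A := wr_trans _ _ _ _ _ _ _ _ _ (wr_trans _ _ _ _ _ _ _ _ _ A1 A2) A3).
    replace (u + h + h) with (u + al) in A by (unfold h; field).
    assert (T <= L1 + (h + m + h) + L2); [|unfold h in *; lra].
    refine (optimal_split _ _ _ _ _ _ _ _ _ _ _ _ _ _ _ _ Hopt HF A HB _ _ _).
    + unfold h in *; lra.
    + rewrite HX, Ev. change (u + h) with k. rewrite Eu.
      rewrite !cos_minus, !cos_plus. unfold m. ring.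
    + rewrite HY, Ev. change (u + h) with k. rewrite Eu.
      rewrite !sin_minus, !sin_plus. unfold m. ring.
  - assert (Hh : PI / 2 < h < PI) by (unfold h; lra).
    assert (Hch : cos h < 0) by (apply cos_lt_0; lra).
    assert (Hsh : 0 < sin h) by (apply sin_gt_0; lra).
    (* The new word is symmetric about the heading [k], so only the displacement along [k] has to be
       matched, and this fixes [l']. *)
    set (l' := fun s => (2 * sin h - 2 * sin (h + s) + l * cos h) / cos (h + s)).
    assert (l'0 : l' 0 = l) by (unfold l'; rewrite Rplus_0_r; field; lra).
    assert (H1 : at_right 0 (fun s => 0 < l' s)).
    { apply at_right_gt; [|lra]. apply (ex_derive_continuous (V := R_NormedModule)).
      unfold l'. auto_derive. rewrite Rplus_0_r. lra. }
    assert (H2 : at_right 0 (fun s => 4 * s + 2 * l' s < 2 * l)).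
    { apply (at_right_decr (fun s => 4 * s + 2 * l' s) (2 * l * sin h / cos h)).
      - unfold l'. auto_derive; rewrite Rplus_0_r; [lra|]. field. lra.
      - assert (0 < 2 * l * sin h / - cos h).
        { apply Rdiv_lt_0_compat; [|lra]. apply Rmult_lt_0_compat; lra. }
        replace (2 * l * sin h / cos h) with (- (2 * l * sin h / - cos h)) by (field; lra). lra.
      - rewrite l'0. ring. }
    assert (H3 : at_right 0 (fun s => cos (h + s) < 0)).
    { apply at_right_lt; [|rewrite Rplus_0_r; lra].
      apply (ex_derive_continuous (V := R_NormedModule)). auto_derive. auto. }
    destruct (at_right_ex _ (filter_and _ _ (filter_and _ _ H1 H2) (filter_and _ _ H3 at_right_pos)))
      as (s & (P1 & P2) & P3 & P4).
    assert (E : l' s * cos (h + s) = 2 * sin h - 2 * sin (h + s) + l * cos h)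
      by (unfold l'; field; lra).
    assert (A1 := wr_right u s ltac:(lra)).
    assert (A2 := wr_line (u - s) (l' s) ltac:(lra)).
    assert (A3 := wr_left (u - s) (al + 2 * s) ltac:(lra)).
    replace (u - s + (al + 2 * s)) with (k + (h + s)) in A3 by (unfold k, h; field).
    assert (A4 := wr_line (k + (h + s)) (l' s) ltac:(lra)).
    assert (A5 := wr_right (k + (h + s)) s ltac:(lra)).
    replace (k + (h + s) - s) with (u + al) in A5 by (unfold k, h; field).
    assert (A := wr_trans _ _ _ _ _ _ _ _ _ (wr_trans _ _ _ _ _ _ _ _ _
      (wr_trans _ _ _ _ _ _ _ _ _ (wr_trans _ _ _ _ _ _ _ _ _ A1 A2) A3) A4) A5).
    assert (T <= L1 + (s + l' s + (al + 2 * s) + l' s + s) + L2); [|lra].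
    refine (optimal_split _ _ _ _ _ _ _ _ _ _ _ _ _ _ _ _ Hopt HF A HB _ _ _).
    + lra.
    + rewrite HX, Ev. replace (u - s) with (k - (h + s)) by (unfold k; ring). rewrite Eu.
      rewrite !(cos_minus k), !(cos_plus k), !(sin_minus k), !(sin_plus k). apply Rminus_diag_uniq.
      transitivity (2 * cos k * (l' s * cos (h + s) - (2 * sin h - 2 * sin (h + s) + l * cos h)));
        [ring|rewrite E; ring].
    + rewrite HY, Ev. replace (u - s) with (k - (h + s)) by (unfold k; ring). rewrite Eu.
      rewrite !(cos_minus k), !(cos_plus k), !(sin_minus k), !(sin_plus k). apply Rminus_diag_uniq.
      transitivity (2 * sin k * (l' s * cos (h + s) - (2 * sin h - 2 * sin (h + s) + l * cos h)));
        [ring|rewrite E; ring].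
Qed.

(** Makes the sign of the rate in [unequal_arcs_core] visible: there all three half angles lie in
    (0, PI). *)
Lemma sin_sum_identity a b :
  sin a + sin b - sin (a + b) = 4 * sin (a / 2) * sin (b / 2) * sin ((a + b) / 2).
Proof.
  replace ((a + b) / 2) with (a / 2 + b / 2) by field.
  rewrite !sin_plus.
  replace (sin a) with (2 * sin (a / 2) * cos (a / 2))
    by (rewrite <- sin_2a; f_equal; field).
  replace (sin b) with (2 * sin (b / 2) * cos (b / 2))
    by (rewrite <- sin_2a; f_equal; field).
  replace (cos a) with (1 - 2 * sin (a / 2) * sin (a / 2))
    by (rewrite <- cos_2a_sin; f_equal; field).
  replace (cos b) with (1 - 2 * sin (b / 2) * sin (b / 2))
    by (rewrite <- cos_2a_sin; f_equal; field).
  ring.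
Qed.

(* If [be < al], insert a segment of length [m s] into the longer arc, at the turn [y]
   before the inflection, and shorten the shorter arc at its soft end by [s]. *)
Lemma unequal_arcs_core I J T X Y u al be L1 X1 Y1 L2 X2 Y2 w :
  0 < w -> PI < be -> be < al < 2 * PI ->
  optimal I J T X Y -> front I u L1 X1 Y1 -> bsoft J w (u - al + be) L2 X2 Y2 ->
  T = L1 + al + be + L2 ->
  X = X1 + (sin u - sin (u - al)) + (sin (u - al + be) - sin (u - al)) + X2 ->
  Y = Y1 + (cos (u - al) - cos u) + (cos (u - al) - cos (u - al + be)) + Y2 -> False.
Proof.
  intros Hw Hbe Hal Hopt HF (d & Hd & HB) HT HX HY. pose proof PI_RGT_0 as Hpi.
  (* The midpoint makes both [al - y] and [q = y - be] positive. The inserted segment has heading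
     [c], and the soft end has heading [c - q]. *)
  set (y := (al + be) / 2). set (q := y - be). set (c := u - al + y).
  assert (Hy : PI < y < 2 * PI) by (unfold y; lra).
  assert (Hq : 0 < q < PI) by (unfold q, y; lra).
  pose proof (sin_neg_interval y Hy) as Hsy.
  (* Across the heading [c] the displacement equation does not involve the segment and determines
     [A]; along [c] it gives the length [m]. *)
  destruct (inverse_cos (fun s => cos y - w / 2 * (cos q - cos (q + s)))
    (- (w / 2 * sin q)) y) as (A & A0 & DA & HA); auto.
  { auto_derive; auto. rewrite Rplus_0_r. ring. }
  { rewrite Rplus_0_r. ring. }
  set (m := fun s => - 2 * (sin (A s) - sin y) + w * (sin (q + s) - sin q)).
  assert (EA : ex_derive A 0) by (eexists; exact DA).
  assert (DA' : Derive (fun s => A s) 0 = - - (w / 2 * sin q) / sin y)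
    by exact (is_derive_unique _ _ _ DA).
  assert (m0 : m 0 = 0) by (unfold m; rewrite A0, Rplus_0_r; ring).
  assert (Hsb : sin be < 0) by (apply sin_neg_interval; lra).
  assert (H1 : at_right 0 (fun s => 0 < m s)).
  { apply (at_right_incr m (w * (- sin be / - sin y))); auto.
    - unfold m. auto_derive; auto. rewrite DA', A0, Rplus_0_r.
      replace be with (y - q) by (unfold q; ring). rewrite sin_minus. field. lra.
    - apply Rmult_lt_0_compat; auto. apply Rdiv_lt_0_compat; lra. }
  assert (H2 : at_right 0 (fun s => 0 < A s)).
  { apply at_right_gt; [now apply derive_continuous in DA|lra]. }
  assert (H3 : at_right 0 (fun s => 0 < A s - q - s)).
  { apply at_right_gt; [|rewrite A0; unfold q; lra].
    apply (ex_derive_continuous (V := R_NormedModule)). auto_derive; auto. }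
  assert (H4 : at_right 0 (fun s => m s + 2 * A s - w * s < 2 * y)).
  { apply (at_right_decr (fun s => m s + 2 * A s - w * s)
      (- (w / - sin y * (sin q + sin be - sin (q + be))))).
    - unfold m. auto_derive; auto. rewrite DA', A0, Rplus_0_r.
      replace (q + be) with y by (unfold q; ring).
      replace be with (y - q) by (unfold q; ring). rewrite sin_minus. field. lra.
    - rewrite sin_sum_identity.
      assert (0 < w / - sin y) by (apply Rdiv_lt_0_compat; lra).
      assert (0 < sin (q / 2)) by (apply sin_gt_0; lra).
      assert (0 < sin (be / 2)) by (apply sin_gt_0; lra).
      assert (0 < sin ((q + be) / 2)) by (apply sin_gt_0; unfold q, y in *; lra).
      assert (0 < w / - sin y * (4 * sin (q / 2) * sin (be / 2) * sin ((q + be) / 2)))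
        by (apply Rmult_lt_0_compat; [|repeat apply Rmult_lt_0_compat]; lra).
      lra.
    - rewrite m0, A0. ring. }
  destruct (at_right_ex _ (filter_and _ _ (filter_and _ _ H1 H2) (filter_and _ _
    (filter_and _ _ H3 H4) (filter_and _ _ (at_right_le _ Hd) (filter_and _ _ at_right_pos
    (at_right_of_locally _ HA))))))
    as (s & (P1 & P2) & (P3 & P4) & P5 & P6 & E).
  assert (E2 : 2 * cos (A s) = 2 * cos y - w * (cos q - cos (q + s))) by (rewrite E; field).
  assert (A1 := wr_right u (al - y) ltac:(unfold y in *; lra)).
  replace (u - (al - y)) with c in A1 by (unfold c; ring).
  assert (A2 := wr_line c (m s) ltac:(lra)).
  assert (A3 := wr_right c (A s) ltac:(lra)).
  assert (A4 := wr_left (c - A s) (A s - q - s) ltac:(lra)).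
  replace (c - A s + (A s - q - s)) with (c - (q + s)) in A4 by ring.
  assert (B1 := wr_trans _ _ _ _ _ _ _ _ _ (wr_trans _ _ _ _ _ _ _ _ _
      (wr_trans _ _ _ _ _ _ _ _ _ A1 A2) A3) A4).
  specialize (HB s ltac:(lra)).
  assert (Ev : u - al + be = c - q) by (unfold c, q; ring).
  replace (u - al + be - s) with (c - (q + s)) in HB by (rewrite Ev; ring).
  rewrite Ev in HX, HY, HB. replace (u - al) with (c - y) in HX, HY by (unfold c; ring).
  assert (T <= L1 + (al - y + m s + A s + (A s - q - s)) + (L2 - (w - 1) * s));
    [|unfold q in *; lra].
  refine (optimal_split _ _ _ _ _ _ _ _ _ _ _ _ _ _ _ _ Hopt HF B1 HB _ _ _).
  - unfold y in *; lra.
  - rewrite HX, !(sin_minus c). apply Rminus_diag_uniq.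
    transitivity (sin c * (2 * cos y - w * (cos q - cos (q + s)) - 2 * cos (A s)));
      [unfold m; ring|rewrite E2; ring].
  - rewrite HY, !(cos_minus c). apply Rminus_diag_uniq.
    transitivity (cos c * (2 * cos (A s) - (2 * cos y - w * (cos q - cos (q + s)))));
      [unfold m; ring|rewrite E2; ring].
Qed.

Lemma cos_sqr a : cos a * cos a = 1 - sin a * sin a.
Proof. pose proof (sin2_cos2 a) as E. unfold Rsqr in E. lra. Qed.

Lemma at_right_sin r : 0 < r -> at_right 0 (fun s => 0 < sin (s * r)).
Proof.
  intros Hr. apply (at_right_incr _ r); auto.
  - auto_derive; auto. rewrite Rmult_0_l, cos_0. ring.
  - rewrite Rmult_0_l. apply sin_0.
Qed.

(** The case [w = 1] of the estimate behind [eta < x / 2 + w * s / 4], which is exactly a gain of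
    length: the modified word contributes [4 * eta - w * s + e] instead of [2 * x + e]. The two
    sides differ by [16 * sin (s / 4) * K s], where [K] vanishes at 0 with a positive derivative, so
    the gain is of second order. *)
Lemma chord_gain_1 x : cos x < 1 ->
  at_right 0 (fun s => 16 * (sin (x / 2 + s / 4))² <
    (4 * sin (x / 2) + 2 * sin (s / 2) * cos ((s - x) / 2))² +
    (2 * sin (s / 2) * sin ((s - x) / 2))²).
Proof.
  intros Hc.
  set (K := fun s => 3 * sin (s / 4) * (cos (s / 4))² + cos (s / 4) * sin (x - s / 2) - sin (x + s / 4)).
  assert (HK : at_right 0 (fun s => 0 < K s)).
  { apply (at_right_incr _ (3 / 4 * (1 - cos x))).
    - unfold K, Rsqr. auto_derive; auto.
      replace (0 * / 4) with 0 by field. replace (x + - (0 * / 2)) with x by field.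
      rewrite Rplus_0_r, sin_0, cos_0. field.
    - lra.
    - unfold K. unfold Rdiv. rewrite !Rmult_0_l, Rminus_0_r, Rplus_0_r, sin_0, cos_0. ring. }
  generalize (filter_and _ _ HK (at_right_sin (/ 4) ltac:(lra))). apply filter_imp.
  intros s [H1 H2]. fold (s / 4) in H2.
  assert (0 < 16 * sin (s / 4) * K s) by (apply Rmult_lt_0_compat; lra).
  match goal with |- ?a < ?b => assert (b - a = 16 * sin (s / 4) * K s); [|lra] end.
  unfold K, Rsqr.
  replace (s / 2) with (2 * (s / 4)) by field.
  replace ((s - x) / 2) with (2 * (s / 4) - x / 2) by field.
  replace (x - 2 * (s / 4)) with (2 * (x / 2) - 2 * (s / 4)) by field.
  replace (x + s / 4) with (2 * (x / 2) + s / 4) by field.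
  generalize (x / 2) (s / 4); intros a f.
  repeat rewrite ?sin_plus, ?sin_minus, ?cos_plus, ?cos_minus, ?sin_2a, ?cos_2a.
  pose proof (cos_sqr a) as E1. pose proof (cos_sqr f) as E2.
  ring [E1 E2].
Qed.

(** The case [w = 2], where the difference of the two sides has a closed form of constant sign. *)
Lemma chord_gain_2 x : cos x < 1 ->
  at_right 0 (fun s => 16 * (sin (x / 2 + s / 2))² <
    (4 * sin (x / 2) + 4 * sin (s / 2) * cos ((s - x) / 2))² +
    (4 * sin (s / 2) * sin ((s - x) / 2))²).
Proof.
  intros Hc.
  generalize (at_right_sin (/ 2) ltac:(lra)). apply filter_imp.
  intros s H2. fold (s / 2) in H2.
  assert (0 < 32 * (sin (s / 2))² * (1 - cos x)).
  { apply Rmult_lt_0_compat; [|lra]. apply Rmult_lt_0_compat; [lra|]. apply Rsqr_pos_lt; lra. }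
  match goal with |- ?a < ?b => assert (b - a = 32 * (sin (s / 2))² * (1 - cos x)); [|lra] end.
  unfold Rsqr.
  replace ((s - x) / 2) with (s / 2 - x / 2) by field.
  replace (cos x) with (cos (2 * (x / 2))) by (f_equal; field).
  generalize (x / 2) (s / 2); intros a f.
  repeat rewrite ?sin_plus, ?sin_minus, ?cos_plus, ?cos_minus, ?sin_2a, ?cos_2a.
  pose proof (cos_sqr a) as E1. pose proof (cos_sqr f) as E2.
  ring [E1 E2].
Qed.

(* In the frame where [u = 0], moving the soft end to heading [s] requires new
   inflections at headings [M + eta] and [M - eta] such that
   [4 i sin eta e^(i M) = Re + i Im = 4 i sin (x/2) e^(i x/2) + w (e^(i s) - 1)], the
   right-hand side being written in the basis turned by [x/2 + PI/2].  The first
   variation of the length vanishes; [chord_gain_1] and [chord_gain_2] give the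
   gain of second order. *)
Lemma equal_arcs_core I J T X Y u x e L1 X1 Y1 L2 X2 Y2 w :
  w = 1 \/ w = 2 -> PI < x < 2 * PI -> 0 < e ->
  optimal I J T X Y -> fsoft I w u L1 X1 Y1 -> back J (u + e) L2 X2 Y2 ->
  T = L1 + x + x + e + L2 ->
  X = X1 + (sin (u + x) - sin u) + (sin (u + x) - sin u) + (sin (u + e) - sin u) + X2 ->
  Y = Y1 + (cos u - cos (u + x)) + (cos u - cos (u + x)) + (cos u - cos (u + e)) + Y2 -> False.
Proof.
  intros Hw Hx He Hopt (d & Hd & HF) HB HT HX HY. pose proof PI_RGT_0 as Hpi.
  assert (Hc : cos x < 1).
  { pose proof (sin_neg_interval x Hx). pose proof (sin2_cos2 x) as S2. unfold Rsqr in S2. nra. }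
  assert (HS : 0 < sin (x / 2)) by (apply sin_gt_0; lra).
  assert (HC : cos (x / 2) < 0) by (apply cos_lt_0; lra).
  assert (HS1 : sin (x / 2) < 1) by (pose proof (cos_sqr (x / 2)); nra).
  set (th := fun s => (s - x) / 2).
  set (Re := fun s => 4 * sin (x / 2) + 2 * w * sin (s / 2) * cos (th s)).
  set (Im := fun s => 2 * w * sin (s / 2) * sin (th s)).
  set (ze := fun s => atan (Im s / Re s)).
  set (Z := fun s => Re s * sqrt (1 + (Im s / Re s)²)).
  (* The root of [4 * sin eta = Z] that continues [x / 2], beyond PI / 2. Sine decreases there, so a
     larger [Z] gives a smaller [eta] and shorter arcs. *)
  set (eta := fun s => PI / 2 + acos (Z s / 4)).
  assert (R0 : Re 0 = 4 * sin (x / 2))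
    by (unfold Re; replace (0 / 2) with 0 by field; rewrite sin_0; ring).
  assert (I0 : Im 0 = 0) by (unfold Im; replace (0 / 2) with 0 by field; rewrite sin_0; ring).
  assert (ze0 : ze 0 = 0) by (unfold ze; rewrite I0; unfold Rdiv; rewrite Rmult_0_l; apply atan_0).
  assert (Z0 : Z 0 = 4 * sin (x / 2)).
  { unfold Z. rewrite I0, R0. unfold Rdiv. rewrite Rmult_0_l, Rsqr_0, Rplus_0_r, sqrt_1. ring. }
  assert (eta0 : eta 0 = x / 2).
  { unfold eta. rewrite Z0. replace (4 * sin (x / 2) / 4) with (cos (x / 2 - PI / 2)).
    - rewrite acos_cos; lra.
    - rewrite cos_minus, cos_PI2, sin_PI2. field. }
  assert (ERe : ex_derive Re 0) by (unfold Re, th; auto_derive; auto).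
  assert (EIm : ex_derive Im 0) by (unfold Im, th; auto_derive; auto).
  assert (EZ : ex_derive Z 0).
  { unfold Z, Rsqr. auto_derive. rewrite I0, R0. repeat split; auto; try lra. }
  assert (Eze : ex_derive ze 0).
  { unfold ze. auto_derive. rewrite R0. repeat split; auto; lra. }
  assert (Ceta : continuous eta 0).
  { apply (ex_derive_continuous (V := R_NormedModule)).
    apply (ex_derive_plus (V := R_NormedModule) (fun _ => PI / 2)); [apply ex_derive_const|].
    apply (ex_derive_comp acos (fun s => Z s / 4)).
    - eexists. apply is_derive_acos. rewrite Z0. lra.
    - auto_derive. auto. }
  assert (Cze : continuous ze 0) by now apply (ex_derive_continuous (V := R_NormedModule)).
  assert (H1 : at_right 0 (fun s => 0 < Re s)).
  { apply at_right_gt; [|lra]. now apply (ex_derive_continuous (V := R_NormedModule)). }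
  assert (H2 : at_right 0 (fun s => Z s / 4 < 1)).
  { apply at_right_lt; [|lra]. apply (ex_derive_continuous (V := R_NormedModule)). auto_derive. auto. }
  assert (H3 : at_right 0 (fun s => 0 < x / 2 + ze s + eta s - s)).
  { apply at_right_gt; [|rewrite ze0, eta0; lra].
    apply (continuous_minus (V := R_NormedModule) (fun s => x / 2 + ze s + eta s)); [|apply continuous_id].
    apply (continuous_plus (V := R_NormedModule) (fun s => x / 2 + ze s)); auto.
    apply (continuous_plus (V := R_NormedModule) (fun s => x / 2)); auto. apply continuous_const. }
  assert (H4 : at_right 0 (fun s => 0 < e - (x / 2 + ze s - eta s))).
  { apply at_right_gt; [|rewrite ze0, eta0; lra].
    apply (continuous_minus (V := R_NormedModule) (fun s => e)); [apply continuous_const|].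
    apply (continuous_minus (V := R_NormedModule) (fun s => x / 2 + ze s)); auto.
    apply (continuous_plus (V := R_NormedModule) (fun s => x / 2)); auto. apply continuous_const. }
  assert (H5 : at_right 0 (fun s => 16 * (sin (x / 2 + w * s / 4))² < (Re s)² + (Im s)²)).
  { destruct Hw as [->| ->].
    - generalize (chord_gain_1 x Hc). apply filter_imp. intros s H.
      unfold Re, Im, th. now rewrite !Rmult_1_r, Rmult_1_l.
    - generalize (chord_gain_2 x Hc). apply filter_imp. intros s H.
      unfold Re, Im, th. replace (2 * 2) with 4 by ring.
      now replace (2 * s / 4) with (s / 2) by field. }
  assert (H6 : at_right 0 (fun s => x / 2 + w * s / 4 < PI)).
  { apply at_right_lt; [|lra]. apply (ex_derive_continuous (V := R_NormedModule)). auto_derive. auto. }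
  destruct (at_right_ex _ (filter_and _ _ (filter_and _ _ (filter_and _ _ H1 H2) (filter_and _ _ H3 H4))
    (filter_and _ _ (filter_and _ _ H5 H6) (filter_and _ _ (at_right_le _ Hd) at_right_pos))))
    as (s & ((P1 & P2) & P3 & P4) & (P5 & P6) & P7 & P8).
  destruct (polar_atan (Re s) (Im s) P1) as [E1 E2].
  fold (ze s) in E1, E2. fold (Z s) in E1, E2.
  assert (HZ : 0 < Z s).
  { apply Rmult_lt_0_compat; auto. apply sqrt_lt_R0. pose proof (Rle_0_sqr (Im s / Re s)). lra. }
  assert (EZ2 : (Re s)² + (Im s)² = (Z s)²).
  { rewrite <- E1, <- E2. pose proof (cos_sqr (ze s)) as E. unfold Rsqr. ring [E]. }
  assert (Esin : 4 * sin (eta s) = Z s).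
  { unfold eta. rewrite sin_plus, sin_PI2, cos_PI2, cos_acos by lra. field. }
  assert (Heta : PI / 2 <= eta s <= 3 * (PI / 2)).
  { unfold eta. pose proof (acos_bound (Z s / 4)). lra. }
  assert (Hgain : eta s < x / 2 + w * s / 4).
  { apply Rnot_le_lt. intros Hle.
    assert (0 <= w * s / 4) by (destruct Hw; subst; lra).
    assert (S1 : sin (eta s) <= sin (x / 2 + w * s / 4)) by (apply sin_decr_1; lra).
    rewrite EZ2, <- Esin in P5. unfold Rsqr in P5. nra. }
  set (M := x / 2 + ze s).
  assert (A1 := wr_left (u + s) (M + eta s - s) ltac:(unfold M; lra)).
  replace (u + s + (M + eta s - s)) with (u + M + eta s) in A1 by ring.
  assert (A2 := wr_right (u + M + eta s) (2 * eta s) ltac:(lra)).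
  replace (u + M + eta s - 2 * eta s) with (u + M - eta s) in A2 by ring.
  assert (A3 := wr_left (u + M - eta s) (e - (M - eta s)) ltac:(unfold M; lra)).
  replace (u + M - eta s + (e - (M - eta s))) with (u + e) in A3 by ring.
  assert (B1 := wr_trans _ _ _ _ _ _ _ _ _ (wr_trans _ _ _ _ _ _ _ _ _ A1 A2) A3).
  specialize (HF s ltac:(lra)).
  assert (T <= L1 - (w - 1) * s + (M + eta s - s + 2 * eta s + (e - (M - eta s))) + L2); [|lra].
  set (k := u + x / 2). set (r := k + th s).
  assert (Eu : u = r - s / 2) by (unfold r, k, th; field).
  assert (Es : u + s = r + s / 2) by (unfold r, k, th; field).
  assert (Eu' : u = k - x / 2) by (unfold k; ring).
  assert (Ex : u + x = k + x / 2) by (unfold k; field).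
  assert (EM : u + M = k + ze s) by (unfold M, k; ring).
  assert (X1' : sin (u + s) - sin u = 2 * sin (s / 2) * cos (k + th s)).
  { rewrite Es, Eu at 1. fold r. rewrite sin_plus, sin_minus. ring. }
  assert (Y1' : cos u - cos (u + s) = 2 * sin (s / 2) * sin (k + th s)).
  { rewrite Es, Eu at 1. fold r. rewrite cos_plus, cos_minus. ring. }
  assert (X2' : sin (u + x) - sin u = 2 * sin (x / 2) * cos k).
  { rewrite Ex, Eu' at 1. rewrite sin_plus, sin_minus. ring. }
  assert (Y2' : cos u - cos (u + x) = 2 * sin (x / 2) * sin k).
  { rewrite Ex, Eu' at 1. rewrite cos_plus, cos_minus. ring. }
  assert (X3' : 2 * (sin (u + M + eta s) - sin (u + M - eta s)) = Z s * cos (k + ze s)).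
  { rewrite EM, sin_plus, sin_minus, <- Esin. ring. }
  assert (Y3' : 2 * (cos (u + M - eta s) - cos (u + M + eta s)) = Z s * sin (k + ze s)).
  { rewrite EM, cos_plus, cos_minus, <- Esin. ring. }
  unfold Re in E1. unfold Im in E2.
  refine (optimal_split _ _ _ _ _ _ _ _ _ _ _ _ _ _ _ _ Hopt HF B1 HB _ _ _).
  - lra.
  - rewrite HX. apply Rminus_diag_uniq.
    transitivity (2 * (sin (u + M + eta s) - sin (u + M - eta s)) - w * (sin (u + s) - sin u)
      - 2 * (sin (u + x) - sin u)); [ring|].
    rewrite X1', X2', X3', (cos_plus k (ze s)), (cos_plus k (th s)).
    transitivity (cos k * (Z s * cos (ze s) - (4 * sin (x / 2) + 2 * w * sin (s / 2) * cos (th s)))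
      - sin k * (Z s * sin (ze s) - 2 * w * sin (s / 2) * sin (th s))); [ring|].
    rewrite E1, E2. ring.
  - rewrite HY. apply Rminus_diag_uniq.
    transitivity (2 * (cos (u + M - eta s) - cos (u + M + eta s)) - w * (cos u - cos (u + s))
      - 2 * (cos u - cos (u + x))); [ring|].
    rewrite Y1', Y2', Y3', (sin_plus k (ze s)), (sin_plus k (th s)).
    transitivity (sin k * (Z s * cos (ze s) - (4 * sin (x / 2) + 2 * w * sin (s / 2) * cos (th s)))
      + cos k * (Z s * sin (ze s) - 2 * w * sin (s / 2) * sin (th s))); [ring|].
    rewrite E1, E2. ring.
Qed.

(** * Forbidden patterns *)

(** The reflections of [softS] and [softE], for right arcs: the suffixes [d] and [i] recall that the
    departure heading may decrease and the arrival heading may increase. *)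
Definition softSd I u (pre : word) :=
  (pre = [] /\ canDec I u) \/ exists p g, pre = p ++ [(Lf, g)].
Definition softEi J v (post : word) :=
  (post = [] /\ canInc J v) \/ exists p g, post = (Lf, g) :: p.

Lemma softSd_mirror I u pre : softSd I u pre -> softS (negated I) (- u) (mirror pre).
Proof.
  intros [[-> H]|(p & g & ->)].
  - left. split; auto. now apply canInc_negated.
  - right. exists (mirror p), g. unfold mirror. now rewrite map_app.
Qed.
Lemma softEi_mirror J v post : softEi J v post -> softE (negated J) (- v) (mirror post).
Proof.
  intros [[-> H]|(p & g & ->)].
  - left. split; auto. now apply canDec_negated.
  - right. now exists (mirror p), g.
Qed.
Lemma softS_rev I u pre : softS I u pre -> softE (negated I) (- (u + turn pre)) (rev pre).
Proof.
  intros [[-> H]|(p & g & ->)].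
  - left. split; auto. simpl. rewrite Rplus_0_r. now apply canDec_negated.
  - right. exists (rev p), g. now rewrite rev_app_distr.
Qed.
Lemma softE_rev J v post : softE J v post -> softS (negated J) (- (v + turn post)) (rev post).
Proof.
  intros [[-> H]|(p & g & ->)].
  - left. split; auto. simpl. rewrite Rplus_0_r. now apply canInc_negated.
  - right. now exists (rev p), g.
Qed.

Lemma front_extend I u v L X Y L' X' Y' :
  front I u L X Y -> wr u v L' X' Y' -> front I v (L + L') (X + X') (Y + Y').
Proof. intros (o & Ho & H) H'. exists o. split; auto. exact (wr_trans _ _ _ _ _ _ _ _ _ H H'). Qed.
Lemma back_extend J u v L X Y L' X' Y' :
  wr u v L' X' Y' -> back J v L X Y -> back J u (L' + L) (X' + X) (Y' + Y).
Proof. intros H' (e & He & H). exists e. split; auto. exact (wr_trans _ _ _ _ _ _ _ _ _ H' H). Qed.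

Lemma solution_split I J u pre mid post : solution I J u (pre ++ mid ++ post) ->
  optimal I J (wlen pre + (wlen mid + wlen post))
    (wX u pre + (wX (u + turn pre) mid + wX (u + turn pre + turn mid) post))
    (wY u pre + (wY (u + turn pre) mid + wY (u + turn pre + turn mid) post)) /\
  front I (u + turn pre) (wlen pre) (wX u pre) (wY u pre) /\
  back J (u + turn pre + turn mid) (wlen post)
    (wX (u + turn pre + turn mid) post) (wY (u + turn pre + turn mid) post) /\
  positive_word pre /\ positive_word mid /\ positive_word post.
Proof.
  intros (Hu & Hv & Hp & Ho).
  rewrite !wlen_app, !wX_app, !wY_app in Ho. rewrite !turn_app in Hv.
  apply Forall_app in Hp as [H1 Hp]. apply Forall_app in Hp as [H2 H3].
  split; auto. split; [|split]; auto.
  - exists u. split; auto. apply wr_word. now apply positive_nonneg.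
  - eexists. split; [|apply wr_word; now apply positive_nonneg].
    now rewrite <- !Rplus_assoc in *.
Qed.

Lemma softE_bsoft_mid I J u pre mid post :
  solution I J u (pre ++ mid ++ post) -> softE J (u + turn pre + turn mid) post ->
  exists w, (w = 1 \/ w = 2) /\ bsoft J w (u + turn pre + turn mid) (wlen post)
    (wX (u + turn pre + turn mid) post) (wY (u + turn pre + turn mid) post).
Proof.
  intros Hs Hp. rewrite app_assoc in Hs.
  replace (u + turn pre + turn mid) with (u + turn (pre ++ mid)) in * by (rewrite turn_app; ring).
  exact (softE_bsoft I J u (pre ++ mid) post Hs Hp).
Qed.

Lemma positive_cons d a w : positive_word ((d, a) :: w) -> 0 < a /\ positive_word w.
Proof. intros H. now inversion H. Qed.

Ltac letters H := repeat match type of H with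
  | positive_word (_ :: _) => let H' := fresh H in apply positive_cons in H as [H' H]
  end.

Lemma solution_pos I J u w : solution I J u w -> positive_word w.
Proof. now intros (_ & _ & H & _). Qed.

Lemma positive_null w : positive_word w -> wlen w <= 0 -> w = [].
Proof.
  destruct w as [|[d a] w]; auto. intros H Hl. exfalso.
  inversion H as [|? ? Ha Hw]; subst. simpl in *.
  apply positive_nonneg, wlen_ge in Hw. lra.
Qed.

Lemma turn1 d a : turn [(d, a)] = sg d * a.
Proof. simpl; ring. Qed.

(** Deleting a full turn changes neither the end headings nor the displacement. A single full circle
    is the exception, since nothing of positive length would remain. *)
Lemma left_arc_short I J u pre a post : solution I J u (pre ++ [(Lf, a)] ++ post) ->
  a < 2 * PI \/ (a = 2 * PI /\ pre = [] /\ post = []).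
Proof.
  intros Hs. pose proof PI_RGT_0 as Hpi.
  destruct (solution_split _ _ _ _ _ _ Hs) as (Ho & HF & HB & Hp1 & _ & Hp2).
  simpl in Ho, HB. rewrite Rmult_1_l, !Rplus_0_r in *.
  pose proof (wlen_ge _ (positive_nonneg _ Hp1)). pose proof (wlen_ge _ (positive_nonneg _ Hp2)).
  destruct (Rlt_le_dec a (2 * PI)) as [|Ha]; auto. right.
  set (v := u + turn pre) in *.
  destruct (Rle_lt_dec (wlen pre + (a - 2 * PI) + wlen post) 0) as [Hle|Hlt].
  - split; [lra|]. split; apply positive_null; auto; lra.
  - exfalso.
    assert (Ec : cos (v + (a - 2 * PI)) = cos (v + a)).
    { replace (v + a) with (v + (a - 2 * PI) + 2 * INR 1 * PI) by (simpl; ring).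
      now rewrite cos_period. }
    assert (Es : sin (v + (a - 2 * PI)) = sin (v + a)).
    { replace (v + a) with (v + (a - 2 * PI) + 2 * INR 1 * PI) by (simpl; ring).
      now rewrite sin_period. }
    assert (A := wr_trans _ _ _ _ _ _ _ _ _ (wr_left v (a - 2 * PI) ltac:(lra))
      (wr_refl (v + (a - 2 * PI)) (v + a) Ec Es)).
    destruct HF as (o & Io & HF). destruct HB as (e & Je & HB).
    assert (B := wr_trans _ _ _ _ _ _ _ _ _ (wr_trans _ _ _ _ _ _ _ _ _ HF A) HB).
    assert (wlen pre + (a + wlen post) <= wlen pre + (a - 2 * PI) + wlen post); [|lra].
    apply (Ho o e); auto.
    eapply wr_eq; [exact B|..]; auto; rewrite ?Es, ?Ec; ring.
Qed.

Lemma left_arc_long I J u pre a post : solution I J u (pre ++ [(Lf, a)] ++ post) ->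
  softS I u pre -> softE J (u + turn pre + a) post -> PI < a.
Proof.
  intros Hs HS HE. destruct (solution_split _ _ _ _ _ _ Hs) as (Ho & _ & _ & _ & Hp & _).
  destruct (softS_fsoft _ _ _ _ _ Hs HS) as (w1 & Hw1 & HF).
  replace (u + turn pre + a) with (u + turn pre + turn [(Lf, a)]) in HE by (simpl; ring).
  destruct (softE_bsoft_mid _ _ _ _ _ _ Hs HE) as (w2 & Hw2 & HB).
  simpl in *. rewrite Rmult_1_l, !Rplus_0_r in *. letters Hp.
  refine (short_arc_core _ _ _ _ _ _ _ _ _ _ _ _ _ _ _ _ _ Ho HF HB _ _ _ _); try ring; lra.
Qed.

Lemma line_left_soft I J u pre l a post : solution I J u (pre ++ [(St, l); (Lf, a)] ++ post) ->
  softE J (u + turn pre + a) post -> False.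
Proof.
  intros Hs HE. destruct (solution_split _ _ _ _ _ _ Hs) as (Ho & HF & _ & _ & Hp & _).
  destruct (left_arc_short I J u (pre ++ [(St, l)]) a post) as [Ha|(_ & E & _)].
  { now rewrite <- app_assoc. }
  2:{ destruct pre; discriminate. }
  replace (u + turn pre + a) with (u + turn pre + turn [(St, l); (Lf, a)]) in HE by (simpl; ring).
  destruct (softE_bsoft_mid _ _ _ _ _ _ Hs HE) as (w2 & Hw2 & HB).
  simpl in *. rewrite Rmult_1_l, Rmult_0_l, Rplus_0_l, !Rplus_0_r in *. letters Hp.
  destruct (Rle_lt_dec a PI).
  - refine (line_arc_core_minor _ _ _ _ _ _ _ _ _ _ _ _ _ _ _ _ Hp0 _ Ho HF HB _ _ _); try ring; lra.
  - refine (line_arc_core_major _ _ _ _ _ _ _ _ _ _ _ _ _ _ _ _ Hp0 _ Ho HF HB _ _ _); try ring; lra.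
Qed.

Lemma line_left_line I J u pre l1 a l2 post :
  solution I J u (pre ++ [(St, l1); (Lf, a); (St, l2)] ++ post) -> False.
Proof.
  intros Hs. destruct (solution_split _ _ _ _ _ _ Hs) as (Ho & HF & HB & _ & Hp & _).
  destruct (left_arc_short I J u (pre ++ [(St, l1)]) a ((St, l2) :: post)) as [Ha|(_ & E & _)].
  { now rewrite <- app_assoc. }
  2:{ destruct pre; discriminate. }
  simpl in *. rewrite Rmult_1_l, !Rmult_0_l, Rplus_0_l, !Rplus_0_r in *. letters Hp.
  (* The variation is symmetric and moves equal lengths on both sides; the excess of the longer
     segment is left to [front] or [back]. *)
  set (l := Rmin l1 l2).
  assert (Hl : 0 < l /\ l <= l1 /\ l <= l2).
  { unfold l. split; [apply Rmin_glb_lt; auto|split; [apply Rmin_l|apply Rmin_r]]. }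
  pose proof (front_extend _ _ _ _ _ _ _ _ _ HF (wr_line (u + turn pre) (l1 - l) ltac:(lra))) as HF'.
  pose proof (back_extend _ _ _ _ _ _ _ _ _ (wr_line (u + turn pre + a) (l2 - l) ltac:(lra)) HB) as HB'.
  refine (line_arc_line_core _ _ _ _ _ _ l a _ _ _ _ _ _ _ _ Ho HF' HB' _ _ _); try ring; lra.
Qed.

(** The left arc is soft at both ends, at its start because a right arc precedes it, so it turns by
    more than PI; a longer right arc would then admit the move of [unequal_arcs_core]. *)
Lemma right_left_le I J u pre a b post : solution I J u (pre ++ [(Rt, a); (Lf, b)] ++ post) ->
  softE J (u + turn pre - a + b) post -> a < 2 * PI -> PI < b /\ a <= b.
Proof.
  intros Hs HE Ha2. destruct (solution_split _ _ _ _ _ _ Hs) as (Ho & HF & _ & _ & Hp & _).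
  assert (Hs' : solution I J u ((pre ++ [(Rt, a)]) ++ [(Lf, b)] ++ post)) by now rewrite <- app_assoc.
  assert (Hb : PI < b).
  { apply (left_arc_long _ _ _ _ _ _ Hs').
    - right. now exists pre, a.
    - rewrite turn_app, turn1. simpl.
      replace (u + (turn pre + -1 * a) + b) with (u + turn pre - a + b) by ring. exact HE. }
  split; auto.
  destruct (left_arc_short _ _ _ _ _ _ Hs') as [Hb2|(_ & E & _)].
  2:{ destruct pre; discriminate. }
  apply Rnot_lt_le. intros Hlt.
  replace (u + turn pre - a + b) with (u + turn pre + turn [(Rt, a); (Lf, b)]) in HE by (simpl; ring).
  destruct (softE_bsoft_mid _ _ _ _ _ _ Hs HE) as (w2 & Hw2 & HB).
  simpl in *.
  replace (u + turn pre + (-1 * a + (1 * b + 0))) with (u + turn pre - a + b) in * by ring.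
  replace (u + turn pre + -1 * a) with (u + turn pre - a) in * by ring.
  refine (unequal_arcs_core _ _ _ _ _ _ a b _ _ _ _ _ _ _ _ Hb _ Ho HF HB _ _ _); try ring; lra.
Qed.

Lemma equal_arcs I J u pre x e post :
  solution I J u (pre ++ [(Lf, x); (Rt, x); (Lf, e)] ++ post) ->
  softS I u pre -> PI < x -> False.
Proof.
  intros Hs HS Hx. destruct (solution_split _ _ _ _ _ _ Hs) as (Ho & _ & HB & _ & Hp & _).
  destruct (left_arc_short I J u pre x ((Rt, x) :: (Lf, e) :: post) Hs) as [Hx2|(_ & _ & E)];
    [|discriminate].
  destruct (softS_fsoft _ _ _ _ _ Hs HS) as (w & Hw & HF).
  letters Hp. simpl in *.
  replace (u + turn pre + (1 * x + (-1 * x + (1 * e + 0)))) with (u + turn pre + e) in * by ring.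
  replace (u + turn pre + 1 * x) with (u + turn pre + x) in * by ring.
  replace (u + turn pre + x - x) with (u + turn pre) in * by ring.
  replace (u + turn pre + x + -1 * x) with (u + turn pre) in * by ring.
  refine (equal_arcs_core _ _ _ _ _ _ x e _ _ _ _ _ _ _ Hw _ _ Ho HF HB _ _ _); try ring; lra.
Qed.

Lemma solution_mirror_mid I J u pre mid post : solution I J u (pre ++ mid ++ post) ->
  solution (negated I) (negated J) (- u) (mirror pre ++ mirror mid ++ mirror post).
Proof. intros H. apply solution_mirror in H. unfold mirror in *. now rewrite !map_app in H. Qed.

Lemma solution_rev_mid I J u pre mid post : solution I J u (pre ++ mid ++ post) ->
  solution (negated J) (negated I) (- (u + turn pre + turn mid + turn post))
    (rev post ++ rev mid ++ rev pre).
Proof.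
  intros H. apply solution_rev in H. rewrite !rev_app_distr, <- app_assoc in H.
  rewrite !turn_app in H.
  now replace (u + turn pre + turn mid + turn post) with (u + (turn pre + (turn mid + turn post))) by ring.
Qed.

Lemma right_arc_short I J u pre a post : solution I J u (pre ++ [(Rt, a)] ++ post) ->
  a < 2 * PI \/ (a = 2 * PI /\ pre = [] /\ post = []).
Proof.
  intros H. apply solution_mirror_mid in H.
  destruct (left_arc_short _ _ _ _ _ _ H) as [|(E & E1 & E2)]; auto.
  right. split; auto. split; [destruct pre|destruct post]; auto; discriminate.
Qed.

Lemma right_arc_long I J u pre a post : solution I J u (pre ++ [(Rt, a)] ++ post) ->
  softSd I u pre -> softEi J (u + turn pre - a) post -> PI < a.
Proof.
  intros H HS HE. apply solution_mirror_mid in H.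
  apply (left_arc_long _ _ _ _ _ _ H); [now apply softSd_mirror|].
  rewrite turn_mirror; cbn [snd]. replace (- u + - turn pre + a) with (- (u + turn pre - a)) by ring.
  now apply softEi_mirror.
Qed.

Lemma line_right_soft I J u pre l a post : solution I J u (pre ++ [(St, l); (Rt, a)] ++ post) ->
  softEi J (u + turn pre - a) post -> False.
Proof.
  intros H HE. apply solution_mirror_mid in H.
  apply (line_left_soft _ _ _ _ _ _ _ H).
  rewrite turn_mirror; cbn [snd]. replace (- u + - turn pre + a) with (- (u + turn pre - a)) by ring.
  now apply softEi_mirror.
Qed.

Lemma left_line_soft I J u pre a l post : solution I J u (pre ++ [(Lf, a); (St, l)] ++ post) ->
  softS I u pre -> False.
Proof.
  intros H HS. apply solution_rev_mid in H.
  apply (line_left_soft _ _ _ _ _ _ _ H). rewrite turn_rev. simpl.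
  replace (- (u + turn pre + (1 * a + (0 * l + 0)) + turn post) + turn post + a)
    with (- (u + turn pre)) by ring.
  now apply softS_rev.
Qed.

Lemma right_line_soft I J u pre a l post : solution I J u (pre ++ [(Rt, a); (St, l)] ++ post) ->
  softSd I u pre -> False.
Proof.
  intros H HS. apply solution_mirror_mid in H.
  apply (left_line_soft _ _ _ _ _ _ _ H). now apply softSd_mirror.
Qed.

Lemma line_right_line I J u pre l1 a l2 post :
  solution I J u (pre ++ [(St, l1); (Rt, a); (St, l2)] ++ post) -> False.
Proof. intros H. apply solution_mirror_mid in H. exact (line_left_line _ _ _ _ _ _ _ _ H). Qed.

Lemma left_right_le I J u pre a b post : solution I J u (pre ++ [(Lf, a); (Rt, b)] ++ post) ->
  softEi J (u + turn pre + a - b) post -> a < 2 * PI -> PI < b /\ a <= b.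
Proof.
  intros H HE. apply solution_mirror_mid in H.
  apply (right_left_le _ _ _ _ _ _ _ H).
  rewrite turn_mirror; cbn [snd]. replace (- u + - turn pre - a + b) with (- (u + turn pre + a - b)) by ring.
  now apply softEi_mirror.
Qed.

Lemma left_right_ge I J u pre a b post : solution I J u (pre ++ [(Lf, a); (Rt, b)] ++ post) ->
  softS I u pre -> b < 2 * PI -> PI < a /\ b <= a.
Proof.
  intros H HS. apply solution_rev_mid in H.
  apply (right_left_le _ _ _ _ _ _ _ H). rewrite turn_rev. simpl.
  replace (- (u + turn pre + (1 * a + (-1 * b + 0)) + turn post) + turn post - b + a)
    with (- (u + turn pre)) by ring.
  now apply softS_rev.
Qed.

Lemma right_left_ge I J u pre a b post : solution I J u (pre ++ [(Rt, a); (Lf, b)] ++ post) ->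
  softSd I u pre -> b < 2 * PI -> PI < a /\ b <= a.
Proof.
  intros H HS. apply solution_mirror_mid in H.
  apply (left_right_ge _ _ _ _ _ _ _ H). now apply softSd_mirror.
Qed.

(** The first two arcs can be compared in both directions: the first has a soft start, and the
    second a soft far end because a left arc follows. They are therefore equal, which [equal_arcs]
    excludes. *)
Lemma left_right_left_softS I J u pre x y e post :
  solution I J u (pre ++ [(Lf, x); (Rt, y); (Lf, e)] ++ post) -> softS I u pre -> False.
Proof.
  intros H HS.
  assert (H' : solution I J u (pre ++ [(Lf, x); (Rt, y)] ++ (Lf, e) :: post)) by exact H.
  destruct (left_arc_short I J u pre x ((Rt, y) :: (Lf, e) :: post)) as [Hx|(_ & _ & E)]; auto;
    [|discriminate].
  destruct (right_arc_short I J u (pre ++ [(Lf, x)]) y ((Lf, e) :: post)) as [Hy|(_ & _ & E)];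
    [now rewrite <- app_assoc| |discriminate].
  destruct (left_right_ge _ _ _ _ _ _ _ H' HS Hy) as [Hx1 Hxy].
  destruct (left_right_le _ _ _ _ _ _ _ H') as [_ Hyx]; auto.
  { right. now exists post, e. }
  assert (y = x) by lra. subst y. exact (equal_arcs _ _ _ _ _ _ _ H HS Hx1).
Qed.

Lemma right_left_right_softS I J u pre x y e post :
  solution I J u (pre ++ [(Rt, x); (Lf, y); (Rt, e)] ++ post) -> softSd I u pre -> False.
Proof.
  intros H HS. apply solution_mirror_mid in H.
  apply (left_right_left_softS _ _ _ _ _ _ _ _ H). now apply softSd_mirror.
Qed.

Lemma left_right_left_softE I J u pre x y e post :
  solution I J u (pre ++ [(Lf, e); (Rt, y); (Lf, x)] ++ post) ->
  softE J (u + turn pre + e - y + x) post -> False.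
Proof.
  intros H HE. apply solution_rev_mid in H.
  apply (left_right_left_softS _ _ _ _ _ _ _ _ H). apply softE_rev in HE.
  simpl. now replace (u + turn pre + (1 * e + (-1 * y + (1 * x + 0))) + turn post)
    with (u + turn pre + e - y + x + turn post) by ring.
Qed.

Lemma right_left_right_softE I J u pre x y e post :
  solution I J u (pre ++ [(Rt, e); (Lf, y); (Rt, x)] ++ post) ->
  softEi J (u + turn pre - e + y - x) post -> False.
Proof.
  intros H HE. apply solution_mirror_mid in H.
  apply (left_right_left_softE _ _ _ _ _ _ _ _ H). apply softEi_mirror in HE.
  rewrite turn_mirror; cbn [snd]. now replace (- u + - turn pre + e - y + x)
    with (- (u + turn pre - e + y - x)) by ring.
Qed.

(** * Optimal words have at most three letters *)

Fixpoint alternating (w : word) : Prop :=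
  match w with
  | (d, _) :: w' => match w' with (e, _) :: _ => d <> e | [] => True end /\ alternating w'
  | [] => True
  end.

(** Either continuation is impossible: an opposite arc makes the far end of [c] soft, and a second
    segment encloses [c] between segments. *)
Lemma no_line_arc I J u l c a d b post :
  solution I J u ((St, l) :: (c, a) :: (d, b) :: post) -> c <> St -> d <> c -> False.
Proof.
  intros H Hc Hd. destruct c, d; try congruence.
  - apply (line_left_soft I J u [] l a ((Rt, b) :: post) H). right. now exists post, b.
  - exact (line_left_line I J u [] l a b post H).
  - apply (line_right_soft I J u [] l a ((Lf, b) :: post) H). right. now exists post, b.
  - exact (line_right_line I J u [] l a b post H).
Qed.

Lemma no_arc_line I J u pre d b c a l post :
  solution I J u (pre ++ [(d, b); (c, a); (St, l)] ++ post) -> c <> St -> d <> c -> False.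
Proof.
  intros H Hc Hd.
  assert (H' : solution I J u ((pre ++ [(d, b)]) ++ [(c, a); (St, l)] ++ post)) by now rewrite <- app_assoc.
  destruct c, d; try congruence.
  - apply (left_line_soft _ _ _ _ _ _ _ H'). right. now exists pre, b.
  - exact (line_left_line _ _ _ _ _ _ _ _ H).
  - apply (right_line_soft _ _ _ _ _ _ _ H'). right. now exists pre, b.
  - exact (line_right_line _ _ _ _ _ _ _ _ H).
Qed.

Lemma no_line_arc_tail I J u d0 a0 l c a d b post :
  solution I J u ((d0, a0) :: (St, l) :: (c, a) :: (d, b) :: post) -> c <> St -> d <> c -> False.
Proof.
  intros H Hc Hd. destruct c, d; try congruence.
  - apply (line_left_soft I J u [(d0, a0)] l a ((Rt, b) :: post) H). right. now exists post, b.
  - exact (line_left_line I J u [(d0, a0)] l a b post H).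
  - apply (line_right_soft I J u [(d0, a0)] l a ((Lf, b) :: post) H). right. now exists post, b.
  - exact (line_right_line I J u [(d0, a0)] l a b post H).
Qed.

(** A segment among the first four letters has two of them before it or two after it, which is
    excluded. Otherwise four arcs alternate; the first gives the second a soft start, and the second
    to fourth arcs form a forbidden triple. *)
Lemma solution_size I J u w : solution I J u w -> alternating w -> (length w <= 3)%nat.
Proof.
  intros H Ha.
  destruct w as [|[d1 a1] [|[d2 a2] [|[d3 a3] [|[d4 a4] w]]]]; simpl; try lia. exfalso.
  simpl in Ha. destruct Ha as (N1 & N2 & N3 & _).
  destruct d1; [| |apply (no_line_arc _ _ _ _ _ _ _ _ _ H); congruence];
  (destruct d2; [| |apply (no_line_arc_tail _ _ _ _ _ _ _ _ _ _ _ H); congruence]);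
  (destruct d3; [| |apply (no_arc_line I J u [] _ _ _ _ _ _ H); congruence]);
  (destruct d4; [| |apply (no_arc_line I J u [_] _ _ _ _ _ _ H); congruence]); try congruence.
  - apply (right_left_right_softS I J u [(Lf, a1)] _ _ _ _ H). right. now exists [], a1.
  - apply (left_right_left_softS I J u [(Rt, a1)] _ _ _ _ H). right. now exists [], a1.
Qed.

(** * Short windows *)

Lemma diff_le (F G f g : R -> R) a b : a <= b ->
  (forall t, a <= t <= b -> is_derive F t (f t)) ->
  (forall t, a <= t <= b -> is_derive G t (g t)) ->
  (forall t, a <= t <= b -> f t <= g t) -> F b - F a <= G b - G a.
Proof.
  intros Hab HF HG H.
  destruct (MVT_gen (fun t => G t - F t) a b (fun t => g t - f t)) as (c & Hc & E).
  - rewrite Rmin_left, Rmax_right by auto. intros t Ht.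
    apply (is_derive_minus (V := R_NormedModule)); [apply HG|apply HF]; lra.
  - rewrite Rmin_left, Rmax_right by auto. intros t Ht.
    apply derivable_continuous_pt, ex_derive_Reals_0.
    exists (g t - f t). apply (is_derive_minus (V := R_NormedModule)); [apply HG|apply HF]; lra.
  - rewrite Rmin_left, Rmax_right in Hc by auto.
    pose proof (H c Hc). assert (0 <= (g c - f c) * (b - a)) by (apply Rmult_le_pos; lra). lra.
Qed.

(** The point [t] may be an end point: the two-sided derivative is tested with one small nonzero
    step that stays in the interval. *)
Lemma derive_zero (F : R -> R) a b t l : a < b -> a <= t <= b -> is_derive F t l ->
  (forall s, a <= s <= b -> F s = F a) -> l = 0.
Proof.
  intros Hab Ht HF H. destruct (Req_dec l 0) as [|Hl]; auto. exfalso.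
  apply is_derive_Reals in HF. destruct (HF (Rabs l) (Rabs_pos_lt l Hl)) as [d Hd].
  assert (exists h, h <> 0 /\ Rabs h < d /\ a <= t + h <= b) as (h & Hh & Hh' & Hr).
  { pose proof (cond_pos d). destruct (Rlt_le_dec t b).
    - exists (Rmin (d / 2) (b - t)). pose proof (Rmin_l (d / 2) (b - t)). pose proof (Rmin_r (d / 2) (b - t)).
      assert (0 < Rmin (d / 2) (b - t)) by (apply Rmin_glb_lt; lra).
      rewrite Rabs_right by lra. lra.
    - exists (- Rmin (d / 2) (t - a)). pose proof (Rmin_l (d / 2) (t - a)). pose proof (Rmin_r (d / 2) (t - a)).
      assert (0 < Rmin (d / 2) (t - a)) by (apply Rmin_glb_lt; lra).
      rewrite Rabs_Ropp, Rabs_right by lra. lra. }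
  specialize (Hd h Hh Hh'). rewrite (H (t + h) Hr), (H t Ht) in Hd.
  replace ((F a - F a) / h - l) with (- l) in Hd by (field; auto).
  rewrite Rabs_Ropp in Hd. lra.
Qed.

(** The equality case of [diff_le]: without slack in the total increments, [G - F] is constant, so
    the derivatives agree up to the end points. *)
Lemma diff_eq (F G f g : R -> R) a b :
  (forall t, a <= t <= b -> is_derive F t (f t)) ->
  (forall t, a <= t <= b -> is_derive G t (g t)) ->
  (forall t, a <= t <= b -> f t <= g t) -> G b - G a <= F b - F a ->
  forall t, a < b -> a <= t <= b -> f t = g t.
Proof.
  intros HF HG H E t Hab Ht.
  assert (g t - f t = 0); [|lra].
  apply (derive_zero (fun s => G s - F s) a b t); auto.
  - apply (is_derive_minus (V := R_NormedModule)); auto.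
  - intros s Hs.
    assert (F s - F a <= G s - G a)
      by (apply (diff_le F G f g); try lra; intros; try apply HF; try apply HG; try apply H; lra).
    assert (F b - F s <= G b - G s)
      by (apply (diff_le F G f g); try lra; intros; try apply HF; try apply HG; try apply H; lra).
    lra.
Qed.

Lemma cos_lipschitz a b : Rabs (cos a - cos b) <= Rabs (a - b).
Proof.
  assert (forall a b, a <= b -> Rabs (cos a - cos b) <= Rabs (a - b)) as H.
  { clear. intros a b Hab. rewrite (Rabs_left1 (a - b)) by lra.
    assert (cos b - cos a <= b - a).
    { apply (diff_le cos (fun t => t) (fun t => - sin t) (fun _ => 1)); auto.
      - intros; auto_derive; auto; ring.
      - intros; auto_derive; auto.
      - intros t _. pose proof (SIN_bound t). lra. }
    assert (- cos b - - cos a <= b - a).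
    { apply (diff_le (fun t => - cos t) (fun t => t) (fun t => sin t) (fun _ => 1)); auto.
      - intros; auto_derive; auto; ring.
      - intros; auto_derive; auto.
      - intros t _. pose proof (SIN_bound t). lra. }
    apply Rabs_le. lra. }
  destruct (Rle_lt_dec a b); auto.
  rewrite Rabs_minus_sym, (Rabs_minus_sym a). apply H. lra.
Qed.

Lemma sin_le_abs a : Rabs (sin a) <= Rabs a.
Proof.
  pose proof (cos_lipschitz (PI / 2 - a) (PI / 2)) as H.
  rewrite cos_PI2, cos_shift in H. rewrite Rminus_0_r in H.
  replace (PI / 2 - a - PI / 2) with (- a) in H by ring. now rewrite Rabs_Ropp in H.
Qed.

(** The constant 1/2 is what the chain [cos v >= 1 - |v| >= |v| >= |sin v|] requires. *)
Lemma small_angle v : Rabs v <= 1 / 2 -> 0 < cos v /\ Rabs (sin v) <= cos v.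
Proof.
  intros Hv. pose proof (cos_lipschitz v 0) as H. rewrite cos_0, Rminus_0_r in H.
  pose proof (sin_le_abs v). apply Rabs_le_between in H. split; [|lra].
  pose proof (Rabs_pos v). lra.
Qed.

Lemma cos_sub_sin_decreasing v u : Rabs v <= 1 / 2 -> Rabs u <= 1 / 2 -> v <= u ->
  cos u - sin u <= cos v - sin v.
Proof.
  intros Hv Hu Hvu. apply Rabs_le_between in Hv, Hu.
  pose proof (diff_le (fun t => cos t - sin t) (fun _ => 0) (fun t => - sin t - cos t) (fun _ => 0) v u Hvu) as H.
  cut (cos u - sin u - (cos v - sin v) <= 0 - 0); [lra|]. apply H.
  - intros; auto_derive; auto; ring.
  - intros; apply (is_derive_const (V := R_NormedModule)).
  - intros t Ht. destruct (small_angle t) as [_ K]; [apply Rabs_le; lra|].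
    apply Rabs_le_between in K. lra.
Qed.

Lemma PI_gt_3 : 3 < PI.
Proof. pose proof PI2_3_2. lra. Qed.

(** * Comparison of a window with an arc-segment-arc path *)

Definition steered (x y th : R -> R) e :=
  (forall t, 0 <= t <= e -> is_derive x t (cos (th t))) /\
  (forall t, 0 <= t <= e -> is_derive y t (sin (th t))) /\
  (forall s t, 0 <= s <= t -> t <= e -> Rabs (th t - th s) <= t - s).

Definition along (x y : R -> R) e phi := (x e - x 0) * cos phi + (y e - y 0) * sin phi.
Definition across (x y : R -> R) e phi := (y e - y 0) * cos phi - (x e - x 0) * sin phi.

Lemma steered_mirror x y th e : steered x y th e ->
  steered x (fun t => - y t) (fun t => - th t) e.
Proof.
  intros (Hx & Hy & HL). split; [|split].
  - intros t Ht. rewrite cos_neg. auto.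
  - intros t Ht. rewrite sin_neg. apply (is_derive_opp (V := R_NormedModule)). auto.
  - intros s t Hs Ht. replace (- th t - - th s) with (- (th t - th s)) by ring.
    rewrite Rabs_Ropp. auto.
Qed.

Lemma along_mirror x y e phi : along x (fun t => - y t) e (- phi) = along x y e phi.
Proof. unfold along. rewrite cos_neg, sin_neg. ring. Qed.
Lemma across_mirror x y e phi : across x (fun t => - y t) e (- phi) = - across x y e phi.
Proof. unfold across. rewrite cos_neg, sin_neg. ring. Qed.

Section Steered.

Variables (x y th : R -> R) (e phi : R).
Hypothesis (HS : steered x y th e) (He : 0 < e <= 1 / 4).
Let A := th 0.
Let B := th e.
Let f t := x t * cos phi + y t * sin phi.
Let g t := y t * cos phi - x t * sin phi.

Lemma along_derive t : 0 <= t <= e -> is_derive f t (cos (th t - phi)).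
Proof.
  intros Ht. destruct HS as (Hx & Hy & _).
  rewrite cos_minus. unfold f.
  apply (is_derive_plus (V := R_NormedModule) (fun t => x t * cos phi) (fun t => y t * sin phi)).
  - apply (is_derive_scal_l (V := R_NormedModule) x t _ (cos phi)). auto.
  - apply (is_derive_scal_l (V := R_NormedModule) y t _ (sin phi)). auto.
Qed.

Lemma across_derive t : 0 <= t <= e -> is_derive g t (sin (th t - phi)).
Proof.
  intros Ht. destruct HS as (Hx & Hy & _).
  rewrite sin_minus. unfold g.
  apply (is_derive_minus (V := R_NormedModule) (fun t => y t * cos phi) (fun t => x t * sin phi)).
  - apply (is_derive_scal_l (V := R_NormedModule) y t _ (cos phi)). auto.
  - apply (is_derive_scal_l (V := R_NormedModule) x t _ (sin phi)). auto.
Qed.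

Lemma heading_bounds t : 0 <= t <= e ->
  A - t <= th t <= A + t /\ B - (e - t) <= th t <= B + (e - t).
Proof.
  intros Ht. destruct HS as (_ & _ & HL).
  pose proof (HL 0 t ltac:(lra) ltac:(lra)) as H1. pose proof (HL t e ltac:(lra) ltac:(lra)) as H2.
  apply Rabs_le_between in H1, H2. fold A in H1. fold B in H2. lra.
Qed.

Hypothesis Hphi : Rabs (phi - A) + Rabs (phi - B) <= e.

Lemma heading_close t : 0 <= t <= e -> Rabs (th t - phi) <= 1 / 2.
Proof.
  intros Ht. pose proof (heading_bounds t Ht).
  pose proof (Rabs_pos (phi - A)). pose proof (Rabs_pos (phi - B)).
  pose proof (Rle_abs (phi - A)). pose proof (Rabs_maj2 (phi - A)).
  apply Rabs_le. lra.
Qed.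

Lemma along_eq : along x y e phi = f e - f 0.
Proof. unfold along, f. ring. Qed.
Lemma across_eq : across x y e phi = g e - g 0.
Proof. unfold across, g. ring. Qed.

(** For this extreme [phi] the comparison path turns left up to [phi] and then right, without a
    segment. The Lipschitz bounds from the two ends keep [th] below its heading, so the lateral rate
    [sin (th - phi)] is smaller at every time. *)
Lemma across_top : 0 <= phi - A -> 0 <= phi - B -> (phi - A) + (phi - B) = e ->
  across x y e phi <= - (1 - cos (phi - A)) - (1 - cos (phi - B)).
Proof.
  intros HA HB E. rewrite across_eq. set (t1 := phi - A) in *. set (t3 := phi - B) in *.
  pose proof PI_gt_3 as Hpi.
  assert (g t1 - g 0 <= - cos (t1 - t1) - - cos (t1 - 0)).
  { apply (diff_le g (fun t => - cos (t1 - t)) (fun t => sin (th t - phi)) (fun t => - sin (t1 - t))); auto.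
    - intros; apply across_derive; lra.
    - intros; auto_derive; auto; ring_simplify. unfold Rminus. ring.
    - intros t Ht. rewrite <- sin_neg. pose proof (heading_bounds t ltac:(lra)).
      pose proof (heading_close t ltac:(lra)) as K. apply Rabs_le_between in K.
      unfold t1, t3 in *. apply sin_incr_1; lra. }
  assert (g e - g t1 <= cos (e - t1) - cos (t1 - t1)).
  { apply (diff_le g (fun t => cos (t - t1)) (fun t => sin (th t - phi)) (fun t => - sin (t - t1))); [lra| | |].
    - intros; apply across_derive; lra.
    - intros; auto_derive; auto; ring_simplify. unfold Rminus. ring.
    - intros t Ht. rewrite <- sin_neg. pose proof (heading_bounds t ltac:(lra)).
      pose proof (heading_close t ltac:(lra)) as K. apply Rabs_le_between in K.
      unfold t1, t3 in *. apply sin_incr_1; lra. }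
  rewrite Rminus_diag, cos_0, Rminus_0_r in *.
  replace (e - t1) with t3 in * by lra. lra.
Qed.

(** The Lipschitz bounds push [th] below the comparison heading, where cosine is smaller, so the
    advance alone has no lower bound of this kind. But [cos v - sin v] decreases in [v]: on the two
    end stretches [along - across] gains at least as much as on the arcs, and in between it does not
    drop. The prescribed value of [across] then isolates [along]. *)
Lemma along_ge_same_side : 0 <= phi - A -> 0 <= phi - B ->
  across x y e phi = - (1 - cos (phi - A)) - (1 - cos (phi - B)) ->
  sin (phi - A) + sin (phi - B) <= along x y e phi.
Proof.
  intros HA HB E. pose proof Hphi as Hp. rewrite !Rabs_right in Hp by lra.
  rewrite across_eq in E. rewrite along_eq.
  set (t1 := phi - A) in *. set (t3 := phi - B) in *.
  assert (D : forall t, 0 <= t <= e ->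
    is_derive (fun t => f t - g t) t (cos (th t - phi) - sin (th t - phi))).
  { intros t Ht. apply (is_derive_minus (V := R_NormedModule)); [now apply along_derive|now apply across_derive]. }
  assert (cos (t1 - t1) - sin (t1 - t1) - (cos (t1 - 0) - sin (t1 - 0)) <= f t1 - g t1 - (f 0 - g 0)).
  { apply (diff_le (fun t => cos (t1 - t) - sin (t1 - t)) (fun t => f t - g t)
      (fun t => cos (- (t1 - t)) - sin (- (t1 - t))) (fun t => cos (th t - phi) - sin (th t - phi))); auto.
    - intros; rewrite cos_neg, sin_neg. auto_derive; auto. unfold Rminus. ring.
    - intros; apply D; lra.
    - intros t Ht. pose proof (heading_bounds t ltac:(lra)).
      apply cos_sub_sin_decreasing; [apply heading_close; lra| |unfold t1, t3 in *; lra].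
      apply Rabs_le. lra. }
  assert (0 - 0 <= f (e - t3) - g (e - t3) - (f t1 - g t1)).
  { apply (diff_le (fun t => 0) (fun t => f t - g t)
      (fun t => 0) (fun t => cos (th t - phi) - sin (th t - phi))); [lra| | |].
    - intros; apply (is_derive_const (V := R_NormedModule)).
    - intros; apply D; lra.
    - intros t Ht. destruct (small_angle (th t - phi)) as [_ K]; [apply heading_close; lra|].
      apply Rabs_le_between in K. lra. }
  assert (sin (e - (e - t3)) - cos (e - (e - t3)) - (sin (e - t3 - (e - t3)) - cos (e - t3 - (e - t3)))
    <= f e - g e - (f (e - t3) - g (e - t3))).
  { apply (diff_le (fun t => sin (t - (e - t3)) - cos (t - (e - t3))) (fun t => f t - g t)
      (fun t => cos (- (t - (e - t3))) - sin (- (t - (e - t3)))) (fun t => cos (th t - phi) - sin (th t - phi))); [lra| | |].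
    - intros; rewrite cos_neg, sin_neg. auto_derive; auto. unfold Rminus. ring.
    - intros; apply D; lra.
    - intros t Ht. pose proof (heading_bounds t ltac:(lra)).
      apply cos_sub_sin_decreasing; [apply heading_close; lra| |unfold t1, t3 in *; lra].
      apply Rabs_le. lra. }
  replace (e - (e - t3)) with t3 in * by ring. rewrite !Rminus_diag, Rminus_0_r, cos_0, sin_0 in *. lra.
Qed.

(** Here the comparison heading rises from [A] through [phi] to [B], and [th] stays within the slack
    [s = e - t1 - t3] of it. Cosine is 1-Lipschitz, so at most [s * e <= s] of the advance is lost,
    no more than the segment contributes. *)
Lemma along_ge_opposite : A <= phi <= B ->
  sin (phi - A) + sin (B - phi) <= along x y e phi.
Proof.
  intros HA. pose proof Hphi as Hp. rewrite (Rabs_right (phi - A)), (Rabs_left1 (phi - B)) in Hp by lra.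
  rewrite along_eq. set (t1 := phi - A) in *. set (t3 := B - phi) in *.
  set (s := e - t1 - t3).
  assert (Hs : 0 <= s) by (unfold s, t3 in *; lra).
  assert (Ht3 : 0 <= t3) by (unfold t3; lra). assert (Ht1 : 0 <= t1) by (unfold t1; lra).
  assert (C : forall u v, u - s <= v <= u + s -> cos u - s <= cos v).
  { intros u v Huv. pose proof (cos_lipschitz u v) as K.
    assert (Rabs (u - v) <= s) by (apply Rabs_le; lra).
    pose proof (Rle_abs (cos u - cos v)). lra. }
  assert (- sin (t1 - t1) - s * t1 - (- sin (t1 - 0) - s * 0) <= f t1 - f 0).
  { apply (diff_le (fun t => - sin (t1 - t) - s * t) f
      (fun t => cos (- (t1 - t)) - s) (fun t => cos (th t - phi))); auto.
    - intros; rewrite cos_neg. auto_derive; auto. unfold Rminus. ring.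
    - intros; apply along_derive; unfold s in *; lra.
    - intros t Ht. apply C. pose proof (heading_bounds t ltac:(unfold s in *; lra)).
      unfold s, t1, t3 in *. lra. }
  assert ((1 - s) * (e - t3) - (1 - s) * t1 <= f (e - t3) - f t1).
  { apply (diff_le (fun t => (1 - s) * t) f (fun t => 1 - s) (fun t => cos (th t - phi))).
    - unfold s in *; lra.
    - intros; auto_derive; auto. ring.
    - intros; apply along_derive; lra.
    - intros t Ht. rewrite <- cos_0. apply C. pose proof (heading_bounds t ltac:(unfold s in *; lra)).
      unfold s, t1, t3 in *. lra. }
  assert (sin (e - (e - t3)) - s * e - (sin (e - t3 - (e - t3)) - s * (e - t3)) <= f e - f (e - t3)).
  { apply (diff_le (fun t => sin (t - (e - t3)) - s * t) f
      (fun t => cos (t - (e - t3)) - s) (fun t => cos (th t - phi))); [lra| | |].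
    - intros; auto_derive; auto. unfold Rminus. ring.
    - intros; apply along_derive; unfold s in *; lra.
    - intros t Ht. apply C. pose proof (heading_bounds t ltac:(unfold s in *; lra)).
      unfold s, t1, t3 in *. lra. }
  replace (e - (e - t3)) with t3 in * by ring. rewrite !Rminus_diag, Rminus_0_r, sin_0 in *.
  assert (s * e <= s * 1) by (apply Rmult_le_compat_l; lra).
  unfold s in *. nra.
Qed.

(** Guarantees that the shortened comparison path still has positive length and so counts as a
    competitor. *)
Lemma along_pos : 0 < along x y e phi.
Proof.
  rewrite along_eq. set (c := 1 / 2).
  assert (c * e - c * 0 <= f e - f 0).
  { apply (diff_le (fun t => c * t) f (fun t => c) (fun t => cos (th t - phi))); [lra| | |].
    - intros; auto_derive; auto. ring.
    - intros; apply along_derive; lra.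
    - intros t Ht. pose proof (cos_lipschitz (th t - phi) 0) as K.
      pose proof (heading_close t Ht). rewrite Rminus_0_r, cos_0 in K.
      apply Rabs_le_between in K. unfold c. lra. }
  unfold c in *. lra.
Qed.

Lemma cos_abs a : cos (Rabs a) = cos a.
Proof. unfold Rabs. destruct Rcase_abs; auto. apply cos_neg. Qed.

(** At each time [|th - phi|] is at least the deviation of the comparison path, by the Lipschitz
    bounds, so its cosine is at most as large. Equal totals force equal cosines by [diff_eq], hence
    equal absolute deviations by injectivity of cosine. *)
Lemma along_le : let t1 := Rabs (phi - A) in let t3 := Rabs (phi - B) in
  along x y e phi <= sin t1 + (e - t1 - t3) + sin t3 /\
  (sin t1 + (e - t1 - t3) + sin t3 <= along x y e phi ->
   (forall t, 0 <= t <= t1 -> Rabs (th t - phi) = t1 - t) /\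
   (forall t, t1 <= t <= e - t3 -> th t = phi) /\
   (forall t, e - t3 <= t <= e -> Rabs (th t - phi) = t - (e - t3))).
Proof.
  intros t1 t3. pose proof (Rabs_pos (phi - A)) as H1. pose proof (Rabs_pos (phi - B)) as H3.
  fold t1 in Hphi, H1. fold t3 in Hphi, H3. rewrite along_eq. pose proof PI_gt_3 as Hpi.
  assert (G1 : forall t, 0 <= t <= t1 -> t1 - t <= Rabs (th t - phi)).
  { intros t Ht. pose proof (heading_bounds t ltac:(lra)).
    assert (t1 <= Rabs (th t - phi) + t); [|lra].
    unfold t1. apply Rabs_le. pose proof (Rle_abs (th t - phi)). pose proof (Rabs_maj2 (th t - phi)). lra. }
  assert (G3 : forall t, e - t3 <= t <= e -> t - (e - t3) <= Rabs (th t - phi)).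
  { intros t Ht. pose proof (heading_bounds t ltac:(lra)).
    assert (t3 <= Rabs (th t - phi) + (e - t)); [|lra].
    unfold t3. apply Rabs_le. pose proof (Rle_abs (th t - phi)). pose proof (Rabs_maj2 (th t - phi)). lra. }
  assert (K1 : forall t, 0 <= t <= t1 -> cos (th t - phi) <= cos (t1 - t)).
  { intros t Ht. rewrite <- cos_abs. pose proof (heading_close t ltac:(lra)). pose proof (G1 t Ht).
    apply cos_decr_1; lra. }
  assert (K3 : forall t, e - t3 <= t <= e -> cos (th t - phi) <= cos (t - (e - t3))).
  { intros t Ht. rewrite <- cos_abs. pose proof (heading_close t ltac:(lra)). pose proof (G3 t Ht).
    apply cos_decr_1; lra. }
  assert (K2 : forall t, t1 <= t <= e - t3 -> cos (th t - phi) <= 1) by (intros; apply COS_bound).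
  assert (D1 : forall t, is_derive (fun t => - sin (t1 - t)) t (cos (t1 - t)))
    by (intros; auto_derive; auto; unfold Rminus; ring).
  assert (D2 : forall t, is_derive (fun t => t) t 1) by (intros; auto_derive; auto).
  assert (D3 : forall t, is_derive (fun t => sin (t - (e - t3))) t (cos (t - (e - t3))))
    by (intros; auto_derive; auto; unfold Rminus; ring).
  assert (E1 : f t1 - f 0 <= - sin (t1 - t1) - - sin (t1 - 0)).
  { apply (diff_le f (fun t => - sin (t1 - t)) (fun t => cos (th t - phi)) (fun t => cos (t1 - t))); auto.
    intros; apply along_derive; lra. }
  assert (E2 : f (e - t3) - f t1 <= e - t3 - t1).
  { apply (diff_le f (fun t => t) (fun t => cos (th t - phi)) (fun t => 1)); auto; [lra|].
    intros; apply along_derive; lra. }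
  assert (E3 : f e - f (e - t3) <= sin (e - (e - t3)) - sin (e - t3 - (e - t3))).
  { apply (diff_le f (fun t => sin (t - (e - t3))) (fun t => cos (th t - phi)) (fun t => cos (t - (e - t3)))); auto; [lra|].
    intros; apply along_derive; lra. }
  assert (Q0 : sin (t1 - t1) = 0) by (rewrite Rminus_diag; apply sin_0).
  assert (Q1 : sin (e - t3 - (e - t3)) = 0) by (rewrite Rminus_diag; apply sin_0).
  assert (Q2 : t1 - 0 = t1) by ring.
  assert (Q3 : e - (e - t3) = t3) by ring.
  rewrite Q0, Q2 in E1. rewrite Q1, Q3 in E3.
  split; [lra|]. intros E.
  assert (R1 : forall t, 0 <= t <= t1 -> Rabs (th t - phi) = t1 - t).
  { intros t Ht. destruct (Rle_lt_dec t1 0).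
    { replace t with 0 by lra. rewrite Rminus_0_r. apply Rabs_minus_sym. }
    assert (Ec : cos (th t - phi) = cos (t1 - t)).
    { apply (diff_eq f (fun t => - sin (t1 - t)) (fun t => cos (th t - phi)) (fun t => cos (t1 - t)) 0 t1); auto.
      - intros; apply along_derive; lra.
      - rewrite Q0, Q2. lra. }
    rewrite <- cos_abs in Ec. pose proof (heading_close t ltac:(lra)).
    pose proof (Rabs_pos (th t - phi)).
    apply cos_inj; auto; lra. }
  split; [|split]; auto.
  - intros t Ht. destruct (Rle_lt_dec (e - t3) t1).
    + pose proof (R1 t1 ltac:(lra)) as Z. replace t with t1 by lra.
      pose proof (Rle_abs (th t1 - phi)). pose proof (Rabs_maj2 (th t1 - phi)). lra.
    + assert (Ec : cos (th t - phi) = 1).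
      { apply (diff_eq f (fun t => t) (fun t => cos (th t - phi)) (fun t => 1) t1 (e - t3)); auto.
        - intros; apply along_derive; lra.
        - lra. }
      rewrite <- cos_0, <- cos_abs in Ec. pose proof (heading_close t ltac:(lra)).
      pose proof (Rabs_pos (th t - phi)).
      assert (Rabs (th t - phi) = 0) as Z by (apply cos_inj; auto; lra).
      pose proof (Rle_abs (th t - phi)). pose proof (Rabs_maj2 (th t - phi)). lra.
  - intros t Ht. destruct (Rle_lt_dec t3 0).
    { replace t with e by lra. rewrite Q3. apply Rabs_minus_sym. }
    assert (Ec : cos (th t - phi) = cos (t - (e - t3))).
    { apply (diff_eq f (fun t => sin (t - (e - t3))) (fun t => cos (th t - phi)) (fun t => cos (t - (e - t3))) (e - t3) e); auto.
      - intros; apply along_derive; lra.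
      - rewrite Q1, Q3. lra.
      - lra. }
    rewrite <- cos_abs in Ec. pose proof (heading_close t ltac:(lra)).
    pose proof (Rabs_pos (th t - phi)).
    apply cos_inj; auto; lra.
Qed.
End Steered.

(* The signed lateral deviation of a turn by [z]: [1 - cos z] with the sign of [z]. *)
Definition dev z := 2 * sin (z / 2) * Rabs (sin (z / 2)).

Lemma dev_pos z : 0 <= z <= 2 -> dev z = 1 - cos z.
Proof.
  intros Hz. pose proof PI_gt_3. unfold dev.
  assert (0 <= sin (z / 2)) by (apply sin_ge_0; lra).
  rewrite Rabs_right by lra.
  replace (cos z) with (cos (2 * (z / 2))) by (f_equal; field). rewrite cos_2a_sin. ring.
Qed.

Lemma dev_opp z : dev (- z) = - dev z.
Proof.
  unfold dev. replace (- z / 2) with (- (z / 2)) by field. rewrite sin_neg, Rabs_Ropp. ring.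
Qed.

Lemma dev_continuous c z : continuity_pt (fun z => dev (z - c)) z.
Proof.
  apply (continuity_pt_mult (fun z => 2 * sin ((z - c) / 2)) (fun z => Rabs (sin ((z - c) / 2)))).
  - apply derivable_continuous_pt, ex_derive_Reals_0. auto_derive. auto.
  - apply (continuity_pt_comp (fun z => sin ((z - c) / 2)) Rabs).
    + apply derivable_continuous_pt, ex_derive_Reals_0. auto_derive. auto.
    + apply Rcontinuity_abs.
Qed.

Definition dir_to a b := if Rle_dec a b then Lf else Rt.

(** The displacement is written in the frame of the final heading [b], with [sin] of the turn along
    it and [dev] to its right, so that turns to a common [phi] can be added componentwise. *)
Lemma wr_turn_to a b : Rabs (b - a) <= 2 ->
  wr a b (Rabs (b - a)) (sin (Rabs (b - a)) * cos b + dev (b - a) * sin b)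
    (sin (Rabs (b - a)) * sin b - dev (b - a) * cos b).
Proof.
  intros H. destruct (Rle_lt_dec a b) as [Hab|Hab].
  - rewrite Rabs_right in * by lra. rewrite dev_pos by lra.
    pose proof (wr_left a (b - a) ltac:(lra)) as K.
    replace (a + (b - a)) with b in K by ring.
    set (z := b - a) in *. replace a with (b - z) in K by (unfold z; ring).
    eapply wr_eq; [exact K|..]; unfold z; try ring; fold z;
      rewrite ?sin_minus, ?cos_minus; ring.
  - rewrite Rabs_left in * by lra.
    pose proof (wr_right a (a - b) ltac:(lra)) as K.
    replace (a - (a - b)) with b in K by ring.
    replace (b - a) with (- (a - b)) by ring. rewrite dev_opp, dev_pos, Ropp_involutive by lra.
    set (z := a - b) in *. replace a with (b + z) in K by (unfold z; ring).
    eapply wr_eq; [exact K|..]; unfold z; try ring; fold z;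
      rewrite ?sin_plus, ?cos_plus; ring.
Qed.

(** The displacement across [phi] of the path that turns from [A] to [phi], runs straight, and turns
    to [B]; the segment contributes nothing. *)
Definition lateral A B phi := - dev (phi - A) - dev (phi - B).

Lemma lateral_opp A B phi : lateral (- A) (- B) (- phi) = - lateral A B phi.
Proof.
  unfold lateral. replace (- phi - - A) with (- (phi - A)) by ring.
  replace (- phi - - B) with (- (phi - B)) by ring. rewrite !dev_opp. ring.
Qed.

Lemma abs_opp_diff a b : Rabs (- a - - b) = Rabs (a - b).
Proof. replace (- a - - b) with (- (a - b)) by ring. apply Rabs_Ropp. Qed.

Lemma along_ge x y th e phi : steered x y th e -> 0 < e <= 1 / 4 ->
  Rabs (phi - th 0) + Rabs (phi - th e) <= e ->
  across x y e phi = lateral (th 0) (th e) phi ->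
  sin (Rabs (phi - th 0)) + sin (Rabs (phi - th e)) <= along x y e phi.
Proof.
  assert (W : forall x y th phi, steered x y th e -> 0 < e <= 1 / 4 ->
    Rabs (phi - th 0) + Rabs (phi - th e) <= e ->
    across x y e phi = lateral (th 0) (th e) phi -> th 0 <= phi ->
    sin (Rabs (phi - th 0)) + sin (Rabs (phi - th e)) <= along x y e phi).
  { clear. intros x y th phi HS He Hphi E HA.
    pose proof (Rabs_pos (phi - th e)). pose proof (Rabs_pos (phi - th 0)).
    destruct (Rle_lt_dec (th e) phi) as [HB|HB].
    - pose proof Hphi as Hphi'. rewrite !Rabs_right in Hphi' by lra.
      rewrite !Rabs_right by lra.
      apply (along_ge_same_side x y th); auto; try lra.
      rewrite E. unfold lateral. rewrite !dev_pos by lra. ring.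
    - rewrite (Rabs_right (phi - th 0)), (Rabs_left (phi - th e)) by lra.
      replace (- (phi - th e)) with (th e - phi) by ring.
      apply (along_ge_opposite x y th); auto; lra. }
  intros HS He Hphi E. destruct (Rle_lt_dec (th 0) phi) as [HA|HA]; [now apply W|].
  rewrite <- along_mirror, <- (abs_opp_diff phi), <- (abs_opp_diff phi (th e)).
  apply (W x (fun t => - y t) (fun t => - th t)); auto; try lra.
  - now apply steered_mirror.
  - now rewrite !abs_opp_diff.
  - now rewrite across_mirror, lateral_opp, E.
Qed.

Lemma across_top_lateral x y th e : steered x y th e -> 0 < e <= 1 / 4 ->
  let phi := (th 0 + th e + e) / 2 in across x y e phi <= lateral (th 0) (th e) phi.
Proof.
  intros HS He phi.
  pose proof HS as (_ & _ & HL). pose proof (HL 0 e ltac:(lra) ltac:(lra)) as K.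
  apply Rabs_le_between in K.
  assert (HA : 0 <= phi - th 0) by (unfold phi; lra).
  assert (HB : 0 <= phi - th e) by (unfold phi; lra).
  assert (E : phi - th 0 + (phi - th e) = e) by (unfold phi; lra).
  unfold lateral. rewrite !dev_pos by lra.
  assert (H : across x y e phi <= - (1 - cos (phi - th 0)) - (1 - cos (phi - th e)));
    [|lra].
  apply (across_top x y th); auto. rewrite !Rabs_right; lra.
Qed.

(** The interval from [lo] to [hi] consists of the [phi] for which both turns fit into the length
    [e]. At [hi] the sign for the intermediate value theorem comes from [across_top_lateral], at
    [lo] from its reflection. *)
Lemma matching_heading x y th e : steered x y th e -> 0 < e <= 1 / 4 ->
  exists phi, Rabs (phi - th 0) + Rabs (phi - th e) <= e /\
    across x y e phi = lateral (th 0) (th e) phi.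
Proof.
  intros HS He.
  pose proof HS as (_ & _ & HL). pose proof (HL 0 e ltac:(lra) ltac:(lra)) as K.
  apply Rabs_le_between in K.
  set (lo := (th 0 + th e - e) / 2). set (hi := (th 0 + th e + e) / 2).
  set (g := fun phi => lateral (th 0) (th e) phi - across x y e phi).
  assert (Hhi : 0 <= g hi).
  { unfold g, hi. pose proof (across_top_lateral x y th e HS He). cbv zeta in *. lra. }
  assert (Hlo : g lo <= 0).
  { pose proof (across_top_lateral x _ _ e (steered_mirror _ _ _ _ HS) He) as H. cbv beta zeta in H.
    replace ((- th 0 + - th e + e) / 2) with (- lo) in H by (unfold lo; field).
    rewrite (across_mirror x y), lateral_opp in H. unfold g. lra. }
  destruct (IVT_gen g lo hi 0) as (phi & Hp & E).
  - intro p. unfold g, lateral, across.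
    apply (continuity_pt_minus (fun p => - dev (p - th 0) - dev (p - th e))
      (fun p => (y e - y 0) * cos p - (x e - x 0) * sin p)).
    + apply (continuity_pt_minus (fun p => - dev (p - th 0)) (fun p => dev (p - th e)));
        [apply (continuity_pt_opp (fun p => dev (p - th 0)))|]; apply dev_continuous.
    + apply derivable_continuous_pt, ex_derive_Reals_0. auto_derive. auto.
  - rewrite Rmin_left, Rmax_right by lra. lra.
  - rewrite Rmin_left, Rmax_right in Hp by (unfold lo, hi; lra).
    exists phi. split; [|unfold g in E; lra].
    unfold lo, hi in Hp. unfold Rabs. repeat destruct Rcase_abs; lra.
Qed.

Lemma window x y th e : steered x y th e -> 0 < e <= 1 / 4 ->
  (forall L, 0 < L -> wr (th 0) (th e) L (x e - x 0) (y e - y 0) -> e <= L) ->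
  exists d1 d3 t1 s t3 phi, 0 <= t1 /\ 0 <= s /\ 0 <= t3 /\ t1 + s + t3 = e /\
    (forall t, 0 <= t <= t1 -> th t = th 0 + sg d1 * t) /\
    (forall t, t1 <= t <= t1 + s -> th t = phi) /\
    (forall t, t1 + s <= t <= e -> th t = phi + sg d3 * (t - (t1 + s))).
Proof.
  intros HS He Hopt.
  destruct (matching_heading x y th e HS He) as (phi & Hphi & Elat).
  pose proof (along_ge x y th e phi HS He Hphi Elat) as Hge.
  destruct (along_le x y th e phi HS He Hphi) as [Hle Heq].
  pose proof (along_pos x y th e phi HS He Hphi) as Hpos.
  set (A := th 0) in *. set (B := th e) in *.
  pose proof (Rabs_pos (phi - A)) as H1. pose proof (Rabs_pos (phi - B)) as H3.
  set (t1 := Rabs (phi - A)) in *. set (t3 := Rabs (phi - B)) in *.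
  set (s := e - t1 - t3).
  set (d := sin t1 + s + sin t3 - along x y e phi).
  assert (Hd : 0 <= d <= s) by (unfold d, s; lra).
  assert (Hd0 : d <= 0).
  { apply Rnot_lt_le. intros Hd0.
    assert (K1 := wr_turn_to A phi ltac:(fold t1; lra)). fold t1 in K1.
    assert (K2 := wr_line phi (s - d) ltac:(lra)).
    (* The turn from [phi] to [B] is taken as the reverse of the one from [B] to [phi], which keeps
       the displacement in the frame of [phi]. *)
    assert (K3 := wr_turn_to B phi ltac:(fold t3; lra)). fold t3 in K3. apply wr_reverse in K3.
    assert (K := wr_trans _ _ _ _ _ _ _ _ _ (wr_trans _ _ _ _ _ _ _ _ _ K1 K2) K3).
    assert (e <= t1 + (s - d) + t3); [|unfold s in *; lra].
    assert (S1 : sin t1 <= t1) by (destruct H1 as [H1|<-]; [left; now apply sin_lt_x|rewrite sin_0; lra]).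
    assert (S3 : sin t3 <= t3) by (destruct H3 as [H3|<-]; [left; now apply sin_lt_x|rewrite sin_0; lra]).
    apply Hopt; [unfold d in *; lra|].
    assert (Ed : s - d = along x y e phi - sin t1 - sin t3) by (unfold d; ring).
    eapply wr_eq; [exact K|..]; auto; rewrite Ed; unfold lateral in Elat.
    - transitivity (along x y e phi * cos phi - (- dev (phi - A) - dev (phi - B)) * sin phi); [ring|].
      rewrite <- Elat. unfold along, across. pose proof (sin2_cos2 phi) as S2. unfold Rsqr in S2.
      transitivity ((x e - x 0) * (sin phi * sin phi + cos phi * cos phi)); [ring|rewrite S2; ring].
    - transitivity (along x y e phi * sin phi + (- dev (phi - A) - dev (phi - B)) * cos phi); [ring|].
      rewrite <- Elat. unfold along, across. pose proof (sin2_cos2 phi) as S2. unfold Rsqr in S2.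
      transitivity ((y e - y 0) * (sin phi * sin phi + cos phi * cos phi)); [ring|rewrite S2; ring]. }
  destruct (Heq ltac:(unfold d, s in *; lra)) as (R1 & R2 & R3).
  pose proof (heading_bounds x y th e HS) as HB0.
  assert (Es : t1 + s = e - t3) by (unfold s; ring).
  exists (dir_to A phi), (dir_to phi B), t1, s, t3, phi.
  split; [lra|]. split; [unfold s; lra|]. split; [lra|]. split; [unfold s; lra|].
  rewrite Es. split; [|split]; auto.
  (* [R1] and [R3] know the deviation only up to sign; the Lipschitz bounds select the sign. *)
  - intros t Ht. pose proof (R1 t Ht) as R. pose proof (HB0 t ltac:(lra)) as HB1. fold A in HB1.
    unfold dir_to. destruct Rle_dec; simpl.
    + unfold t1 in R. rewrite (Rabs_right (phi - A)) in R by lra.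
      pose proof (Rabs_maj2 (th t - phi)). pose proof (Rle_abs (th t - phi)).
      unfold t1 in Ht. rewrite (Rabs_right (phi - A)) in Ht by lra.
      rewrite Rabs_left1 in R by lra. lra.
    + unfold t1 in R. rewrite (Rabs_left1 (phi - A)) in R by lra.
      unfold t1 in Ht. rewrite (Rabs_left1 (phi - A)) in Ht by lra.
      rewrite Rabs_right in R by lra. lra.
  - intros t Ht. pose proof (R3 t Ht) as R. pose proof (HB0 t ltac:(lra)) as [_ HB1]. fold B in HB1.
    unfold dir_to. destruct Rle_dec; simpl.
    + unfold t3 in *. rewrite (Rabs_left1 (phi - B)) in * by lra.
      rewrite Rabs_right in R by lra. lra.
    + unfold t3 in *. rewrite (Rabs_right (phi - B)) in * by lra.
      rewrite Rabs_left1 in R by lra. lra.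
Qed.

(** * From words to paths and back *)

Definition glue (c : R) (f g : R -> R) : R -> R := fun t => if Rle_dec t c then f t else g t.

Lemma glue_left c f g t : t <= c -> glue c f g t = f t.
Proof. intros H. unfold glue. destruct (Rle_dec t c); [auto|lra]. Qed.

Lemma glue_right c f g t : f c = g c -> c <= t -> glue c f g t = g t.
Proof.
  intros E H. unfold glue. destruct (Rle_dec t c); auto. now replace t with c by lra.
Qed.

Lemma locally_left c t : t < c -> locally t (fun s => s <= c).
Proof. intros H. apply (filter_imp (fun s => s < c)); [intros; lra|exact (open_lt c t H)]. Qed.

Lemma locally_right c t : c < t -> locally t (fun s => c <= s).
Proof. intros H. apply (filter_imp (fun s => c < s)); [intros; lra|exact (open_gt c t H)]. Qed.

Lemma continuous_glue c (f g : R -> R) t : f c = g c -> continuous f t -> continuous g t ->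
  continuous (glue c f g) t.
Proof.
  intros E Hf Hg. destruct (Rtotal_order t c) as [H|[->|H]].
  - apply (continuous_ext_loc _ f); auto.
    generalize (locally_left c t H). apply filter_imp. intros s Hs. now rewrite glue_left.
  - intros P HP. rewrite glue_left in HP by lra.
    assert (H1 : locally c (fun s => P (f s))) by exact (Hf P HP).
    rewrite E in HP. assert (H2 : locally c (fun s => P (g s))) by exact (Hg P HP).
    refine (filter_imp (fun s => P (f s) /\ P (g s)) _ _ (filter_and _ _ H1 H2)).
    intros s [K1 K2]. unfold glue. destruct (Rle_dec s c); auto.
  - apply (continuous_ext_loc _ g); auto.
    generalize (locally_right c t H). apply filter_imp. intros s Hs. now rewrite glue_right.
Qed.

Lemma is_derive_glue c (f g : R -> R) f' g' t : f c = g c -> f' c = g' c ->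
  is_derive f t (f' t) -> is_derive g t (g' t) -> is_derive (glue c f g) t (glue c f' g' t).
Proof.
  intros E E' Hf Hg. destruct (Rtotal_order t c) as [H|[->|H]].
  - rewrite glue_left by lra. apply (is_derive_ext_loc f); auto.
    generalize (locally_left c t H). apply filter_imp. intros s Hs. now rewrite glue_left.
  - rewrite glue_left by lra. rewrite <- E' in Hg. apply is_derive_Reals in Hf, Hg. apply is_derive_Reals.
    intros e He. destruct (Hf e He) as [d1 H1]. destruct (Hg e He) as [d2 H2].
    exists (mkposreal _ (Rmin_stable_in_posreal d1 d2)). simpl. intros h Hh Hd.
    pose proof (Rmin_l d1 d2). pose proof (Rmin_r d1 d2).
    rewrite (glue_left c f g c) by lra.
    destruct (Rle_lt_dec h 0).
    + rewrite glue_left by lra. apply H1; auto; lra.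
    + rewrite glue_right, E by (auto; lra). apply H2; auto; lra.
  - rewrite glue_right by (auto; lra). apply (is_derive_ext_loc g); auto.
    generalize (locally_right c t H). apply filter_imp. intros s Hs. now rewrite glue_right.
Qed.

Lemma C1_derive f t : Defs.C1 f -> is_derive f t (Derive f t).
Proof. intros H. apply Derive_correct, H. Qed.

Lemma C1_intro (f f' : R -> R) : (forall t, is_derive f t (f' t)) -> (forall t, continuous f' t) -> Defs.C1 f.
Proof.
  intros H1 H2 t. split; [now exists (f' t)|].
  apply (continuous_ext f'); auto. intros s. symmetry. now apply is_derive_unique.
Qed.

Lemma C2_intro (f f' f'' : R -> R) : (forall t, is_derive f t (f' t)) ->
  (forall t, is_derive f' t (f'' t)) -> (forall t, continuous f'' t) ->
  Defs.C2 f /\ (forall t, Derive f t = f' t) /\ (forall t, Derive_n f 2 t = f'' t).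
Proof.
  intros H1 H2 H3.
  assert (E1 : forall t, Derive f t = f' t) by (intros; now apply is_derive_unique).
  assert (E2 : forall t, Derive_n f 2 t = f'' t).
  { intros t. transitivity (Derive f' t); [|now apply is_derive_unique].
    apply (Derive_ext (Derive_n f 1) f'). intros s. apply E1. }
  split; [|split]; auto. intros t. split; [|split].
  - now exists (f' t).
  - exists (f'' t). apply (is_derive_ext f'); auto.
  - apply (continuous_ext f''); auto.
Qed.

Lemma C2_C1 f : Defs.C2 f -> Defs.C1 f.
Proof.
  intros H t. destruct (H t) as (H1 & H2 & _). split; auto.
  now apply (ex_derive_continuous (V := R_NormedModule)).
Qed.

Lemma C2_derive2 f t : Defs.C2 f -> is_derive (Derive f) t (Derive_n f 2 t).
Proof. intros H. apply Derive_correct, H. Qed.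

Lemma is_derive_shift (f : R -> R) c t l : is_derive f (t - c) l -> is_derive (fun s => f (s - c)) t l.
Proof.
  intros H. replace l with (scal 1 l) by exact (scal_one (l : R_NormedModule)).
  apply (is_derive_comp f (fun s => s - c)); auto. auto_derive; auto.
Qed.

Lemma continuous_shift (f : R -> R) c t : continuous f (t - c) -> continuous (fun s => f (s - c)) t.
Proof.
  intros H. apply (continuous_comp (fun s => s - c) f); auto.
  apply (ex_derive_continuous (V := R_NormedModule)). auto_derive. auto.
Qed.

Lemma C2_shift f c : Defs.C2 f -> Defs.C2 (fun t => f (t - c)) /\
  (forall t, Derive (fun t => f (t - c)) t = Derive f (t - c)) /\
  (forall t, Derive_n (fun t => f (t - c)) 2 t = Derive_n f 2 (t - c)).
Proof.
  intros H. apply C2_intro.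
  - intros t. apply is_derive_shift, C1_derive, C2_C1, H.
  - intros t. apply is_derive_shift. now apply C2_derive2.
  - intros t. apply (continuous_shift (Derive_n f 2)), H.
Qed.

Lemma C1_shift f c : Defs.C1 f -> Defs.C1 (fun t => f (t - c)) /\
  (forall t, Derive (fun t => f (t - c)) t = Derive f (t - c)).
Proof.
  intros H. split.
  - apply (C1_intro _ (fun t => Derive f (t - c))).
    + intros t. now apply is_derive_shift, C1_derive.
    + intros t. apply (continuous_shift (Derive f)), H.
  - intros t. now apply is_derive_unique, is_derive_shift, C1_derive.
Qed.

Lemma C1_glue c f g : Defs.C1 f -> Defs.C1 g -> f c = g c -> Derive f c = Derive g c ->
  Defs.C1 (glue c f g) /\ forall t, Derive (glue c f g) t = glue c (Derive f) (Derive g) t.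
Proof.
  intros Hf Hg E E'.
  assert (H : forall t, is_derive (glue c f g) t (glue c (Derive f) (Derive g) t))
    by (intros; apply is_derive_glue; auto; now apply C1_derive).
  split.
  - apply (C1_intro _ _ H). intros t. apply continuous_glue; auto; [apply Hf|apply Hg].
  - intros t. now apply is_derive_unique.
Qed.

(** * Concatenation of paths and realization of words *)

Definition joins rho x y u x' y' v L (h : path) :=
  len h = L /\ 0 < L /\ Defs.C1 (px h) /\ Defs.C1 (py h) /\ unit_speed h /\
  piecewise_C2_radius_ge rho h /\ px h 0 = x /\ py h 0 = y /\
  px h L = x' /\ py h L = y' /\ heading h 0 u /\ heading h L v.

Lemma subdivision_mono (s : nat -> R) n : (forall i, (i < n)%nat -> s i < s (S i)) ->
  forall i j, (i <= j <= n)%nat -> s i <= s j.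
Proof.
  intros H i j [Hij Hj]. induction Hij as [|j Hij IH]; [lra|].
  apply Rle_trans with (s j); [apply IH; lia|]. left. apply H. lia.
Qed.

Lemma joins_trans rho x y u x1 y1 u1 x2 y2 u2 L1 L2 h1 h2 :
  joins rho x y u x1 y1 u1 L1 h1 -> joins rho x1 y1 u1 x2 y2 u2 L2 h2 ->
  exists h, joins rho x y u x2 y2 u2 (L1 + L2) h.
Proof.
  intros (El1 & HL1 & CX1 & CY1 & U1 & P1 & X1 & Y1 & X1' & Y1' & [HX1 HY1] & [HX1' HY1'])
    (El2 & HL2 & CX2 & CY2 & U2 & P2 & X2 & Y2 & X2' & Y2' & [HX2 HY2] & [HX2' HY2']).
  destruct (C1_shift _ L1 CX2) as [CX3 DX3]. destruct (C1_shift _ L1 CY2) as [CY3 DY3].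
  assert (EX : px h1 L1 = px h2 (L1 - L1)) by (rewrite Rminus_diag; congruence).
  assert (EY : py h1 L1 = py h2 (L1 - L1)) by (rewrite Rminus_diag; congruence).
  assert (EX' : Derive (px h1) L1 = Derive (fun t => px h2 (t - L1)) L1)
    by (rewrite DX3, Rminus_diag; congruence).
  assert (EY' : Derive (py h1) L1 = Derive (fun t => py h2 (t - L1)) L1)
    by (rewrite DY3, Rminus_diag; congruence).
  destruct (C1_glue L1 (px h1) (fun t => px h2 (t - L1))) as [CX DX]; auto.
  destruct (C1_glue L1 (py h1) (fun t => py h2 (t - L1))) as [CY DY]; auto.
  set (X := glue L1 (px h1) (fun t => px h2 (t - L1))) in *.
  set (Y := glue L1 (py h1) (fun t => py h2 (t - L1))) in *.
  assert (XL : forall t, t <= L1 -> X t = px h1 t) by (intros; now apply glue_left).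
  assert (YL : forall t, t <= L1 -> Y t = py h1 t) by (intros; now apply glue_left).
  assert (XR : forall t, L1 <= t -> X t = px h2 (t - L1)) by (intros; unfold X; now rewrite glue_right).
  assert (YR : forall t, L1 <= t -> Y t = py h2 (t - L1)) by (intros; unfold Y; now rewrite glue_right).
  assert (DXL : forall t, t <= L1 -> Derive X t = Derive (px h1) t)
    by (intros; rewrite DX; now apply glue_left).
  assert (DYL : forall t, t <= L1 -> Derive Y t = Derive (py h1) t)
    by (intros; rewrite DY; now apply glue_left).
  assert (DXR : forall t, L1 <= t -> Derive X t = Derive (px h2) (t - L1))
    by (intros; rewrite DX, glue_right; auto).
  assert (DYR : forall t, L1 <= t -> Derive Y t = Derive (py h2) (t - L1))
    by (intros; rewrite DY, glue_right; auto).
  exists (mkPath (L1 + L2) X Y).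
  split; [|split; [|split; [|split; [|split; [|split]]]]]; auto; simpl.
  - lra.
  - intros t Ht. simpl in *. destruct (Rle_lt_dec t L1).
    + rewrite DXL, DYL by auto. apply U1. lra.
    + rewrite DXR, DYR by lra. apply U2. lra.
  - destruct P1 as (n1 & s1 & S1 & S1' & Q1). destruct P2 as (n2 & s2 & S2 & S2' & Q2).
    (* The two subdivisions share the cut of index [n1]: there [s1 n1 = L1], and [s2] starts at
       0. *)
    pose (s := fun i => if Nat.leb i n1 then s1 i else L1 + s2 (i - n1)%nat).
    assert (sL : forall i, (i <= n1)%nat -> s i = s1 i).
    { intros i Hi. unfold s. now rewrite (proj2 (Nat.leb_le i n1) Hi). }
    assert (sR : forall i, (n1 <= i)%nat -> s i = L1 + s2 (i - n1)%nat).
    { intros i Hi. unfold s. destruct (Nat.leb_spec i n1); auto.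
      replace i with n1 by lia. rewrite Nat.sub_diag, S2, S1', El1. ring. }
    exists (n1 + n2)%nat, s. split; [|split].
    + rewrite sL by lia. auto.
    + rewrite sR by lia. replace (n1 + n2 - n1)%nat with n2 by lia. simpl. rewrite S2', El2. auto.
    + intros i Hi. destruct (Nat.lt_ge_cases i n1) as [Hlt|Hge].
      * rewrite !sL by lia. destruct (Q1 i Hlt) as (Hs & A & B & CA & CB & K).
        split; auto. exists A, B. split; [|split]; auto. intros t Ht.
        assert (s1 (S i) <= L1).
        { rewrite <- El1, <- S1'. apply (subdivision_mono s1 n1); [|lia]. intros; now apply Q1. }
        simpl. rewrite XL, YL by lra. now apply K.
      * rewrite !sR by lia. replace (S i - n1)%nat with (S (i - n1)) by lia.
        destruct (Q2 (i - n1)%nat ltac:(lia)) as (Hs & A & B & CA & CB & K).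
        split; [lra|]. destruct (C2_shift A L1 CA) as (CA' & DA & DA2).
        destruct (C2_shift B L1 CB) as (CB' & DB & DB2).
        exists (fun t => A (t - L1)), (fun t => B (t - L1)). split; [|split]; auto.
        intros t Ht.
        assert (0 <= s2 (i - n1)%nat).
        { rewrite <- S2. apply (subdivision_mono s2 n2); [|lia]. intros; now apply Q2. }
        simpl. rewrite XR, YR by lra. unfold curvature. rewrite DA, DB, DA2, DB2.
        apply K. lra.
  - rewrite XL, YL by lra. split; auto. split; auto.
    rewrite XR, YR by lra. replace (L1 + L2 - L1) with L2 by ring.
    split; auto. split; auto. unfold heading; simpl.
    rewrite (DXL 0), (DYL 0), (DXR (L1 + L2)), (DYR (L1 + L2)) by lra.
    replace (L1 + L2 - L1) with L2 by ring. auto.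
Qed.

(** A path must have positive length, so the trivial connection is a separate alternative. It
    realizes [wr_refl] and absorbs changes of the heading by multiples of 2 pi. *)
Definition conn rho x y u x' y' v L :=
  (L = 0 /\ x = x' /\ y = y' /\ cos u = cos v /\ sin u = sin v) \/
  exists h, joins rho x y u x' y' v L h.

Lemma joins_heading rho x y u x' y' v L h u0 v0 : joins rho x y u x' y' v L h ->
  cos u0 = cos u -> sin u0 = sin u -> cos v = cos v0 -> sin v = sin v0 ->
  joins rho x y u0 x' y' v0 L h.
Proof.
  unfold joins, heading. intros H E1 E2 E3 E4. rewrite E1, E2, <- E3, <- E4. exact H.
Qed.

Lemma conn_trans rho x y u x1 y1 u1 x2 y2 u2 L1 L2 :
  conn rho x y u x1 y1 u1 L1 -> conn rho x1 y1 u1 x2 y2 u2 L2 ->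
  conn rho x y u x2 y2 u2 (L1 + L2).
Proof.
  intros [(-> & -> & -> & E1 & E2)|[h1 H1]] [(-> & -> & -> & E3 & E4)|[h2 H2]].
  - left. repeat split; try lra; congruence.
  - right. rewrite Rplus_0_l. exists h2. eapply joins_heading; eauto.
  - right. rewrite Rplus_0_r. exists h1. eapply joins_heading; eauto.
  - right. eapply joins_trans; eauto.
Qed.

Lemma conn_piece rho X Y u v L : 0 < L -> Defs.C2 X -> Defs.C2 Y ->
  (forall t, 0 <= t <= L -> (Derive X t) ^ 2 + (Derive Y t) ^ 2 = 1 /\
     (curvature X Y t = 0 \/ rho <= / Rabs (curvature X Y t))) ->
  Derive X 0 = cos u -> Derive Y 0 = sin u -> Derive X L = cos v -> Derive Y L = sin v ->
  conn rho (X 0) (Y 0) u (X L) (Y L) v L.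
Proof.
  intros HL CX CY H Xu Yu Xv Yv. right. exists (mkPath L X Y).
  split; [|split; [|split; [|split; [|split; [|split]]]]]; auto; simpl; auto using C2_C1.
  - intros t Ht. now apply H.
  - exists 1%nat, (fun i => match i with O => 0 | _ => L end). split; [|split]; auto.
    intros i Hi. replace i with 0%nat by lia. split; auto. exists X, Y. split; [|split]; auto.
    intros t Ht. simpl. split; auto. split; auto. now apply H.
  - unfold heading. simpl. repeat split; auto.
Qed.

Lemma conn_arc rho x y u k t : 0 < rho -> k = 1 \/ k = -1 -> 0 < t ->
  conn rho x y u (x + rho * (k * (sin (u + k * t) - sin u)))
    (y + rho * (k * (cos u - cos (u + k * t)))) (u + k * t) (rho * t).
Proof.
  intros Hr Hk Ht.
  assert (Hk2 : k * k = 1) by (destruct Hk; subst; ring).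
  pose (X := fun s => x + rho * (k * (sin (u + k * (s / rho)) - sin u))).
  pose (Y := fun s => y + rho * (k * (cos u - cos (u + k * (s / rho))))).
  destruct (C2_intro X (fun s => cos (u + k * (s / rho))) (fun s => - (k / rho) * sin (u + k * (s / rho))))
    as (CX & DX & DX2).
  { intros s. unfold X. auto_derive; auto. unfold Rdiv.
    transitivity (rho * / rho * (k * k) * cos (u + k * (s * / rho))); [ring|].
    rewrite Hk2. field. lra. }
  { intros s. auto_derive; auto. unfold Rdiv. ring. }
  { intros s. apply (ex_derive_continuous (V := R_NormedModule)). auto_derive. auto. }
  destruct (C2_intro Y (fun s => sin (u + k * (s / rho))) (fun s => (k / rho) * cos (u + k * (s / rho))))
    as (CY & DY & DY2).
  { intros s. unfold Y. auto_derive; auto. unfold Rdiv.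
    transitivity (rho * / rho * (k * k) * sin (u + k * (s * / rho))); [ring|].
    rewrite Hk2. field. lra. }
  { intros s. auto_derive; auto. unfold Rdiv. ring. }
  { intros s. apply (ex_derive_continuous (V := R_NormedModule)). auto_derive. auto. }
  assert (Ht0 : u + k * (0 / rho) = u) by (field; lra).
  assert (Htt : u + k * (rho * t / rho) = u + k * t) by (field; lra).
  assert (HL : 0 < rho * t) by (apply Rmult_lt_0_compat; auto).
  pose proof (conn_piece rho X Y u (u + k * t) (rho * t) HL CX CY) as H.
  replace (X 0) with x in H by (unfold X; rewrite Ht0; ring).
  replace (Y 0) with y in H by (unfold Y; rewrite Ht0; ring).
  replace (X (rho * t)) with (x + rho * (k * (sin (u + k * t) - sin u))) in H
    by (unfold X; now rewrite Htt).
  replace (Y (rho * t)) with (y + rho * (k * (cos u - cos (u + k * t)))) in H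
    by (unfold Y; now rewrite Htt).
  apply H.
  - intros s _. unfold curvature. rewrite DX, DY, DX2, DY2.
    pose proof (sin2_cos2 (u + k * (s / rho))) as S2. unfold Rsqr in S2.
    split; [rewrite <- S2; ring|]. right.
    match goal with |- rho <= / Rabs ?e => replace e with (k / rho) end.
    + unfold Rdiv. rewrite Rabs_mult, Rabs_inv, (Rabs_right rho) by lra.
      replace (Rabs k) with 1 by (destruct Hk; subst; rewrite ?Rabs_Ropp, ?Rabs_R1; auto;
        unfold Rabs; destruct Rcase_abs; lra).
      rewrite Rmult_1_l, Rinv_inv. lra.
    + transitivity (k / rho * (sin (u + k * (s / rho)) * sin (u + k * (s / rho)) +
        cos (u + k * (s / rho)) * cos (u + k * (s / rho)))); [rewrite S2; ring|ring].
  - now rewrite DX, Ht0.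
  - now rewrite DY, Ht0.
  - now rewrite DX, Htt.
  - now rewrite DY, Htt.
Qed.

Lemma conn_line rho x y u t : 0 < t -> conn rho x y u (x + t * cos u) (y + t * sin u) u t.
Proof.
  intros Ht.
  pose (X := fun s => x + s * cos u). pose (Y := fun s => y + s * sin u).
  destruct (C2_intro X (fun s => cos u) (fun s => 0)) as (CX & DX & DX2).
  { intros s. unfold X. auto_derive; auto. ring. }
  { intros s. auto_derive; auto. }
  { intros s. apply continuous_const. }
  destruct (C2_intro Y (fun s => sin u) (fun s => 0)) as (CY & DY & DY2).
  { intros s. unfold Y. auto_derive; auto. ring. }
  { intros s. auto_derive; auto. }
  { intros s. apply continuous_const. }
  pose proof (conn_piece rho X Y u u t Ht CX CY) as H.
  replace (X 0) with x in H by (unfold X; ring).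
  replace (Y 0) with y in H by (unfold Y; ring).
  apply H; auto.
  intros s _. unfold curvature. rewrite DX, DY, DX2, DY2.
  pose proof (sin2_cos2 u) as S2. unfold Rsqr in S2.
  split; [rewrite <- S2; ring|left; ring].
Qed.

Lemma wr_conn rho u v L X Y : 0 < rho -> wr u v L X Y ->
  forall x y, conn rho x y u (x + rho * X) (y + rho * Y) v (rho * L).
Proof.
  intros Hr. induction 1 as [u v Hc Hs|u t Ht|u t Ht|u t Ht|u v w L1 X1 Y1 L2 X2 Y2 _ IH1 _ IH2];
    intros x y.
  - left. rewrite !Rmult_0_r, !Rplus_0_r. auto.
  - destruct Ht as [Ht|<-].
    + pose proof (conn_arc rho x y u 1 t Hr (or_introl eq_refl) Ht) as H.
      now rewrite !Rmult_1_l in H.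
    + left. rewrite Rplus_0_r, Rmult_0_r, !Rminus_diag, !Rmult_0_r, !Rplus_0_r. auto.
  - destruct Ht as [Ht|<-].
    + pose proof (conn_arc rho x y u (-1) t Hr (or_intror eq_refl) Ht) as H.
      replace (u + -1 * t) with (u - t) in H by ring.
      replace (-1 * (sin (u - t) - sin u)) with (sin u - sin (u - t)) in H by ring.
      replace (-1 * (cos u - cos (u - t))) with (cos (u - t) - cos u) in H by ring. exact H.
    + left. rewrite Rminus_0_r, Rmult_0_r, !Rminus_diag, !Rmult_0_r, !Rplus_0_r. auto.
  - destruct Ht as [Ht|<-].
    + pose proof (conn_line rho x y u (rho * t) (Rmult_lt_0_compat _ _ Hr Ht)) as H.
      now rewrite !Rmult_assoc in H.
    + left. rewrite !Rmult_0_l, Rmult_0_r, !Rplus_0_r. auto.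
  - rewrite !Rmult_plus_distr_l, <- !(Rplus_assoc x), <- !(Rplus_assoc y).
    eapply conn_trans; [apply IH1|apply IH2].
Qed.

(** * Lifting the direction of travel to a heading function *)

Lemma unit_heading p q : p ^ 2 + q ^ 2 = 1 -> exists u, p = cos u /\ q = sin u.
Proof.
  intros H. assert (Hp : -1 <= p <= 1) by nra.
  pose proof (sin_acos p Hp) as Hs. unfold Rsqr in Hs.
  replace (1 - p * p) with (q²) in Hs by (unfold Rsqr; lra). rewrite sqrt_Rsqr_abs in Hs.
  destruct (Rle_lt_dec 0 q).
  - exists (acos p). rewrite cos_acos, Hs, Rabs_right by lra. auto.
  - exists (- acos p). rewrite cos_neg, sin_neg, cos_acos, Hs, Rabs_left by lra. lra.
Qed.

Lemma curvature_le rho k : 0 < rho -> k = 0 \/ rho <= / Rabs k -> Rabs k <= / rho.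
Proof.
  intros Hr [->|H].
  - rewrite Rabs_R0. left. now apply Rinv_0_lt_compat.
  - destruct (Req_dec k 0) as [->|Hk].
    + rewrite Rabs_R0. left. now apply Rinv_0_lt_compat.
    + rewrite <- (Rinv_inv (Rabs k)). apply Rinv_le_contravar; auto.
Qed.

Lemma derive_agree f g a b : Defs.C1 f -> Defs.C1 g -> a < b ->
  (forall t, a <= t <= b -> f t = g t) -> forall t, a <= t <= b -> Derive f t = Derive g t.
Proof.
  intros Hf Hg Hab H t Ht.
  cut (Derive f t - Derive g t = 0); [lra|].
  apply (derive_zero (fun s => f s - g s) a b t); auto.
  - apply (is_derive_minus (V := R_NormedModule)); now apply C1_derive.
  - intros s Hs. rewrite (H s Hs), (H a ltac:(lra)). ring.
Qed.

(** The lift is [u] plus the integral of the curvature. The scalar product [D] of the velocity with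
    [(cos th, sin th)] has zero derivative on the interval, because unit speed makes the
    acceleration normal. It starts at 1, and unit vectors with scalar product 1 coincide. *)
Lemma heading_lift rho X Y a b u : 0 < rho -> a < b -> Defs.C2 X -> Defs.C2 Y ->
  (forall t, a <= t <= b -> Derive X t ^ 2 + Derive Y t ^ 2 = 1) ->
  (forall t, a <= t <= b -> Rabs (curvature X Y t) <= / rho) ->
  Derive X a = cos u -> Derive Y a = sin u ->
  exists th, th a = u /\
    (forall t, a <= t <= b -> Derive X t = cos (th t) /\ Derive Y t = sin (th t)) /\
    (forall s t, a <= s <= t -> t <= b -> Rabs (th t - th s) <= / rho * (t - s)).
Proof.
  intros Hr Hab CX CY HU HK HX HY.
  set (k := curvature X Y).
  assert (Ck : forall t, continuous k t).
  { intros t. unfold k, curvature.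
    apply (continuous_minus (V := R_NormedModule) (fun t => Derive X t * Derive_n Y 2 t)).
    - apply (continuous_mult (K := R_AbsRing) (Derive X) (Derive_n Y 2)); [apply (C2_C1 _ CX)|apply CY].
    - apply (continuous_mult (K := R_AbsRing) (Derive Y) (Derive_n X 2)); [apply (C2_C1 _ CY)|apply CX]. }
  set (th := fun t => u + RInt k a t).
  assert (Dth : forall t, is_derive th t (k t)).
  { intros t. unfold th. rewrite <- (Rplus_0_l (k t)).
    apply (is_derive_plus (V := R_NormedModule) (fun _ => u)); [apply (is_derive_const (V := R_NormedModule))|].
    apply (is_derive_RInt (V := R_NormedModule) k (RInt k a) a t); auto.
    apply filter_forall. intros s. apply (RInt_correct (V := R_CompleteNormedModule)).
    apply (ex_RInt_continuous (V := R_CompleteNormedModule)). intros; apply Ck. }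
  assert (th0 : th a = u) by (unfold th; rewrite RInt_point; apply Rplus_0_r).
  exists th. split; [auto|split].
  - set (D := fun t => Derive X t * cos (th t) + Derive Y t * sin (th t)).
    assert (DX2 := fun t => C2_derive2 X t CX). assert (DY2 := fun t => C2_derive2 Y t CY).
    assert (O : forall t, a <= t <= b -> Derive X t * Derive_n X 2 t + Derive Y t * Derive_n Y 2 t = 0).
    { intros t Ht. cut (2 * (Derive X t * Derive_n X 2 t + Derive Y t * Derive_n Y 2 t) = 0); [lra|].
      apply (derive_zero (fun t => Derive X t ^ 2 + Derive Y t ^ 2) a b t); auto.
      - replace (2 * (Derive X t * Derive_n X 2 t + Derive Y t * Derive_n Y 2 t))
          with (INR 2 * Derive_n X 2 t * Derive X t ^ 1 + INR 2 * Derive_n Y 2 t * Derive Y t ^ 1)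
          by (simpl; ring).
        apply (is_derive_plus (V := R_NormedModule)).
        + apply (is_derive_pow (Derive X) 2 t). auto.
        + apply (is_derive_pow (Derive Y) 2 t). auto.
      - intros s Hs. rewrite !HU; auto; lra. }
    set (D' := fun t => Derive_n X 2 t * cos (th t) + Derive X t * (- (k t * sin (th t))) +
        (Derive_n Y 2 t * sin (th t) + Derive Y t * (k t * cos (th t)))).
    assert (DD : forall t, is_derive D t (D' t)).
    { intros t. unfold D.
      assert (Dc : is_derive (fun t => cos (th t)) t (- (k t * sin (th t)))).
      { rewrite Ropp_mult_distr_r. apply (is_derive_comp cos th t (- sin (th t)) (k t)); auto. apply is_derive_Reals, derivable_pt_lim_cos. }
      assert (Ds : is_derive (fun t => sin (th t)) t (k t * cos (th t))).
      { apply (is_derive_comp sin th t (cos (th t)) (k t)); auto. apply is_derive_Reals, derivable_pt_lim_sin. }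
      apply (is_derive_plus (V := R_NormedModule)).
      - apply (is_derive_mult (K := R_AbsRing) (Derive X) (fun t => cos (th t))); auto. intros; apply Rmult_comm.
      - apply (is_derive_mult (K := R_AbsRing) (Derive Y) (fun t => sin (th t))); auto. intros; apply Rmult_comm. }
    assert (DD0 : forall t, a <= t <= b ->
       Derive_n X 2 t * cos (th t) + Derive X t * (- (k t * sin (th t))) +
        (Derive_n Y 2 t * sin (th t) + Derive Y t * (k t * cos (th t))) = 0).
    { intros t Ht. pose proof (O t Ht) as HO. pose proof (HU t Ht) as HUt. unfold k, curvature.
      set (p := Derive X t) in *. set (q := Derive Y t) in *.
      set (p' := Derive_n X 2 t) in *. set (q' := Derive_n Y 2 t) in *.
      assert (Ep : p' = - (p * q' - q * p') * q).
      { transitivity (p' * (p ^ 2 + q ^ 2) - p * (p * p' + q * q')); [rewrite HUt, HO; ring|ring]. }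
      assert (Eq : q' = (p * q' - q * p') * p).
      { transitivity (q' * (p ^ 2 + q ^ 2) - q * (p * p' + q * q')); [rewrite HUt, HO; ring|ring]. }
      transitivity ((p' - - (p * q' - q * p') * q) * cos (th t) + (q' - (p * q' - q * p') * p) * sin (th t));
        [ring|]. rewrite <- Ep, <- Eq. ring. }
    intros t Ht.
    assert (ED : D t = 1).
    { assert (D a = 1).
      { unfold D. rewrite th0, HX, HY. pose proof (sin2_cos2 u) as S2. unfold Rsqr in S2. lra. }
      assert (D t - D a <= 0 - 0).
      { apply (diff_le D (fun _ => 0) D' (fun _ => 0)); [lra| | |].
        - intros; apply DD.
        - intros; apply (is_derive_const (V := R_NormedModule)).
        - intros s Hs. unfold D'. rewrite DD0; lra. }
      assert (0 - 0 <= D t - D a).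
      { apply (diff_le (fun _ => 0) D (fun _ => 0) D'); [lra| | |].
        - intros; apply (is_derive_const (V := R_NormedModule)).
        - intros; apply DD.
        - intros s Hs. unfold D'. rewrite DD0; lra. }
      lra. }
    pose proof (HU t Ht) as HUt. unfold D in ED.
    pose proof (sin2_cos2 (th t)) as S2. unfold Rsqr in S2.
    assert (E : (Derive X t - cos (th t)) ^ 2 + (Derive Y t - sin (th t)) ^ 2 = 0).
    { transitivity (Derive X t ^ 2 + Derive Y t ^ 2 + (sin (th t) * sin (th t) + cos (th t) * cos (th t))
        - 2 * (Derive X t * cos (th t) + Derive Y t * sin (th t))); [ring|rewrite HUt, S2, ED; ring]. }
    rewrite <- !Rsqr_pow2 in E. destruct (Rplus_sqr_eq_0 _ _ E). lra.
  - intros s t Hs Ht.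
    assert (th t - th s <= / rho * t - / rho * s).
    { apply (diff_le th (fun t => / rho * t) k (fun _ => / rho)); [lra| | |].
      - intros; apply Dth.
      - intros; auto_derive; auto; ring.
      - intros r Hrr. pose proof (Rle_abs (k r)). pose proof (HK r ltac:(lra)). unfold k in *. lra. }
    assert (- / rho * t - - / rho * s <= th t - th s).
    { apply (diff_le (fun t => - / rho * t) th (fun _ => - / rho) k); [lra| | |].
      - intros; auto_derive; auto; ring.
      - intros; apply Dth.
      - intros r Hrr. pose proof (Rabs_maj2 (k r)). pose proof (HK r ltac:(lra)). unfold k in *. lra. }
    apply Rabs_le. lra.
Qed.

(** * From a shortest path to a word *)

Definition tame rho (g : path) (n : nat) (s : nat -> R) :=
  Defs.C1 (px g) /\ Defs.C1 (py g) /\ unit_speed g /\ s 0%nat = 0 /\ s n = len g /\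
  forall i, (i < n)%nat -> s i < s (S i) /\
    exists X Y : R -> R, Defs.C2 X /\ Defs.C2 Y /\
      forall t, s i <= t <= s (S i) -> px g t = X t /\ py g t = Y t /\
        (curvature X Y t = 0 \/ rho <= / Rabs (curvature X Y t)).

Lemma tame_range rho g n s i : tame rho g n s -> (i < n)%nat -> 0 <= s i /\ s (S i) <= len g.
Proof.
  intros (_ & _ & _ & H0 & Hn & H) Hi. rewrite <- H0, <- Hn.
  split; apply (subdivision_mono s n); try lia; intros; now apply H.
Qed.

Lemma heading_exists g t : unit_speed g -> 0 <= t <= len g -> exists u, heading g t u.
Proof. intros HU Ht. now apply unit_heading, HU. Qed.

Lemma sub_conn_piece rho g n s i a b u v : tame rho g n s -> (i < n)%nat ->
  s i <= a -> a <= b -> b <= s (S i) -> heading g a u -> heading g b v ->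
  conn rho (px g a) (py g a) u (px g b) (py g b) v (b - a).
Proof.
  intros HT Hi Ha [Hab|<-] Hb [Hu1 Hu2] [Hv1 Hv2].
  2:{ left. repeat split; try ring; congruence. }
  pose proof (tame_range _ _ _ _ _ HT Hi) as Hr.
  destruct HT as (CX & CY & HU & _ & _ & H). destruct (H i Hi) as (_ & X & Y & CX' & CY' & K).
  assert (EX : forall t, a <= t <= b -> Derive (px g) t = Derive X t).
  { apply derive_agree; auto using C2_C1. intros t Ht. apply K. lra. }
  assert (EY : forall t, a <= t <= b -> Derive (py g) t = Derive Y t).
  { apply derive_agree; auto using C2_C1. intros t Ht. apply K. lra. }
  destruct (C2_shift X (- a) CX') as (CX2 & DX & DX2).
  destruct (C2_shift Y (- a) CY') as (CY2 & DY & DY2).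
  assert (Hra : forall z, z - - a = z + a) by (intros; ring).
  pose proof (conn_piece rho (fun t => X (t - - a)) (fun t => Y (t - - a)) u v (b - a)
    ltac:(lra) CX2 CY2) as P.
  cbv beta in P. replace (0 - - a) with a in P by ring. replace (b - a - - a) with b in P by ring.
  rewrite (proj1 (K a ltac:(lra))), (proj1 (proj2 (K a ltac:(lra)))),
    (proj1 (K b ltac:(lra))), (proj1 (proj2 (K b ltac:(lra)))).
  apply P.
  - intros t Ht. unfold curvature. rewrite DX, DY, DX2, DY2, Hra. split.
    + rewrite <- EX, <- EY by lra. apply HU. lra.
    + apply K. lra.
  - rewrite DX. replace (0 - - a) with a by ring. rewrite <- EX by lra. auto.
  - rewrite DY. replace (0 - - a) with a by ring. rewrite <- EY by lra. auto.
  - rewrite DX. replace (b - a - - a) with b by ring. rewrite <- EX by lra. auto.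
  - rewrite DY. replace (b - a - - a) with b by ring. rewrite <- EY by lra. auto.
Qed.

(** Portions of the path itself are the unchanged sides when a window is replaced; induction over
    the pieces joins them across the cut points. *)
Lemma sub_conn rho g n s : tame rho g n s -> forall a b u v, 0 <= a -> a <= b -> b <= len g ->
  heading g a u -> heading g b v -> conn rho (px g a) (py g a) u (px g b) (py g b) v (b - a).
Proof.
  intros HT. pose proof HT as (_ & _ & HU & H0 & Hn & H).
  enough (G : forall i, (i <= n)%nat -> forall a b u v, 0 <= a -> a <= b -> b <= s i ->
    heading g a u -> heading g b v -> conn rho (px g a) (py g a) u (px g b) (py g b) v (b - a)).
  { intros a b u v Ha Hab Hb. rewrite <- Hn in Hb. now apply (G n). }
  induction i as [|i IH]; intros Hi a b u v Ha Hab Hb Hu Hv.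
  - rewrite H0 in Hb. assert (E : a = b) by lra. subst b. left.
    destruct Hu, Hv. repeat split; try ring; congruence.
  - destruct (Rle_lt_dec b (s i)); [apply IH; auto; lia|].
    destruct (Rle_lt_dec (s i) a).
    + apply (sub_conn_piece rho g n s i); auto.
    + destruct (heading_exists g (s i) HU) as [w Hw].
      { pose proof (tame_range _ _ _ _ _ HT Hi). destruct (H i Hi). lra. }
      replace (b - a) with ((s i - a) + (b - s i)) by ring.
      apply (conn_trans rho _ _ _ (px g (s i)) (py g (s i)) w).
      * apply IH; auto; lia || lra.
      * apply (sub_conn_piece rho g n s i); auto; lra.
Qed.

(** Only headings are recorded, as positions follow by integration. The real number [u] accumulates
    the turns, while [heading] sees it modulo 2 pi. *)
Fixpoint traced rho g (w : word) a u b : Prop :=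
  match w with
  | [] => a = b
  | (d, l) :: w' => 0 <= l /\
      (forall t, 0 <= t <= l -> heading g (a + rho * t) (u + sg d * t)) /\
      traced rho g w' (a + rho * l) (u + sg d * l) b
  end.

Lemma traced_app rho g w1 w2 a u b c : traced rho g w1 a u b -> traced rho g w2 b (u + turn w1) c ->
  traced rho g (w1 ++ w2) a u c.
Proof.
  revert a u; induction w1 as [|[d l] w1 IH]; intros a u; simpl.
  - intros -> H. now rewrite Rplus_0_r in H.
  - intros (Hl & Hh & H1) H2. split; [|split]; auto. apply IH; auto.
    now replace (u + sg d * l + turn w1) with (u + (sg d * l + turn w1)) by ring.
Qed.

Lemma traced_heading rho g w a u b : heading g a u -> traced rho g w a u b -> heading g b (u + turn w).
Proof.
  revert a u; induction w as [|[d l] w IH]; intros a u Hu; simpl.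
  - intros <-. now rewrite Rplus_0_r.
  - intros (Hl & Hh & H1). rewrite <- Rplus_assoc. apply (IH (a + rho * l)); auto.
    apply Hh. lra.
Qed.

(** The window lies in one piece, where the heading can be lifted; dividing lengths by [rho] turns
    the curvature bound into the Lipschitz constant 1. *)
Lemma window_traced rho g n s i a b u : 0 < rho -> tame rho g n s -> (i < n)%nat ->
  s i <= a -> a < b -> b <= s (S i) -> b - a <= rho / 4 -> heading g a u ->
  (forall v L, 0 < L -> heading g b v ->
     wr u v L ((px g b - px g a) / rho) ((py g b - py g a) / rho) -> b - a <= rho * L) ->
  exists w, traced rho g w a u b.
Proof.
  intros Hr HT Hi Ha Hab Hb Hs [Hu1 Hu2] Hopt.
  pose proof (tame_range _ _ _ _ _ HT Hi) as Hrg.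
  destruct HT as (CX & CY & HU & _ & _ & H). destruct (H i Hi) as (_ & X & Y & CX' & CY' & K).
  assert (EX : forall t, a <= t <= b -> Derive (px g) t = Derive X t).
  { apply derive_agree; auto using C2_C1. intros t Ht. apply K. lra. }
  assert (EY : forall t, a <= t <= b -> Derive (py g) t = Derive Y t).
  { apply derive_agree; auto using C2_C1. intros t Ht. apply K. lra. }
  destruct (heading_lift rho X Y a b u Hr Hab CX' CY') as (th & th0 & Hth & HL).
  { intros t Ht. rewrite <- EX, <- EY by auto. apply HU. lra. }
  { intros t Ht. apply curvature_le; auto. apply K. lra. }
  { rewrite <- EX by lra. auto. }
  { rewrite <- EY by lra. auto. }
  set (e := (b - a) / rho).
  assert (Ee : rho * e = b - a) by (unfold e; field; lra).
  assert (He : 0 < e <= 1 / 4).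
  { split; [apply Rdiv_lt_0_compat; lra|].
    apply Rmult_le_reg_l with rho; auto. rewrite Ee. lra. }
  assert (Hin : forall t, 0 <= t <= e -> a <= a + rho * t <= b).
  { intros t Ht. assert (0 <= rho * t) by (apply Rmult_le_pos; lra).
    assert (rho * t <= rho * e) by (apply Rmult_le_compat_l; lra). lra. }
  assert (Hend : a + rho * e = b) by lra.
  assert (HS : steered (fun t => px g (a + rho * t) / rho) (fun t => py g (a + rho * t) / rho)
    (fun t => th (a + rho * t)) e).
  { split; [|split].
    - intros t Ht. rewrite <- (proj1 (Hth _ (Hin t Ht))), <- EX by auto.
      auto_derive; [apply CX|].
      change (Derive (fun r => px g r)) with (Derive (px g)). field. lra.
    - intros t Ht. rewrite <- (proj2 (Hth _ (Hin t Ht))), <- EY by auto.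
      auto_derive; [apply CY|].
      change (Derive (fun r => py g r)) with (Derive (py g)). field. lra.
    - intros p t Hp Ht. pose proof (Hin p ltac:(lra)). pose proof (Hin t ltac:(lra)).
      assert (rho * p <= rho * t) by (apply Rmult_le_compat_l; lra).
      replace (t - p) with (/ rho * (a + rho * t - (a + rho * p))) by (field; lra).
      apply HL; lra. }
  assert (Hh : forall t, 0 <= t <= e -> heading g (a + rho * t) (th (a + rho * t))).
  { intros t Ht. pose proof (Hin t Ht) as Ht'. unfold heading. rewrite EX, EY by auto. now apply Hth. }
  destruct (window _ _ _ e HS He) as (d1 & d3 & t1 & m & t3 & phi & H1 & Hm & H3 & Hsum & R1 & R2 & R3).
  { cbv beta. rewrite Rmult_0_r, Rplus_0_r, Hend, th0. intros L HLp Hw.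
    apply Rmult_le_reg_l with rho; auto. rewrite Ee.
    apply (Hopt (th b)); auto.
    - rewrite <- Hend. apply Hh. lra.
    - eapply wr_eq; [exact Hw|..]; auto; field; lra. }
  cbv beta in R1, R2, R3. rewrite Rmult_0_r, Rplus_0_r, th0 in R1.
  assert (Ephi : u + sg d1 * t1 = phi).
  { rewrite <- R1 by lra. apply R2. lra. }
  exists [(d1, t1); (St, m); (d3, t3)]. cbn [traced sg].
  rewrite Ephi, Rmult_0_l, Rplus_0_r.
  split; [auto|]. split.
  { intros t Ht. rewrite <- R1 by lra. apply Hh. lra. }
  split; [auto|]. split.
  { intros t Ht. rewrite Rmult_0_l, Rplus_0_r.
    replace (a + rho * t1 + rho * t) with (a + rho * (t1 + t)) by ring.
    rewrite <- (R2 (t1 + t)) by lra. apply Hh. lra. }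
  split; [auto|]. split.
  { intros t Ht.
    replace (a + rho * t1 + rho * m + rho * t) with (a + rho * (t1 + m + t)) by ring.
    replace (sg d3 * t) with (sg d3 * (t1 + m + t - (t1 + m))) by ring.
    rewrite <- (R3 (t1 + m + t)) by lra. apply Hh. lra. }
  rewrite <- Hend, <- Hsum. ring.
Qed.

(** Induction on the number of windows of length [rho / 4]; the lifted heading [u + turn w1] at the
    end of one window starts the next. *)
Lemma piece_traced rho g n s i : 0 < rho -> tame rho g n s -> (i < n)%nat ->
  (forall a b u v L, 0 <= a -> a < b -> b <= len g -> heading g a u -> 0 < L -> heading g b v ->
     wr u v L ((px g b - px g a) / rho) ((py g b - py g a) / rho) -> b - a <= rho * L) ->
  forall N a b u, s i <= a -> a <= b -> b <= s (S i) -> b - a <= INR N * (rho / 4) ->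
  heading g a u -> exists w, traced rho g w a u b.
Proof.
  intros Hr HT Hi Hopt. pose proof (tame_range _ _ _ _ _ HT Hi) as Hrg.
  induction N as [|N IH]; intros a b u Ha Hab Hb HN Hu.
  - simpl in HN. exists []. simpl. lra.
  - rewrite S_INR in HN. destruct (Rle_lt_dec (b - a) (rho / 4)) as [Hs|Hs].
    + destruct Hab as [Hab|<-]; [|now exists []].
      apply (window_traced rho g n s i); auto.
      intros v L HL Hv Hw. apply (Hopt a b u v L); auto; lra.
    + destruct (window_traced rho g n s i a (a + rho / 4) u) as [w1 H1]; auto; try lra.
      { intros v L HL Hv Hw. apply (Hopt a (a + rho / 4) u v L); auto; lra. }
      destruct (IH (a + rho / 4) b (u + turn w1)) as [w2 H2]; try lra.
      { eapply traced_heading; eauto. }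
      exists (w1 ++ w2). eapply traced_app; eauto.
Qed.

Lemma path_traced rho g n s u : 0 < rho -> tame rho g n s -> heading g 0 u ->
  (forall a b u v L, 0 <= a -> a < b -> b <= len g -> heading g a u -> 0 < L -> heading g b v ->
     wr u v L ((px g b - px g a) / rho) ((py g b - py g a) / rho) -> b - a <= rho * L) ->
  exists w, traced rho g w 0 u (len g).
Proof.
  intros Hr HT Hu Hopt. pose proof HT as (_ & _ & _ & H0 & Hn & H).
  rewrite <- Hn.
  enough (G : forall i, (i <= n)%nat -> exists w, traced rho g w 0 u (s i)) by auto.
  induction i as [|i IH]; intros Hi.
  - exists []. simpl. auto.
  - destruct IH as [w1 H1]; [lia|].
    destruct (H i Hi) as [Hlt _].
    assert (Hq : 0 < rho / 4) by lra.
    destruct (INR_archimed (rho / 4) (s (S i) - s i) Hq) as [N HN].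
    destruct (piece_traced rho g n s i Hr HT Hi Hopt N (s i) (s (S i)) (u + turn w1)) as [w2 H2]; try lra.
    { eapply traced_heading; eauto. }
    exists (w1 ++ w2). eapply traced_app; eauto.
Qed.

(** Windows produce letters of length zero and equal letters on both sides of a boundary; the
    forbidden patterns concern positive, alternating words. *)
Lemma traced_normalize rho g w a u b : 0 < rho -> traced rho g w a u b ->
  exists w', traced rho g w' a u b /\ positive_word w' /\ alternating w'.
Proof.
  intros Hr. revert a u; induction w as [|[d l] w IH]; intros a u; simpl.
  - intros ->. exists []. simpl. repeat split; auto. constructor.
  - intros (Hl & Hh & Ht). destruct (IH _ _ Ht) as (w' & Ht' & Hp & Ha).
    destruct Hl as [Hl|<-].
    2:{ rewrite !Rmult_0_r, !Rplus_0_r in Ht'. eauto. }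
    assert (Hcons : traced rho g ((d, l) :: w') a u b) by (simpl; split; [lra|auto]).
    assert (Hpos : positive_word ((d, l) :: w')) by (constructor; auto).
    destruct w' as [|[d' l'] w'].
    { exists [(d, l)]. split; [exact Hcons|]. split; [exact Hpos|simpl; auto]. }
    assert (D : d = d' \/ d <> d') by (destruct d, d'; auto; right; discriminate).
    destruct D as [<-|D].
    2:{ exists ((d, l) :: (d', l') :: w'). split; [|split]; auto. simpl in *. auto. }
    apply positive_cons in Hp as [Hl' Hp]. destruct Ht' as (_ & Hh' & Ht').
    exists ((d, l + l') :: w'). split; [|split].
    + simpl. split; [lra|]. split.
      * intros t Htt. destruct (Rle_lt_dec t l); [apply Hh; lra|].
        replace (a + rho * t) with (a + rho * l + rho * (t - l)) by ring.
        replace (u + sg d * t) with (u + sg d * l + sg d * (t - l)) by ring. apply Hh'. lra.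
      * replace (a + rho * (l + l')) with (a + rho * l + rho * l') by ring.
        now replace (u + sg d * (l + l')) with (u + sg d * l + sg d * l') by ring.
    + constructor; [simpl; lra|auto].
    + exact Ha.
Qed.

Lemma letter_derive d u s : is_derive (fun t => dX d u t) s (cos (u + sg d * s)) /\
  is_derive (fun t => dY d u t) s (sin (u + sg d * s)).
Proof.
  destruct d; simpl; split; auto_derive; auto; ring_simplify; try f_equal; try ring;
    rewrite ?Rmult_0_l, ?Rplus_0_r; auto; try (f_equal; ring).
Qed.

Lemma letter_position rho g a u d l : 0 < rho -> Defs.C1 (px g) -> Defs.C1 (py g) -> 
  (forall t, 0 <= t <= l -> heading g (a + rho * t) (u + sg d * t)) ->
  forall t, 0 <= t <= l ->
    px g (a + rho * t) = px g a + rho * dX d u t /\ py g (a + rho * t) = py g a + rho * dY d u t.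
Proof.
  intros Hr CX CY Hh t Ht.
  assert (E : forall (f F : R -> R) (f' : R -> R), Defs.C1 f -> F 0 = 0 ->
     (forall s, 0 <= s <= t -> is_derive F s (f' s)) ->
     (forall s, 0 <= s <= t -> Derive f (a + rho * s) = f' s) -> f (a + rho * t) = f a + rho * F t).
  { clear - Hr Ht. intros f F f' Cf F0 HF Hf.
    assert (D1 : forall s, 0 <= s <= t -> is_derive (fun s => f (a + rho * s)) s (rho * f' s)).
    { intros s Hs. rewrite <- Hf by auto.
      apply (is_derive_comp f (fun s => a + rho * s) s (Derive f (a + rho * s)) rho).
      - now apply C1_derive.
      - auto_derive; auto; ring. }
    assert (D2 : forall s, 0 <= s <= t -> is_derive (fun s => rho * F s) s (rho * f' s)).
    { intros s Hs. apply (is_derive_scal F s rho). auto. }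
    pose proof (diff_le _ _ _ _ 0 t (proj1 Ht) D1 D2 (fun s _ => Rle_refl _)) as L1.
    pose proof (diff_le _ _ _ _ 0 t (proj1 Ht) D2 D1 (fun s _ => Rle_refl _)) as L2.
    cbv beta in L1, L2. rewrite F0, !Rmult_0_r, Rplus_0_r in L1, L2. lra. }
  split.
  - apply (E (px g) (dX d u) (fun s => cos (u + sg d * s))); auto.
    + destruct d; simpl; rewrite ?Rplus_0_r, ?Rminus_0_r; ring.
    + intros s _. apply letter_derive.
    + intros s Hs. apply Hh. lra.
  - apply (E (py g) (dY d u) (fun s => sin (u + sg d * s))); auto.
    + destruct d; simpl; rewrite ?Rplus_0_r, ?Rminus_0_r; ring.
    + intros s _. apply letter_derive.
    + intros s Hs. apply Hh. lra.
Qed.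

Lemma traced_displacement rho g w a u b : 0 < rho -> Defs.C1 (px g) -> Defs.C1 (py g) ->
  traced rho g w a u b ->
  b = a + rho * wlen w /\ px g b = px g a + rho * wX u w /\ py g b = py g a + rho * wY u w.
Proof.
  intros Hr CX CY. revert a u; induction w as [|[d l] w IH]; intros a u; simpl.
  - intros ->. rewrite !Rmult_0_r, !Rplus_0_r. auto.
  - intros (Hl & Hh & Ht). destruct (IH _ _ Ht) as (E1 & E2 & E3).
    destruct (letter_position rho g a u d l Hr CX CY Hh l ltac:(lra)) as [P1 P2].
    rewrite E2, E3, P1, P2, E1. repeat split; ring.
Qed.

Definition spells psi (c : letter) (p : dir * R) : Prop :=
  match c with
  | Llet => fst p = Lf
  | Rlet => fst p = Rt
  | Slet => fst p = St
  | Llet_psi => fst p = Lf /\ snd p = psi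
  | Rlet_psi => fst p = Rt /\ snd p = psi
  end.

Lemma traced_end_ge rho g w a u b : 0 < rho -> traced rho g w a u b -> a <= b.
Proof.
  intros Hr. revert a u; induction w as [|[d l] w IH]; intros a u; simpl; [lra|].
  intros (Hl & _ & Ht). apply IH in Ht. assert (0 <= rho * l) by (apply Rmult_le_pos; lra). lra.
Qed.

Lemma letter_traces rho psi g a u d l c : 0 < rho -> Defs.C1 (px g) -> Defs.C1 (py g) ->
  (forall t, 0 <= t <= l -> heading g (a + rho * t) (u + sg d * t)) ->
  spells psi c (d, l) -> traces rho psi g c a (a + rho * l).
Proof.
  intros Hr CX CY Hh Hs.
  assert (P : forall t, a <= t <= a + rho * l ->
    px g t = px g a + rho * dX d u ((t - a) / rho) /\ py g t = py g a + rho * dY d u ((t - a) / rho)).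
  { intros t Ht. set (r := (t - a) / rho). assert (Er : t = a + rho * r) by (unfold r; field; lra).
    rewrite Er. apply (letter_position rho g a u d l); auto.
    split; [|]; apply Rmult_le_reg_l with rho; auto; lra. }
  assert (Hpsi : (a + rho * l - a) / rho = l) by (field; lra).
  assert (PL : d = Lf -> is_ccw_arc rho g a (a + rho * l)).
  (* The centre lies at distance [rho] to the left of the path, and the polar angle seen from it is
     the heading minus PI / 2. *)
  { intros ->. exists (px g a - rho * sin u), (py g a + rho * cos u), (u - PI / 2).
    intros t Ht. destruct (P t Ht) as [-> ->]. simpl.
    replace (u - PI / 2 + (t - a) / rho) with (u + (t - a) / rho - PI / 2) by ring.
    rewrite cos_minus, sin_minus, cos_PI2, sin_PI2. split; ring. }
  assert (PR : d = Rt -> is_cw_arc rho g a (a + rho * l)).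
  { intros ->. exists (px g a + rho * sin u), (py g a - rho * cos u), (u + PI / 2).
    intros t Ht. destruct (P t Ht) as [-> ->]. simpl.
    replace (u + PI / 2 - (t - a) / rho) with (u - (t - a) / rho + PI / 2) by ring.
    rewrite cos_plus, sin_plus, cos_PI2, sin_PI2. split; ring. }
  destruct c; simpl in *; auto.
  - exists u. intros t Ht. destruct (P t Ht) as [-> ->]. rewrite Hs. simpl. split; field; lra.
  - destruct Hs as [H1 H2]. rewrite Hpsi. auto.
  - destruct Hs as [H1 H2]. rewrite Hpsi. auto.
Qed.

Lemma traced_follows rho psi g w ls a u b : 0 < rho -> Defs.C1 (px g) -> Defs.C1 (py g) ->
  traced rho g w a u b -> positive_word w -> Forall2 (spells psi) ls w -> follows rho psi g ls a b.
Proof.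
  intros Hr CX CY Ht Hp Hs. revert a u Ht Hp; induction Hs as [|c [d l] ls w Hc Hs IH]; intros a u.
  - simpl. auto.
  - intros (Hl & Hh & Ht) Hp. apply positive_cons in Hp as [Hl' Hp].
    exists (a + rho * l). split; [|split].
    + split; [|now apply traced_end_ge in Ht].
      assert (0 < rho * l) by (apply Rmult_lt_0_compat; auto). lra.
    + eapply letter_traces; eauto.
    + eapply IH; eauto.
Qed.

(** * End headings modulo 2 pi *)

Definition allowed lo hi (u : R) := exists t, lo <= t <= hi /\ cos t = cos u /\ sin t = sin u.

(** Unless [hi] itself represents the heading, the representative lies strictly below [hi] and has
    room to grow. *)
Lemma allowed_canInc lo hi u : allowed lo hi u -> ~ (cos hi = cos u /\ sin hi = sin u) ->
  canInc (allowed lo hi) u.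
Proof.
  intros (t & Ht & E1 & E2) N.
  assert (t <> hi) by (intros ->; auto).
  exists (hi - t). split; [lra|]. intros r Hr. exists (t + r). split; [lra|].
  rewrite !cos_plus, !sin_plus, E1, E2. auto.
Qed.

Lemma allowed_canDec lo hi u : allowed lo hi u -> ~ (cos lo = cos u /\ sin lo = sin u) ->
  canDec (allowed lo hi) u.
Proof.
  intros (t & Ht & E1 & E2) N.
  assert (t <> lo) by (intros ->; auto).
  exists (t - lo). split; [lra|]. intros r Hr. exists (t - r). split; [lra|].
  rewrite !cos_minus, !sin_minus, E1, E2. auto.
Qed.

Lemma heading_cases lo hi g t u : allowed lo hi u -> heading g t u ->
  (heading g t hi \/ canInc (allowed lo hi) u) /\ (heading g t lo \/ canDec (allowed lo hi) u) /\
  (heading g t hi \/ heading g t lo \/ exists th, lo < th < hi /\ heading g t th).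
Proof.
  intros Ha [H1 H2]. unfold heading. rewrite H1, H2.
  assert (Dhi : (cos hi = cos u /\ sin hi = sin u) \/ ~ (cos hi = cos u /\ sin hi = sin u)).
  { destruct (Req_dec (cos hi) (cos u)); [|right; tauto].
    destruct (Req_dec (sin hi) (sin u)); [left|right]; tauto. }
  assert (Dlo : (cos lo = cos u /\ sin lo = sin u) \/ ~ (cos lo = cos u /\ sin lo = sin u)).
  { destruct (Req_dec (cos lo) (cos u)); [|right; tauto].
    destruct (Req_dec (sin lo) (sin u)); [left|right]; tauto. }
  split; [|split].
  - destruct Dhi as [[]|N]; [left; auto|right; now apply allowed_canInc].
  - destruct Dlo as [[]|N]; [left; auto|right; now apply allowed_canDec].
  - destruct Dhi as [[]|N]; [left; auto|]. destruct Dlo as [[]|N']; [right; left; auto|].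
    right. right. destruct Ha as (th & Hth & E1 & E2). exists th.
    assert (th <> hi) by (intros ->; auto). assert (th <> lo) by (intros ->; auto).
    split; [lra|auto].
Qed.

Lemma conn_feasible rho x1 y1 x2 y2 t1min t1max t2min t2max u v L :
  conn rho x1 y1 u x2 y2 v L -> 0 < L -> allowed t1min t1max u -> allowed t2min t2max v ->
  exists h, feasible rho x1 y1 x2 y2 t1min t1max t2min t2max h /\ len h = L.
Proof.
  intros [(-> & _)|[h (E & HL & CX & CY & U & P & X1 & Y1 & X2 & Y2 & [U1 U2] & [V1 V2])]];
    [intros; lra|].
  intros _ (td & Htd & D1 & D2) (ta & Hta & A1 & A2). exists h. split; auto.
  subst L. split; [|split; [|split; [|split; [|split; [|split; [|split; [|split; [|split; [|split]]]]]]]]]; auto.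
  - exists td. split; auto. unfold departs, heading. rewrite D1, D2. auto.
  - exists ta. split; auto. unfold arrives, heading. rewrite A1, A2. auto.
Qed.

(** * The theorem *)

Lemma shortest_solution rho x1 y1 x2 y2 t1min t1max t2min t2max g :
  0 < rho -> shortest rho x1 y1 x2 y2 t1min t1max t2min t2max g ->
  exists u w, heading g 0 u /\ traced rho g w 0 u (len g) /\ alternating w /\
    solution (allowed t1min t1max) (allowed t2min t2max) u w.
Proof.
  intros Hr [(Hlen & CX & CY & HU & (n & s & S0 & Sn & HP) & X1 & Y1 & X2 & Y2 &
    (td & Htd & [D1 D2]) & (ta & Hta & [A1 A2])) Hmin].
  assert (HT : tame rho g n s) by (split; [|split; [|split; [|split; [|split]]]]; auto).
  assert (Itd : allowed t1min t1max td) by (exists td; auto).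
  assert (Jta : allowed t2min t2max ta) by (exists ta; auto).
  assert (Hopt : forall a b u v L, 0 <= a -> a < b -> b <= len g -> heading g a u -> 0 < L ->
    heading g b v -> wr u v L ((px g b - px g a) / rho) ((py g b - py g a) / rho) ->
    b - a <= rho * L).
  (* Splicing the word in place of the portion between [a] and [b] gives a feasible path, so each
     portion is itself shortest among words with its end data. *)
  { intros a b u v L Ha Hab Hb Hu HL Hv Hw.
    assert (K1 : conn rho (px g 0) (py g 0) td (px g a) (py g a) u (a - 0))
      by (apply (sub_conn rho g n s); auto; try lra; split; auto).
    assert (K3 : conn rho (px g b) (py g b) v (px g (len g)) (py g (len g)) ta (len g - b))
      by (apply (sub_conn rho g n s); auto; try lra; split; auto).
    assert (K2 := wr_conn rho _ _ _ _ _ Hr Hw (px g a) (py g a)).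
    replace (px g a + rho * ((px g b - px g a) / rho)) with (px g b) in K2 by (field; lra).
    replace (py g a + rho * ((py g b - py g a) / rho)) with (py g b) in K2 by (field; lra).
    assert (K := conn_trans _ _ _ _ _ _ _ _ _ _ _ _ (conn_trans _ _ _ _ _ _ _ _ _ _ _ _ K1 K2) K3).
    rewrite X1, Y1, X2, Y2 in K.
    assert (0 < rho * L) by (apply Rmult_lt_0_compat; auto).
    destruct (conn_feasible _ _ _ _ _ t1min t1max t2min t2max _ _ _ K ltac:(lra) Itd Jta) as (h & Hf & Eh).
    pose proof (Hmin h Hf). lra. }
  destruct (path_traced rho g n s td Hr HT (conj D1 D2) Hopt) as [w0 Hw0].
  destruct (traced_normalize _ _ _ _ _ _ Hr Hw0) as (w & Hw & Hpos & Halt).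
  exists td, w. split; [split; auto|]. split; auto. split; auto.
  destruct (traced_displacement _ _ _ _ _ _ Hr CX CY Hw) as (E1 & E2 & E3).
  split; auto. split; [|split; auto].
  - destruct (traced_heading rho g w 0 td (len g) (conj D1 D2) Hw) as [T1 T2].
    exists ta. split; auto. split; congruence.
  - intros o e L Io Je HL Hwr.
    assert (K := wr_conn rho _ _ _ _ _ Hr Hwr x1 y1).
    rewrite <- X1 in K at 2. rewrite <- Y1 in K at 2. rewrite <- E2, <- E3, X2, Y2 in K.
    destruct (conn_feasible _ _ _ _ _ t1min t1max t2min t2max _ _ _ K
      (Rmult_lt_0_compat _ _ Hr HL) Io Je) as (h & Hf & Eh).
    pose proof (Hmin h Hf). apply Rmult_le_reg_l with rho; auto. lra.
Qed.

Lemma of_type_intro rho g w u W ls psi : 0 < rho -> Defs.C1 (px g) -> Defs.C1 (py g) ->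
  traced rho g w 0 u (len g) -> positive_word w ->
  PI < psi -> In ls (subwords W) -> Forall2 (spells psi) ls w -> of_type rho g W.
Proof.
  intros Hr CX CY Ht Hp Hpsi Hin Hs. exists psi. split; auto. exists ls. split; auto.
  eapply traced_follows; eauto.
Qed.

Ltac member := simpl; repeat (first [left; reflexivity | right]).

Ltac pick := first [solve [left; auto 7] | solve [auto 7] | right; pick].
Ltac cases H := match type of H with _ \/ _ => destruct H as [H|H]; [|cases H] | _ => idtac end.

(* [ls] is the degenerate form of the type [W] that the path follows. *)
Ltac typ W ls := match goal with T : forall W ls, _ -> _ -> of_type ?rho ?g W |- _ =>
  assert (of_type rho g W) by (apply (T W ls); [member|repeat constructor]) end.
Ltac typ_psi W ls psi := match goal with OT : forall W ls psi, _ -> _ -> _ -> of_type ?rho ?g W |- _ =>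
  assert (of_type rho g W) by (apply (OT W ls psi); [auto|member|repeat constructor]) end.
Ltac at_end H := refine (eq_ind _ _ H _ _); simpl; ring.
(** Splits each end heading into maximal, minimal and interior, then searches for an available
    alternative; clearing the general rules first keeps the search small. *)
Ltac finish := repeat match goal with H : forall _, _ |- _ => clear H end;
  match goal with Sc : departs _ _ \/ departs _ _ \/ _, Ec : arrives _ _ \/ arrives _ _ \/ _ |- _ =>
    cases Sc; cases Ec end;
  repeat match goal with H : _ \/ departs _ _ |- _ => destruct H | H : _ \/ arrives _ _ |- _ => destruct H end;
  pick.

Theorem theorem1 (rho x1 y1 x2 y2 t1min t1max t2min t2max : R) (g : path)
  (hrho : 0 < rho)
  (h1min : 0 <= t1min) (h1 : t1min < t1max) (h1max : t1max <= 2 * PI)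
  (h2min : 0 <= t2min) (h2 : t2min < t2max) (h2max : t2max <= 2 * PI)
  (hg : shortest rho x1 y1 x2 y2 t1min t1max t2min t2max g) :
  (of_type rho g [Slet] \/ of_type rho g [Llet_psi] \/
   of_type rho g [Rlet_psi] \/ of_type rho g [Llet_psi; Rlet_psi] \/
   of_type rho g [Rlet_psi; Llet_psi])
  \/ (departs g t1max /\ arrives g t2max /\ of_type rho g [Llet; Slet; Rlet])
  \/ (departs g t1max /\ arrives g t2min /\
      (of_type rho g [Llet; Slet; Llet] \/ of_type rho g [Llet; Rlet_psi; Llet]))
  \/ (departs g t1min /\ arrives g t2min /\ of_type rho g [Rlet; Slet; Llet])
  \/ (departs g t1min /\ arrives g t2max /\
      (of_type rho g [Rlet; Slet; Rlet] \/ of_type rho g [Rlet; Llet_psi; Rlet]))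
  \/ (departs g t1max /\ (exists ta, t2min < ta < t2max /\ arrives g ta) /\
      (of_type rho g [Llet; Slet] \/ of_type rho g [Llet; Rlet_psi]))
  \/ (departs g t1min /\ (exists ta, t2min < ta < t2max /\ arrives g ta) /\
      (of_type rho g [Rlet; Slet] \/ of_type rho g [Rlet; Llet_psi]))
  \/ ((exists td, t1min < td < t1max /\ departs g td) /\ arrives g t2max /\
      (of_type rho g [Slet; Rlet] \/ of_type rho g [Llet_psi; Rlet]))
  \/ ((exists td, t1min < td < t1max /\ departs g td) /\ arrives g t2min /\
      (of_type rho g [Slet; Llet] \/ of_type rho g [Rlet_psi; Llet])).
Proof.
  destruct (shortest_solution _ _ _ _ _ _ _ _ _ _ hrho hg) as (u & w & Hu & Ht & Ha & Hs).
  assert (CX : Defs.C1 (px g)) by apply hg. assert (CY : Defs.C1 (py g)) by apply hg.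
  pose proof (traced_heading _ _ _ _ _ _ Hu Ht) as Hv.
  destruct (heading_cases t1min t1max g 0 u (proj1 Hs) Hu) as (SM & Sm & Sc).
  destruct (heading_cases t2min t2max g (len g) _ (proj1 (proj2 Hs)) Hv) as (EM & Em & Ec).
  change (heading g 0 t1max) with (departs g t1max) in *.
  change (heading g 0 t1min) with (departs g t1min) in *.
  change (heading g (len g) t2max) with (arrives g t2max) in *.
  change (heading g (len g) t2min) with (arrives g t2min) in *.
  change (exists th, t1min < th < t1max /\ heading g 0 th) with
    (exists td, t1min < td < t1max /\ departs g td) in Sc.
  change (exists th, t2min < th < t2max /\ heading g (len g) th) with
    (exists ta, t2min < ta < t2max /\ arrives g ta) in Ec.
  set (Di := exists td, t1min < td < t1max /\ departs g td) in *.
  set (Ai := exists ta, t2min < ta < t2max /\ arrives g ta) in *.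
  pose proof (solution_pos _ _ _ _ Hs) as Hp.
  pose proof (solution_size _ _ _ _ Hs Ha) as Hsize.
  pose proof (fun W ls psi => of_type_intro rho g w u W ls psi hrho CX CY Ht Hp) as OT.
  set (I := allowed t1min t1max) in *. set (J := allowed t2min t2max) in *.
  clearbody Di Ai I J.
  pose proof PI_RGT_0 as Hpi.
  assert (Hpi2 : PI < 2 * PI) by lra.
  (* Without a subscripted letter any [psi > PI] is a valid witness; 2 PI is taken. *)
  assert (T : forall W ls, In ls (subwords W) -> Forall2 (spells (2 * PI)) ls w -> of_type rho g W)
    by (intros W ls; now apply OT).
  destruct w as [|[d1 a] [|[d2 b] [|[d3 c] [|? ?]]]]; [| | | |simpl in Hsize; lia].
  - exfalso. simpl in Ht. assert (0 < len g) by apply hg. lra.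
  - destruct d1.
    + destruct (Rlt_le_dec PI a) as [Hpa|Hpa].
      * typ_psi [Llet_psi] [Llet_psi] a. finish.
      (* A left arc of turn at most PI is not soft at both ends. Whichever end is blocked, each
         possible heading at the other end makes the arc a degenerate form of a listed type. *)
      * assert (departs g t1max \/ arrives g t2min).
        { destruct SM as [|SM]; auto. destruct Em as [|Em]; auto. exfalso.
          apply (Rle_not_lt _ _ Hpa), (left_arc_long I J u [] a [] Hs); left; split; auto. at_end Em. }
        typ [Llet; Slet; Rlet] [Llet]. typ [Llet; Slet; Llet] [Llet]. typ [Llet; Slet] [Llet].
        typ [Rlet; Slet; Llet] [Llet]. typ [Slet; Llet] [Llet]. finish.
    + destruct (Rlt_le_dec PI a) as [Hpa|Hpa].
      * typ_psi [Rlet_psi] [Rlet_psi] a. finish.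
      * assert (departs g t1min \/ arrives g t2max).
        { destruct Sm as [|Sm]; auto. destruct EM as [|EM]; auto. exfalso.
          apply (Rle_not_lt _ _ Hpa), (right_arc_long I J u [] a [] Hs); left; split; auto. at_end EM. }
        typ [Rlet; Slet; Rlet] [Rlet]. typ [Rlet; Slet; Llet] [Rlet]. typ [Rlet; Slet] [Rlet].
        typ [Llet; Slet; Rlet] [Rlet]. typ [Slet; Rlet] [Rlet]. finish.
    + typ [Slet] [Slet]. finish.
  - destruct Ha as [Ha _]. destruct d1, d2; try (exfalso; now apply Ha).
    + destruct (left_arc_short I J u [] a [(Rt, b)] Hs) as [Ha2|(_ & _ & ?)]; [|discriminate].
      destruct (right_arc_short I J u [(Lf, a)] b [] Hs) as [Hb2|(_ & ? & _)]; [|discriminate].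
      assert (HB : arrives g t2max \/ PI < b /\ a <= b).
      { destruct EM as [|EM]; auto. right. apply (left_right_le I J u [] a b [] Hs); auto.
        left. split; auto. at_end EM. }
      assert (HA : departs g t1max \/ PI < a /\ b <= a).
      { destruct SM as [|SM]; auto. right. apply (left_right_ge I J u [] a b [] Hs); auto.
        left. split; auto. }
      (* An arc at an unblocked end of the path turns by more than PI and carries the subscript; if
         neither end is blocked, the two inequalities give [a = b]. *)
      destruct HA as [HA|[HA1 HA2]], HB as [HB|[HB1 HB2]].
      * typ [Llet; Slet; Rlet] [Llet; Rlet]. finish.
      * typ_psi [Llet; Rlet_psi; Llet] [Llet; Rlet_psi] b. typ_psi [Llet; Rlet_psi] [Llet; Rlet_psi] b.
        typ [Llet; Slet; Rlet] [Llet; Rlet]. finish.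
      * typ_psi [Rlet; Llet_psi; Rlet] [Llet_psi; Rlet] a. typ_psi [Llet_psi; Rlet] [Llet_psi; Rlet] a.
        typ [Llet; Slet; Rlet] [Llet; Rlet]. finish.
      * assert (a = b) by lra. subst b. typ_psi [Llet_psi; Rlet_psi] [Llet_psi; Rlet_psi] a. finish.
    + assert (departs g t1max).
      { destruct SM as [|SM]; auto. exfalso. apply (left_line_soft I J u [] a b [] Hs). left. auto. }
      typ [Llet; Slet; Rlet] [Llet; Slet]. typ [Llet; Slet; Llet] [Llet; Slet].
      typ [Llet; Slet] [Llet; Slet]. finish.
    + destruct (right_arc_short I J u [] a [(Lf, b)] Hs) as [Ha2|(_ & _ & ?)]; [|discriminate].
      destruct (left_arc_short I J u [(Rt, a)] b [] Hs) as [Hb2|(_ & ? & _)]; [|discriminate].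
      assert (HB : arrives g t2min \/ PI < b /\ a <= b).
      { destruct Em as [|Em]; auto. right. apply (right_left_le I J u [] a b [] Hs); auto.
        left. split; auto. at_end Em. }
      assert (HA : departs g t1min \/ PI < a /\ b <= a).
      { destruct Sm as [|Sm]; auto. right. apply (right_left_ge I J u [] a b [] Hs); auto.
        left. split; auto. }
      destruct HA as [HA|[HA1 HA2]], HB as [HB|[HB1 HB2]].
      * typ [Rlet; Slet; Llet] [Rlet; Llet]. finish.
      * typ_psi [Rlet; Llet_psi; Rlet] [Rlet; Llet_psi] b. typ_psi [Rlet; Llet_psi] [Rlet; Llet_psi] b.
        typ [Rlet; Slet; Llet] [Rlet; Llet]. finish.
      * typ_psi [Llet; Rlet_psi; Llet] [Rlet_psi; Llet] a. typ_psi [Rlet_psi; Llet] [Rlet_psi; Llet] a.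
        typ [Rlet; Slet; Llet] [Rlet; Llet]. finish.
      * assert (a = b) by lra. subst b. typ_psi [Rlet_psi; Llet_psi] [Rlet_psi; Llet_psi] a. finish.
    + assert (departs g t1min).
      { destruct Sm as [|Sm]; auto. exfalso. apply (right_line_soft I J u [] a b [] Hs). left. auto. }
      typ [Rlet; Slet; Llet] [Rlet; Slet]. typ [Rlet; Slet; Rlet] [Rlet; Slet].
      typ [Rlet; Slet] [Rlet; Slet]. finish.
    + assert (arrives g t2min).
      { destruct Em as [|Em]; auto. exfalso. apply (line_left_soft I J u [] a b [] Hs). left.
        split; auto. at_end Em. }
      typ [Rlet; Slet; Llet] [Slet; Llet]. typ [Llet; Slet; Llet] [Slet; Llet].
      typ [Slet; Llet] [Slet; Llet]. finish.
    + assert (arrives g t2max).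
      { destruct EM as [|EM]; auto. exfalso. apply (line_right_soft I J u [] a b [] Hs). left.
        split; auto. at_end EM. }
      typ [Llet; Slet; Rlet] [Slet; Rlet]. typ [Rlet; Slet; Rlet] [Slet; Rlet].
      typ [Slet; Rlet] [Slet; Rlet]. finish.
  (* An arc next to a middle segment must be blocked at its outer end, which determines the end
     heading from its orientation. *)
  - assert (DM : d1 = Lf -> d2 = St -> departs g t1max).
    { intros -> ->. destruct SM as [|SM]; auto. exfalso.
      apply (left_line_soft I J u [] a b [(d3, c)] Hs). left. auto. }
    assert (Dm : d1 = Rt -> d2 = St -> departs g t1min).
    { intros -> ->. destruct Sm as [|Sm]; auto. exfalso.
      apply (right_line_soft I J u [] a b [(d3, c)] Hs). left. auto. }
    assert (AM : d2 = St -> d3 = Rt -> arrives g t2max).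
    { intros -> ->. destruct EM as [|EM]; auto. exfalso.
      apply (line_right_soft I J u [(d1, a)] b c [] Hs). left. split; auto. at_end EM. }
    assert (Am : d2 = St -> d3 = Lf -> arrives g t2min).
    { intros -> ->. destruct Em as [|Em]; auto. exfalso.
      apply (line_left_soft I J u [(d1, a)] b c [] Hs). left. split; auto. at_end Em. }
    destruct Ha as (Ha1 & Ha2 & _). destruct d1, d2, d3; try (exfalso; now apply Ha1);
      try (exfalso; now apply Ha2);
      try (exfalso; apply (no_line_arc _ _ _ _ _ _ _ _ _ Hs); congruence);
      try (exfalso; apply (no_arc_line I J u [] _ _ _ _ _ _ Hs); congruence).
    + assert (PI < b).
      { apply (right_arc_long I J u [(Lf, a)] b [(Lf, c)] Hs); right; [exists [], a|exists [], c]; auto. }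
      assert (departs g t1max).
      { destruct SM as [|SM]; auto. exfalso.
        apply (left_right_left_softS I J u [] a b c [] Hs). left. auto. }
      assert (arrives g t2min).
      { destruct Em as [|Em]; auto. exfalso.
        apply (left_right_left_softE I J u [] c b a [] Hs). left. split; auto. at_end Em. }
      typ_psi [Llet; Rlet_psi; Llet] [Llet; Rlet_psi; Llet] b. finish.
    + specialize (DM eq_refl eq_refl). specialize (Am eq_refl eq_refl). typ [Llet; Slet; Llet] [Llet; Slet; Llet]. finish.
    + specialize (DM eq_refl eq_refl). specialize (AM eq_refl eq_refl). typ [Llet; Slet; Rlet] [Llet; Slet; Rlet]. finish.
    + assert (PI < b).
      { apply (left_arc_long I J u [(Rt, a)] b [(Rt, c)] Hs); right; [exists [], a|exists [], c]; auto. }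
      assert (departs g t1min).
      { destruct Sm as [|Sm]; auto. exfalso.
        apply (right_left_right_softS I J u [] a b c [] Hs). left. auto. }
      assert (arrives g t2max).
      { destruct EM as [|EM]; auto. exfalso.
        apply (right_left_right_softE I J u [] c b a [] Hs). left. split; auto. at_end EM. }
      typ_psi [Rlet; Llet_psi; Rlet] [Rlet; Llet_psi; Rlet] b. finish.
    + specialize (Dm eq_refl eq_refl). specialize (Am eq_refl eq_refl). typ [Rlet; Slet; Llet] [Rlet; Slet; Llet]. finish.
    + specialize (Dm eq_refl eq_refl). specialize (AM eq_refl eq_refl). typ [Rlet; Slet; Rlet] [Rlet; Slet; Rlet]. finish.
Qed.
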